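(* Let $(W,S)$ be a Coxeter system of finite rank. Let $N(W)$ be the normal closure in $W$ of the subgroups $N(\langle B\rangle)$ (defined in the context according to the type of $B$) for every base $B$ of $(W,S)$ of rank greater than $2$. Let $W^{(2)}=W/N(W)$, let $\eta:W\to W^{(2)}$ be the quotient homomorphism, and let $S^{(2)}=\eta(S)$. Then the pair $(W^{(2)},S^{(2)})$ is a Coxeter system that can be obtained from $(W,S)$ by a finite series of elementary edge quotient operations. The group $N(W)$ is a characteristic subgroup of $W$ that does not depend on the choice of Coxeter generators $S$ of $W$.
   Context: A Coxeter matrix is a symmetric matrix $M=(m(s,t))_{s,t\in S}$ with each $m(s,t)$ a positive integer or $\infty$, and $m(s,t)=1$ if and only if $s=t$. A Coxeter system with Coxeter matrix $M$ is a pair $(W,S)$ where $W$ is a group generated by $S\subset W$ with presentation $W=\langle S \mid (st)^{m(s,t)} : s,t\in S,\ m(s,t)<\infty\rangle$; then $m(s,t)$ is the order of $st$ in $W$, and $S$ is called a set of Coxeter generators for $W$. The rank is $|S|$. A visual subgroup of $(W,S)$ is a subgroup $\langle A\rangle$ with $A\subset S$; $(\langle A\rangle,A)$ is again a Coxeter system. $\langle A\rangle$ is irreducible if the graph with vertex set $A$ and an edge joining $s,t$ whenever $m(s,t)>2$ (labeled $m(s,t)$; the C-diagram) is connected. A basic subgroup of $(W,S)$ is a noncyclic, maximal, finite, irreducible, visual subgroup $\langle B\rangle$ of $(W,S)$ (maximal among the finite irreducible visual subgroups); the set $B\subset S$ is then called a base of $(W,S)$, and its rank is $|B|$. The finite irreducible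 Coxeter systems of rank $n\ge 3$ are, in Coxeter's notation (subscript = rank), the following. $\mathbf{A}_n$: C-diagram a path with all labels $3$. $\mathbf{B}_n$ ($n\ge4$): Y-shaped diagram with all labels $3$ and two short arms consisting of single edges (Bourbaki's $D_n$). $\mathbf{C}_n$: path with all labels $3$ except the last edge, labeled $4$ (Bourbaki's $B_n$). $\mathbf{E}_6,\mathbf{E}_7,\mathbf{E}_8$: star-shaped with three arms and all labels $3$, one arm of length one and another of length two. $\mathbf{F}_4$: path with labels $3,4,3$. $\mathbf{G}_3$: path with labels $3,5$ (Bourbaki's $H_3$). $\mathbf{G}_4$: path with labels $3,3,5$ (Bourbaki's $H_4$). For a base $B$ of rank $n\geq 3$, the subgroup $N(\langle B\rangle)$ of $\langle B\rangle$ is defined as follows. If $n\ge5$ or $B$ has type $\mathbf{A}_4$, $\mathbf{G}_3$ or $\mathbf{G}_4$, then $N(\langle B\rangle)$ is the commutator subgroup of $\langle B\rangle$. Otherwise $N(\langle B\rangle)$ is the normal closure in $\langle B\rangle$ of the following elements: - type $\mathbf{A}_3$, $B=\{a_1,a_2,a_3\}$ with $m(a_1,a_2)=m(a_2,a_3)=3$: the element $a_1a_3$; - type $\mathbf{B}_4$, $B=\{b_1,b_2,b_3,b_4\}$ with $m(b_1,b_4)=m(b_2,b_4)=m(b_3,b_4)=3$: the elements $b_1b_2$ and $b_2b_3$; - type $\mathbf{C}_3$, $B=\{c_1,c_2,c_3\}$ with $m(c_1,c_2)=3$, $m(c_2,c_3)=4$: the element $(c_2c_3)^2$; - type $\mathbf{C}_4$,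 $B=\{c_1,c_2,c_3,c_4\}$ with $m(c_1,c_2)=m(c_2,c_3)=3$, $m(c_3,c_4)=4$: the element $c_1c_3$; - type $\mathbf{F}_4$, $B=\{f_1,f_2,f_3,f_4\}$ with $m(f_1,f_2)=m(f_3,f_4)=3$, $m(f_2,f_3)=4$: the element $(f_2f_3)^2$. (All unmentioned pairs of distinct generators commute.) Elementary edge quotient operations on a finite rank Coxeter system $(W,S)$ are of two kinds, for distinct $s,t\in S$ with $m=m(s,t)<\infty$. (1) Edge label reduction: for a divisor $d$ of $m$ with $1<d<m$, let $N$ be the normal closure of $(st)^d$ in $W$ and pass to $(W/N,\{rN: r\in S\})$; this is the Coxeter system whose Coxeter matrix is obtained by replacing $m(s,t)=m$ by $d$. (2) Edge elimination: let $N$ be the normal closure of $st$ in $W$ and pass to $(W/N,\{rN: r\in S\})$; this is a Coxeter system, obtained by identifying $t$ with $s$, replacing the labels of coalesced edges by their greatest common divisor, and further identifying generators whenever a greatest common divisor equals $1$. Independence of the choice of $S$ means: if $S'$ is any other set of Coxeter generators of $W$, the subgroup constructed from $S'$ in the same way equals the one constructed from $S$. *)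

(* Defs.v *)
From HB Require Import structures.
From mathcomp Require Import all_boot.
From mathcomp Require Import boolp classical_sets functions cardinality.

Set Implicit Arguments.
Unset Strict Implicit.
Unset Printing Implicit Defensive.

Local Open Scope quotient_scope.
Local Open Scope classical_set_scope.
Local Open Scope card_scope.
Local Open Scope group_scope.

Section Subgroups.
Variable G : groupType.
Implicit Types A H K : set G.

Definition is_subgroup H :=
  [/\ H 1, (forall x y, H x -> H y -> H (x * y)) & forall x, H x -> H x^-1].

Definition generated A : set G := smallest is_subgroup A.

Definition is_normal H K :=
  [/\ is_subgroup K, K `<=` H & forall x h, K x -> H h -> K (x ^ h)].

(* Meant for A `<=` H. *)
Definition normal_closure H A : set G := smallest (is_normal H) A.

Definition commutator_subgroup H : set G :=
  generated [set z | exists x y, [/\ H x, H y & z = [~ x, y]]].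

Definition is_cyclic H := exists x, H = generated [set x].

Definition characteristic H :=
  forall phi : {multiplicative G -> G}, bijective phi -> phi @` H = H.

Lemma is_subgroupT : is_subgroup setT.
Proof. by split. Qed.

Lemma normal_closureT_normal A : is_normal setT (normal_closure setT A).
Proof.
split=> [|//|x h Nx _ K [nK sAK]]; last first.
  by case: (nK) => _ _; apply=> //; exact: Nx.
split=> [K [[[K1 _ _] _ _] _]//|x y Nx Ny K hK|x Nx K hK].
  by case: (hK) => -[[_ KM _] _ _] _; apply: KM; [exact: Nx|exact: Ny].
by case: (hK) => -[[_ _ KV] _ _] _; apply: KV; exact: Nx.
Qed.

Record normal_subgroup := NormalSubgroup {
  nsval :> set G;
  nsvalP : is_normal setT nsval }.

Definition ncl A : normal_subgroup :=
  NormalSubgroup (normal_closureT_normal A).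

End Subgroups.

Section Quotient.
Variables (G : groupType) (N : normal_subgroup G).

Definition coset_rel : rel G := fun x y => `[< nsval N (x^-1 * y) >].

Lemma coset_rel_refl : reflexive coset_rel.
Proof. by move=> x; apply/asboolP; rewrite mulVg; case: (nsvalP N) => -[]. Qed.

Lemma coset_rel_sym : symmetric coset_rel.
Proof.
have sym x y : coset_rel x y -> coset_rel y x.
  move=> /asboolP Nxy; apply/asboolP.
  by case: (nsvalP N) => -[_ _ NV] _ _; have := NV _ Nxy; rewrite invgM invgK.
by move=> x y; apply/idP/idP; exact: sym.
Qed.

Lemma coset_rel_trans : transitive coset_rel.
Proof.
move=> y x z /asboolP Nxy /asboolP Nyz; apply/asboolP.
by case: (nsvalP N) => -[_ NM _] _ _; have := NM _ _ Nxy Nyz; rewrite -mulgA mulVKg.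
Qed.

Canonical coset_equiv :=
  EquivRel coset_rel coset_rel_refl coset_rel_sym coset_rel_trans.

Definition quot := {eq_quot coset_equiv}.
HB.instance Definition _ := Choice.on quot.

Definition eta (x : G) : quot := \pi_({eq_quot coset_equiv}) x.

Lemma etaP x y : eta x = eta y <-> nsval N (x^-1 * y).
Proof.
by rewrite /eta; split=> [/eqmodP/asboolP//|Nxy]; apply/eqmodP/asboolP.
Qed.

Definition quot_repr (u : quot) : G := repr (u : {eq_quot coset_equiv}).

Lemma quot_reprK : cancel quot_repr eta. Proof. exact: reprK. Qed.

Definition quot_one : quot := eta 1.
Definition quot_mul (u v : quot) : quot := eta (quot_repr u * quot_repr v).
Definition quot_inv (u : quot) : quot := eta (quot_repr u)^-1.

Lemma eta_mul x y : quot_mul (eta x) (eta y) = eta (x * y).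
Proof.
apply/etaP; case: (nsvalP N) => -[_ NM _] _ NJ.
have /etaP Nx := quot_reprK (eta x); have /etaP Ny := quot_reprK (eta y).
have := NM _ _ (NJ _ (quot_repr (eta y)) Nx I) Ny.
by congr (nsval N _); rewrite /conjg invgM !mulgA mulgK.
Qed.

Lemma eta_inv x : quot_inv (eta x) = eta x^-1.
Proof.
apply/etaP; case: (nsvalP N) => -[_ _ NV] _ NJ.
have /etaP Nx := quot_reprK (eta x).
have := NJ _ x^-1 (NV _ Nx) I.
by congr (nsval N _); rewrite /conjg !invgM !invgK !mulgA mulgV mul1g.
Qed.

Lemma quot_ind (P : quot -> Prop) : (forall x, P (eta x)) -> forall u, P u.
Proof. by move=> Peta u; rewrite -[u]quot_reprK. Qed.

Lemma quot_mulA : associative quot_mul.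
Proof.
elim/quot_ind=> x; elim/quot_ind=> y; elim/quot_ind=> z.
by rewrite !eta_mul mulgA.
Qed.

Lemma quot_mul1g : left_id quot_one quot_mul.
Proof. by elim/quot_ind=> x; rewrite eta_mul mul1g. Qed.

Lemma quot_mulg1 : right_id quot_one quot_mul.
Proof. by elim/quot_ind=> x; rewrite eta_mul mulg1. Qed.

Lemma quot_mulVg : left_inverse quot_one quot_inv quot_mul.
Proof. by elim/quot_ind=> x; rewrite eta_inv eta_mul mulVg. Qed.

Lemma quot_mulgV : right_inverse quot_one quot_inv quot_mul.
Proof. by elim/quot_ind=> x; rewrite eta_inv eta_mul mulgV. Qed.

HB.instance Definition _ := isGroup.Build quot
  quot_mulA quot_mul1g quot_mulg1 quot_mulVg quot_mulgV.

Lemma etaM : {morph eta : x y / x * y}.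
Proof. by move=> x y; rewrite -eta_mul. Qed.

HB.instance Definition _ := isMultiplicative.Build G quot eta etaM.

End Quotient.

Arguments quot {G} N.
Arguments eta {G} N x.

Section Presentation.
Variable G : groupType.

(* The letter (s, false) stands for s and (s, true) for its formal inverse. *)
Definition word := seq (G * bool).

Definition word_val (u : word) : G :=
  \prod_(a <- u) (if a.2 then a.1^-1 else a.1).

Definition word_over (S : set G) (u : word) := forall a, a \in u -> S a.1.

(* The quotient of the words over S by this congruence is the group <S | R>. *)
Inductive word_equiv (S : set G) (R : set word) : word -> word -> Prop :=
| we_refl u : word_equiv S R u u
| we_sym u v : word_equiv S R u v -> word_equiv S R v u
| we_trans u v w :
    word_equiv S R u v -> word_equiv S R v w -> word_equiv S R u w
| we_cancel u v s e :
    S s -> word_equiv S R (u ++ [:: (s, e); (s, ~~ e)] ++ v) (u ++ v)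
| we_relator u v r : R r -> word_equiv S R (u ++ r ++ v) (u ++ v).

Definition presented_by (S : set G) (R : set word) :=
  generated S = setT /\
  forall u, word_over S u -> (word_val u = 1 <-> word_equiv S R u [::]).

End Presentation.

Section Coxeter.
Variable W : groupType.
Implicit Types (S A B : set W) (m : W -> W -> nat).

(* The value 0 encodes the label infinity; m is irrelevant outside S. *)
Definition coxeter_matrix S m := forall s t, S s -> S t ->
  m s t = m t s /\ (m s t = 1%N <-> s = t).

Definition coxeter_relators S m : set (word W) :=
  [set r | exists s t, [/\ S s, S t, (0 < m s t)%N &
    r = flatten (nseq (m s t) [:: (s, false); (t, false)])]].

Definition coxeter_system S m :=
  coxeter_matrix S m /\ presented_by S (coxeter_relators S m).

(* Label 0 (infinity) also gives an edge. *)
Definition c_diagram m A : rel W :=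
  fun s t => [&& s \in A, t \in A & m s t \notin [:: 1; 2]%N].

Definition irreducible m A := forall s t, A s -> A t ->
  exists2 p, path (c_diagram m A) s p & last s p = t.

Definition finite_irreducible_visual S m A :=
  [/\ A `<=` S, irreducible m A & finite_set (generated A)].

Definition base S m B :=
  [/\ finite_irreducible_visual S m B,
      ~ is_cyclic (generated B)
    & forall A, finite_irreducible_visual S m A ->
        generated B `<=` generated A -> generated A = generated B].

(* The C-diagram of B is a path through the vertices b_0, b_1, ... (in this
   order) whose successive edges have the labels l_0, l_1, ... *)
Definition path_type m B (l : seq nat) (b : seq W) :=
  [/\ B = [set` b], uniq b, size b = (size l).+1
    & forall i j, (i < j < size b)%N ->
        m (nth 1 b i) (nth 1 b j) = if j == i.+1 then nth 0%N l i else 2%N].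

Definition star_type m B (b1 b2 b3 b4 : W) :=
  [/\ B = [set` [:: b1; b2; b3; b4]], uniq [:: b1; b2; b3; b4],
      [/\ m b1 b4 = 3%N, m b2 b4 = 3%N & m b3 b4 = 3%N]
    & [/\ m b1 b2 = 2%N, m b1 b3 = 2%N & m b2 b3 = 2%N]].

Definition commutator_type m B :=
  [\/ `I_5 #<= B, exists b, path_type m B [:: 3; 3; 3]%N b,
      exists b, path_type m B [:: 3; 5]%N b
    | exists b, path_type m B [:: 3; 3; 5]%N b].

(* The union is over all labellings of B as in the diagram; any one of them
   gives the same normal closure in the group generated by B. *)
Variant base_relator m B : W -> Prop :=
| relator_A3 a1 a2 a3 of path_type m B [:: 3; 3]%N [:: a1; a2; a3] :
    base_relator m B (a1 * a3)
| relator_B4_12 b1 b2 b3 b4 of star_type m B b1 b2 b3 b4 :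
    base_relator m B (b1 * b2)
| relator_B4_23 b1 b2 b3 b4 of star_type m B b1 b2 b3 b4 :
    base_relator m B (b2 * b3)
| relator_C3 c1 c2 c3 of path_type m B [:: 3; 4]%N [:: c1; c2; c3] :
    base_relator m B ((c2 * c3) ^+ 2)
| relator_C4 c1 c2 c3 c4 of path_type m B [:: 3; 3; 4]%N [:: c1; c2; c3; c4] :
    base_relator m B (c1 * c3)
| relator_F4 f1 f2 f3 f4 of path_type m B [:: 3; 4; 3]%N [:: f1; f2; f3; f4] :
    base_relator m B ((f2 * f3) ^+ 2).

Definition base_kernel m B : set W :=
  if `[< commutator_type m B >] then commutator_subgroup (generated B)
  else normal_closure (generated B) (base_relator m B).

Definition coxeter_kernel S m : normal_subgroup W :=
  ncl (\bigcup_(B in [set B | base S m B /\ `I_3 #<= B]) base_kernel m B).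

(* The elements whose normal closure is divided out by an elementary edge
   quotient operation on (W, S). *)
Variant edge_relator S : W -> Prop :=
| edge_label_reduction m s t d of
    coxeter_system S m & S s & S t & s <> t & (0 < m s t)%N
    & (d %| m s t)%N & (1 < d < m s t)%N : edge_relator S ((s * t) ^+ d)
| edge_elimination m s t of
    coxeter_system S m & S s & S t & s <> t & (0 < m s t)%N :
    edge_relator S (s * t).

End Coxeter.

(* edge_quotient_series X Y f: the pair (H, Y) is obtained from (G, X) by a
   finite series of elementary edge quotient operations, up to an isomorphism
   of pairs, and f : G -> H is the resulting composite quotient map. *)
Inductive edge_quotient_series :
    forall G H : groupType, set G -> set H -> (G -> H) -> Prop :=
| edge_series_iso (G H : groupType) (X : set G) (Y : set H)
    (f : {multiplicative G -> H}) :
    bijective f -> f @` X = Y -> edge_quotient_series X Y f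
| edge_series_step (G H : groupType) (X : set G) (Y : set H) (r : G)
    (f : quot (ncl [set r]) -> H) :
    finite_set X -> edge_relator X r ->
    edge_quotient_series (eta (ncl [set r]) @` X) Y f ->
    edge_quotient_series X Y (f \o eta (ncl [set r])).

(* Main.v *)
From HB Require Import structures.
Require Import Defs.
From mathcomp Require Import all_boot all_order all_algebra.
From mathcomp Require Import boolp classical_sets functions cardinality.
From mathcomp Require Import Rstruct reals trigo.
From mathcomp Require Import zify ring lra.
Import Order.TTheory GRing.Theory Num.Theory.

(** The kernel [N] of the theorem can be described without generators: it is the
    normal closure of the second derived subgroups of all finite subgroups of [W]
    ([coxeter_kernel_intrinsic]). Automorphisms permute the finite subgroups, so [N]
    is characteristic, and two sets of Coxeter generators lead to the same subgroup.

    The description rests on three facts. First, for a finite irreducible visual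
    subgroup [<B>] of rank at least 3, a quotient of [W] kills the subgroup attached to
    [B] exactly when the image of [<B>] is metabelian. In a metabelian group a product
    of two involutions of odd order lies in the abelian derived subgroup, and this
    makes the ends of an [A3] equal, merges all the generators of [G3] and makes the
    last two generators of [C3] commute; the other types follow
    ([base_kernel_collapse]). Conversely, after the quotient, [<B>] is abelian or a
    product of at most two commuting groups generated by two involutions
    ([base_kernel_metabelian]). Second, visual subgroups of rank at most 2 are
    metabelian, every other finite irreducible one lies in a base, and a finite visual
    subgroup is the product of its commuting components, so that dividing by [N] makes
    it metabelian ([metabelian_visual]). Third, every finite subgroup is conjugate into a finite visual one
    ([finite_subgroup_conjugate], due to Tits).

    Tits' theorem is proved in the contragredient of the geometric representation, on
    functions [f] from the generators to the reals, in which a root is the functional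
    sending [f] to the value of [w^-1 f] at a generator. If [F] is finite, the orbit
    under [F] of the constant function 1 sums to a fixed point that only finitely many
    positive roots make negative. Reflections move it into the closed fundamental
    chamber ([tits_cone]), where stabilizers are visual ([stabilizer_parabolic]).
    The same orbit sums bound finite diagrams: nonzero nonnegative weights on generators
    of a finite visual subgroup cannot pair nonnegatively with all the simple reflections
    ([finite_generated_weights]). The weights of the affine diagrams then give the
    classification, of which only the ranks up to 5 matter: from rank 5 on, a
    metabelian image is already abelian ([rank5_commute]).

    That the quotient is a Coxeter system is formal. If one divides a Coxeter group by
    powers of products of two generators, the images of the generators satisfy Coxeter
    relations with the orders of their products as labels, and no others are needed
    ([quotient_coxeter_system]). The subgroup [N] is the normal closure of finitely many
    [(s * t) ^+ k] with finite label [m s t] ([coxeter_kernel_edge_relators]). Dividing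
    by one of them amounts to dividing by [(s * t) ^+ d] for [d] the greatest common
    divisor of [k] and [m s t], which is an edge elimination if [d = 1], a label
    reduction if [1 < d < m s t], and otherwise trivial
    ([coxeter_edge_quotient_series]). *)

Set Implicit Arguments.
Unset Strict Implicit.
Unset Printing Implicit Defensive.

Local Open Scope classical_set_scope.
Local Open Scope card_scope.
Local Open Scope group_scope.

(** * Metabelian groups *)

Section Subgroups.
Variable G : groupType.
Implicit Types A B H K : set G.

Lemma generated_subgroup A : is_subgroup (generated A).
Proof.
split=> [K [[]//]|x y Ax Ay K sAK|x Ax K sAK].
- by have [[_ KM _] _] := sAK; apply: KM; [exact: Ax|exact: Ay].
- by have [[_ _ KV] _] := sAK; apply: KV; exact: Ax.
Qed.

Lemma sub_generated A : A `<=` generated A.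
Proof. exact: sub_gen_smallest. Qed.

Lemma generated_min A H : is_subgroup H -> A `<=` H -> generated A `<=` H.
Proof. by move=> sgH sAH x; apply; split. Qed.

Lemma generatedS A B : A `<=` B -> generated A `<=` generated B.
Proof.
move=> sAB; apply: generated_min (generated_subgroup _) _.
exact: subset_trans sAB (@sub_generated _).
Qed.

Lemma generated_id H : is_subgroup H -> generated H = H.
Proof.
by move=> sgH; apply/seteqP; split; [exact: generated_min|exact: sub_generated].
Qed.

Lemma subgroup1 H : is_subgroup H -> H 1. Proof. by case. Qed.

Lemma subgroupM H x y : is_subgroup H -> H x -> H y -> H (x * y).
Proof. by case=> _ HM _; exact: HM. Qed.

Lemma subgroupV H x : is_subgroup H -> H x -> H x^-1.
Proof. by case=> _ _; apply. Qed.

Lemma subgroupX H x n : is_subgroup H -> H x -> H (x ^+ n).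
Proof.
move=> sgH Hx; elim: n => [|n IHn]; first exact: subgroup1.
by rewrite expgS; apply: subgroupM.
Qed.

Lemma subgroupR H x y : is_subgroup H -> H x -> H y -> H [~ x, y].
Proof.
move=> sgH Hx Hy; rewrite /commg /conjg.
by do ![apply: subgroupM => // | apply: subgroupV => //].
Qed.

Lemma commute_generated A x :
  (forall a, A a -> commute x a) -> forall y, generated A y -> commute x y.
Proof.
move=> cxA; apply: generated_min => [|a /cxA//].
split=> [|y z|y]; [exact: commute1|exact: commuteM|exact: commuteV].
Qed.

Lemma commute_generated2 A B :
  (forall a b, A a -> B b -> commute a b) ->
  forall x y, generated A x -> generated B y -> commute x y.
Proof.
move=> cAB x y Ax; apply: commute_generated => b Bb.
by apply/commute_sym; apply: (commute_generated _ Ax) => a Aa; exact/commute_sym/cAB.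
Qed.

Lemma commutator_subgroup_subgroup H : is_subgroup (commutator_subgroup H).
Proof. exact: generated_subgroup. Qed.

Lemma mem_commutator H x y : H x -> H y -> commutator_subgroup H [~ x, y].
Proof. by move=> Hx Hy; apply: sub_generated; exists x, y. Qed.

Lemma commutator_subgroup_min H K : is_subgroup K ->
  (forall x y, H x -> H y -> K [~ x, y]) -> commutator_subgroup H `<=` K.
Proof.
by move=> sgK HK; apply: generated_min => // _ [x [y [Hx Hy ->]]]; exact: HK.
Qed.

Lemma commutator_subgroupS H K :
  H `<=` K -> commutator_subgroup H `<=` commutator_subgroup K.
Proof.
move=> sHK; apply: commutator_subgroup_min => [|x y /sHK Kx /sHK Ky].
  exact: commutator_subgroup_subgroup.
exact: mem_commutator.
Qed.

Lemma commutator_subgroup_sub H : is_subgroup H -> commutator_subgroup H `<=` H.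
Proof. by move=> sgH; apply: commutator_subgroup_min => // x y; exact: subgroupR. Qed.

Definition second_derived H := commutator_subgroup (commutator_subgroup H).

Lemma second_derivedS H K : H `<=` K -> second_derived H `<=` second_derived K.
Proof. by move=> sHK; do 2!apply: commutator_subgroupS. Qed.

Definition metabelian H := second_derived H `<=` [set 1].

Lemma metabelianP H : metabelian H <-> forall x y,
  commutator_subgroup H x -> commutator_subgroup H y -> commute x y.
Proof.
split=> [mH x y Hx Hy|cH].
  by apply/commgP/eqP; apply: mH; exact: mem_commutator.
apply: commutator_subgroup_min => [|x y Hx Hy].
  by split=> [//|x y -> ->|x ->]; rewrite /= ?mulg1 ?invg1.
by apply/eqP/commgP; exact: cH.
Qed.

Lemma metabelianS H K : H `<=` K -> metabelian K -> metabelian H.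
Proof. by move=> /second_derivedS sHK mK; exact: subset_trans mK. Qed.

Lemma metabelian_abelian H :
  (forall x y, H x -> H y -> commute x y) -> metabelian H.
Proof.
move=> cH; apply/metabelianP => x y Hx Hy.
suff: commutator_subgroup H `<=` [set 1].
  by move=> H1; rewrite (H1 _ Hx) (H1 _ Hy).
apply: commutator_subgroup_min => [|u v Hu Hv].
  by split=> [//|u v -> ->|u ->]; rewrite /= ?mulg1 ?invg1.
by apply/eqP/commgP; exact: cH.
Qed.

Lemma generatedU_commute A B x :
  (forall a b, A a -> B b -> commute a b) -> generated (A `|` B) x ->
  exists a b, [/\ generated A a, generated B b & x = a * b].
Proof.
move=> cAB; have cg := commute_generated2 cAB.
have [sgA sgB] := (generated_subgroup A, generated_subgroup B).
move: x; apply: generated_min => [|x [Ax|Bx]]; last 2 first.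
- exists x, 1; split; rewrite ?mulg1 //; [exact: sub_generated|exact: subgroup1].
- exists 1, x; split; rewrite ?mul1g //; [exact: subgroup1|exact: sub_generated].
split=> [|_ _ [a [b [Aa Bb ->]]] [c [d [Ac Bd ->]]]|_ [a [b [Aa Bb ->]]]].
- by exists 1, 1; split; rewrite ?mulg1 //; exact: subgroup1.
- exists (a * c), (b * d); split; [exact: (subgroupM sgA)|exact: (subgroupM sgB)|].
  by rewrite -!mulgA; congr (_ * _); rewrite !mulgA (cg c b).
- exists a^-1, b^-1; split; [exact: (subgroupV sgA)|exact: (subgroupV sgB)|].
  by rewrite invgM; apply/esym/cg; [exact: (subgroupV sgA)|exact: (subgroupV sgB)].
Qed.

(** Commutators of a product of two commuting subgroups are computed factor by
    factor. *)
Lemma commutator_generatedU A B :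
  (forall a b, A a -> B b -> commute a b) ->
  commutator_subgroup (generated (A `|` B)) `<=`
    generated (commutator_subgroup (generated A) `|`
               commutator_subgroup (generated B)).
Proof.
move=> cAB; have cg := commute_generated2 cAB.
have [sgA sgB] := (generated_subgroup A, generated_subgroup B).
set K := generated (commutator_subgroup _ `|` _); have sgK : is_subgroup K by exact: generated_subgroup.
apply: (commutator_subgroup_min sgK) => x y.
move=> /(generatedU_commute cAB)[a [b [Aa Bb ->]]].
move=> /(generatedU_commute cAB)[c [d [Ac Bd ->]]].
suff -> : [~ a * b, c * d] = [~ a, c] * [~ b, d].
  by apply: (subgroupM sgK); apply: sub_generated; [left|right]; exact: mem_commutator.
have E u v (Au : generated A u) (Bv : generated B v) : u * v = v * u by exact: cg.
have [Va Vc] := (subgroupV sgA Aa, subgroupV sgA Ac).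
have [Vb Vd] := (subgroupV sgB Bb, subgroupV sgB Bd).
rewrite /commg /conjg !invgM -!mulgA.
rewrite (mulgA b^-1) -(E _ _ Va Vb) -!mulgA; congr (_ * _).
rewrite (mulgA d^-1) -(E _ _ Vc Vd) -!mulgA.
rewrite (mulgA b^-1) -(E _ _ Vc Vb) -!mulgA; congr (_ * _).
rewrite (mulgA d^-1) -(E _ _ Aa Vd) -!mulgA.
rewrite (mulgA b^-1) -(E _ _ Aa Vb) -!mulgA; congr (_ * _).
by rewrite (mulgA b) -(E _ _ Ac Bb) -!mulgA (mulgA d^-1) -(E _ _ Ac Vd) -!mulgA
           (mulgA b^-1) -(E _ _ Ac Vb) -!mulgA.
Qed.

Lemma metabelianU A B : (forall a b, A a -> B b -> commute a b) ->
  metabelian (generated A) -> metabelian (generated B) ->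
  metabelian (generated (A `|` B)).
Proof.
move=> cAB /metabelianP mA /metabelianP mB; apply/metabelianP => x y.
have cg := commute_generated2 cAB.
have [sgA sgB] := (generated_subgroup A, generated_subgroup B).
have [sA sB] := (commutator_subgroup_sub sgA, commutator_subgroup_sub sgB).
move=> /(commutator_generatedU cAB) Hx /(commutator_generatedU cAB) Hy.
move: x y Hx Hy; apply: commute_generated2 => a b [Aa|Ba] [Ab|Bb].
- exact: mA.
- by apply: cg; [exact: sA|exact: sB].
- by apply/commute_sym/cg; [exact: sA|exact: sB].
- exact: mB.
Qed.

(** The rotations form an abelian subgroup [C] containing all the commutators. *)
Lemma metabelian_dihedral x y :
  x * x = 1 -> y * y = 1 -> metabelian (generated [set x; y]).
Proof.
move=> xx yy; pose C := generated [set x * y].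
have sgC : is_subgroup C by exact: generated_subgroup.
have cC u v : C u -> C v -> commute u v.
  by apply: commute_generated2 => _ _ -> ->; exact: commute_refl.
have CJ u : C u -> C (x * u * x).
  move: u; apply: generated_min => [|_ ->]; last first.
    rewrite /= mulgA xx mul1g (_ : y * x = (x * y)^-1); last first.
      by rewrite invgM (mulg1_eq xx) (mulg1_eq yy).
    by apply: (subgroupV sgC); exact: sub_generated.
  split=> [|u v Cu Cv|u Cu] /=.
  - by rewrite mulg1 xx; exact: subgroup1.
  - rewrite (_ : _ * x = (x * u * x) * (x * v * x)); first exact: (subgroupM sgC).
    by rewrite -!mulgA (mulgA x x (v * x)) xx mul1g.
  - rewrite (_ : _ * x = (x * u * x)^-1); first exact: (subgroupV sgC).
    by rewrite !invgM (mulg1_eq xx) !mulgA.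
(* [D e] is the coset of rotations or of reflections, according to the parity [e];
   parities add up, hence are even for commutators. *)
pose X (e : bool) := if e then x else 1.
have XX e : X e * X e = 1 by case: e; rewrite /= ?mulg1.
have XV e : (X e)^-1 = X e by apply: mulg1_eq; rewrite XX.
have XD e e' : X (e (+) e') = X e * X e'.
  by case: e e' => [] []; rewrite /= ?mulg1 ?mul1g ?xx.
have CJX e u : C u -> C (X e * u * X e).
  by case: e => [/CJ//|]; rewrite /= mul1g mulg1.
pose D e g := C (g * X e).
have DM e e' g h : D e g -> D e' h -> D (e (+) e') (g * h).
  move=> Dg Dh; rewrite /D XD.
  rewrite (_ : _ * _ = (g * X e) * (X e * (h * X e') * X e)).
    by apply: (subgroupM sgC) => //; exact: CJX.
  rewrite -!mulgA (mulgA (X e)) XX mul1g -!XD; do 2!congr (_ * _).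
  by rewrite addbC.
have DV e g : D e g -> D e g^-1.
  move=> /(subgroupV sgC) /(CJX e); rewrite /D invgM XV.
  by rewrite !mulgA XX mul1g.
have D_gen g : generated [set x; y] g -> exists e, D e g.
  move: g; apply: generated_min => [|_ [->|->]].
  - split=> [|g h [e Dg] [e' Dh]|g [e Dg]].
    + by exists false; rewrite /D /= mulg1; exact: subgroup1.
    + by exists (e (+) e'); exact: DM.
    + by exists e; exact: DV.
  - by exists true; rewrite /D /= xx; exact: subgroup1.
  - exists true; rewrite /D /= (_ : y * x = (x * y)^-1); last first.
      by rewrite invgM (mulg1_eq xx) (mulg1_eq yy).
    by apply: (subgroupV sgC); exact: sub_generated.
have sDC : commutator_subgroup (generated [set x; y]) `<=` C.
  apply: (commutator_subgroup_min sgC) => g h /D_gen[e Dg] /D_gen[e' Dh].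
  have := DM _ _ _ _ (DV _ _ Dg) (DM _ _ _ _ (DV _ _ Dh) (DM _ _ _ _ Dg Dh)).
  by rewrite (addbA e') (addbC e') addbK addbb /D /= mulg1.
by apply/metabelianP => u v /sDC Cu /sDC Cv; exact: cC.
Qed.

End Subgroups.

Section Morphisms.
Variables (G H : groupType) (f : {multiplicative G -> H}).
Implicit Types A : set G.

Lemma gmorph1 : f 1 = 1.
Proof. by apply: (mulgI (f 1)); rewrite -gmulfM !mulg1. Qed.

Lemma gmorphV x : f x^-1 = (f x)^-1.
Proof. by apply/esym/mulg1_eq; rewrite -gmulfM mulgV gmorph1. Qed.

Lemma gmorphX x n : f (x ^+ n) = f x ^+ n.
Proof. by elim: n => [|n IHn]; rewrite ?gmorph1 // !expgS gmulfM IHn. Qed.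

Lemma gmorphR x y : f [~ x, y] = [~ f x, f y].
Proof. by rewrite /commg /conjg !gmulfM !gmorphV. Qed.

Lemma image_generated A : f @` generated A = generated (f @` A).
Proof.
apply/seteqP; split=> [_ [x Ax <-]|]; last first.
  apply: generated_min => [|_ [a Aa <-]]; last by exists a => //; exact: sub_generated.
  have sg := generated_subgroup A.
  split=> [|_ _ [x Ax <-] [y Ay <-]|_ [x Ax <-]].
  - by exists 1; [exact: subgroup1|exact: gmorph1].
  - by exists (x * y); [exact: (subgroupM sg)|exact: gmulfM].
  - by exists x^-1; [exact: (subgroupV sg)|exact: gmorphV].
have sg := generated_subgroup (f @` A).
move: x Ax; apply: generated_min => [|a Aa]; last by apply: sub_generated; exists a.
split=> [|x y Ax Ay|x Ax] /=; first by rewrite gmorph1; exact: subgroup1.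
- by rewrite gmulfM; exact: (subgroupM sg).
- by rewrite gmorphV; exact: (subgroupV sg).
Qed.

Lemma image_commutator_subgroup A :
  f @` commutator_subgroup A = commutator_subgroup (f @` A).
Proof.
rewrite /commutator_subgroup image_generated; congr generated.
apply/seteqP; split=> [_ [_ [x [y [Ax Ay ->]]] <-]|].
  by exists (f x), (f y); split; [exists x|exists y|exact: gmorphR].
move=> _ [_ [_ [[x Ax <-] [y Ay <-] ->]]].
by exists [~ x, y]; [exists x, y|exact: gmorphR].
Qed.

Lemma image_second_derived A : f @` second_derived A = second_derived (f @` A).
Proof. by rewrite /second_derived !image_commutator_subgroup. Qed.

End Morphisms.

Section MetabelianRelations.
Variables (G : groupType) (H : set G).
Hypothesis metH : metabelian H.

(** The square of [x * y] is the commutator of [x] and [y], and [x * y] is a power of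
    its square. *)
Lemma mulg_derived_odd x y k : H x -> H y -> x * x = 1 -> y * y = 1 ->
  odd k -> (x * y) ^+ k = 1 -> commutator_subgroup H (x * y).
Proof.
move=> Hx Hy xx yy k_odd xyk.
have D : commutator_subgroup H ((x * y) ^+ 2).
  suff -> : (x * y) ^+ 2 = [~ x, y] by exact: mem_commutator.
  by rewrite expg2 /commg /conjg (mulg1_eq xx) (mulg1_eq yy) !mulgA.
have -> : x * y = ((x * y) ^+ 2) ^+ (uphalf k).
  rewrite -expgnA mul2n -[LHS]mul1g -{1}xyk -expgSr; congr (_ ^+ _).
  by rewrite -[in LHS](odd_double_half k) k_odd uphalf_half k_odd doubleD.
by apply: subgroupX D; exact: commutator_subgroup_subgroup.
Qed.

(** The rotations [a * b] and [b * c] lie in the abelian derived subgroup. Their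
    product [a * c] is an involution whose order divides the odd number [p * q]. *)
Lemma odd_path_collapse a b c p q : H a -> H b -> H c ->
  a * a = 1 -> b * b = 1 -> c * c = 1 -> odd p -> odd q ->
  (a * b) ^+ p = 1 -> (b * c) ^+ q = 1 -> commute a c -> a = c.
Proof.
move=> Ha Hb Hc aa bb cc op oq abp bcq ac.
have cm : commute (a * b) (b * c).
  by move/metabelianP: metH; apply;
    [exact: mulg_derived_odd abp|exact: mulg_derived_odd bcq].
have E : (a * b) * (b * c) = a * c by rewrite -mulgA (mulgA b) bb mul1g.
have ac2 : (a * c) ^+ 2 = 1 by rewrite expgMn // !expg2 aa cc mulg1.
suff: a * c = 1 by move/mulg1_eq <-; rewrite (mulg1_eq aa).
have : (a * c) ^+ (p * q) = 1.
  by rewrite -E expgMn // expgnA abp mulnC expgnA bcq !expg1n mulg1.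
rewrite -[(p * q)%N]odd_double_half oddM op oq /= expgS -mul2n.
by rewrite expgnA ac2 expg1n mulg1.
Qed.

(** The derived subgroup contains [a * b] and [w = (b * c) ^+ 2]. So [w] commutes with
    [a * b], with [b], and therefore with [a]; conjugating [c] by both sides of the
    braid relation of [a] and [b] then gives [c = w * c]. *)
Lemma four_path_collapse a b c : H a -> H b -> H c ->
  a * a = 1 -> b * b = 1 -> c * c = 1 ->
  (a * b) ^+ 3 = 1 -> (b * c) ^+ 4 = 1 -> commute a c -> (b * c) ^+ 2 = 1.
Proof.
move=> Ha Hb Hc aa bb cc ab3 bc4 ac; set w := (b * c) ^+ 2.
have Dw : commutator_subgroup H w.
  suff -> : w = [~ b, c] by exact: mem_commutator.
  by rewrite /w expg2 /commg /conjg (mulg1_eq bb) (mulg1_eq cc) !mulgA.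
have Dx : commutator_subgroup H (a * b) by exact: mulg_derived_odd ab3.
have cxw : commute (a * b) w by move/metabelianP: metH; exact.
have ww : w * w = 1 by rewrite /w -expgnDr.
have wE : w = b * c * b * c by rewrite /w expg2 !mulgA.
clearbody w.
have cbw : commute b w.
  have : b * w * b = w.
    have -> : b * w * b = w^-1.
      by rewrite wE !invgM (mulg1_eq bb) (mulg1_eq cc) !mulgA bb mul1g.
    exact: mulg1_eq.
  by move=> E; rewrite /commute -[w in RHS]E -!mulgA bb mulg1.
have caw : commute a w.
  have -> : a = (a * b) * b by rewrite -mulgA bb mulg1.
  by apply/commute_sym/commuteM; exact/commute_sym.
have bcb : b * c * b = w * c by rewrite wE -!mulgA cc mulg1.
have bab : b * a * b = a * b * a.
  have /mulg1_eq <- : (a * b * a) * (b * a * b) = 1.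
    by rewrite -ab3 !expgS expg0 mulg1 !mulgA.
  by rewrite !invgM (mulg1_eq aa) (mulg1_eq bb) !mulgA.
have awc : a * (w * c) * a = w * c.
  by rewrite mulgA caw -!mulgA -ac (mulgA a) aa mul1g.
have Ec : (b * a * b) * c * (b * a * b) = c.
  have -> : (b * a * b) * c * (b * a * b) = b * (a * (b * c * b) * a) * b.
    by rewrite !mulgA.
  by rewrite bcb awc mulgA cbw -!mulgA (mulgA b c) bcb mulgA ww mul1g.
have : w * c = c.
  rewrite -{2}Ec bab.
  have -> : (a * b * a) * c * (a * b * a) = a * (b * (a * c * a) * b) * a.
    by rewrite !mulgA.
  have -> : a * c * a = c by rewrite ac -mulgA aa mulg1.
  by rewrite bcb awc.
by move/(canRL (mulgK _)); rewrite mulgV.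
Qed.
End MetabelianRelations.

(** * Words and quotients *)

Section Order.
Variable G : groupType.
Implicit Types x y : G.

(** The order of [x], and 0 if [x] has infinite order: the convention of Coxeter
    matrices, which turns [x ^+ n = 1] into divisibility by the order. *)
Definition elt_order x : nat :=
  if pselect (exists n, (0 < n)%N && (x ^+ n == 1)) is left e then ex_minn e
  else 0%N.

Lemma elt_order_dvd x n : (x ^+ n = 1) <-> (elt_order x %| n)%N.
Proof.
rewrite /elt_order; case: pselect => [e|ne]; last first.
  rewrite dvd0n; split=> [|/eqP->//]; case: n => [//|n] xn.
  by case: ne; exists n.+1; rewrite xn eqxx.
case: ex_minnP => k /andP[k0 /eqP xk] k_min.
have xmod : x ^+ n = x ^+ (n %% k).
  by rewrite {1}(divn_eq n k) expgnDr mulnC expgnA xk expg1n mul1g.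
split=> [|/eqP n0]; last by rewrite xmod n0.
rewrite xmod => xnk; apply/eqP; case: (posnP (n %% k)) => // nk0.
by have := k_min (n %% k)%N; rewrite nk0 xnk eqxx leqNgt ltn_mod k0 => /(_ isT).
Qed.

Lemma elt_orderV x : elt_order x^-1 = elt_order x.
Proof.
have E n : (elt_order x^-1 %| n)%N = (elt_order x %| n)%N.
  apply/idP/idP => /elt_order_dvd xn; apply/elt_order_dvd.
    by apply: invg_inj; rewrite -expVgn xn invg1.
  by rewrite expVgn xn invg1.
by apply/eqP; rewrite eqn_dvd E dvdnn -E dvdnn.
Qed.

Lemma elt_order_eq1 x : elt_order x = 1%N <-> x = 1.
Proof.
split=> [o1|->]; last by apply/eqP; rewrite -dvdn1; apply/elt_order_dvd.
by rewrite -[x]expg1; apply/elt_order_dvd; rewrite o1.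
Qed.

Lemma elt_order_gt0 x n : (0 < n)%N -> x ^+ n = 1 -> (0 < elt_order x)%N.
Proof. by move=> n0 /elt_order_dvd/dvdn_gt0; exact. Qed.

End Order.

Section NormalClosure.
Variable G : groupType.
Implicit Types (A B K : set G).

Lemma sub_ncl A : A `<=` ncl A.
Proof. exact: sub_gen_smallest. Qed.

Lemma ncl_min A K : is_normal setT K -> A `<=` K -> ncl A `<=` K.
Proof. by move=> nK sAK x; apply; split. Qed.

Lemma nsval_subgroup (N : normal_subgroup G) : is_subgroup N.
Proof. by case: (nsvalP N). Qed.

Lemma nsvalJ (N : normal_subgroup G) x y : nsval N x -> nsval N (x ^ y).
Proof. by case: (nsvalP N) => _ _ NJ Nx; exact: NJ. Qed.

Lemma normal_closure_min (H A K : set G) :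
  is_normal H K -> A `<=` K -> normal_closure H A `<=` K.
Proof. by move=> nK sAK x; apply; split. Qed.

Lemma sub_normal_closure (H A : set G) : A `<=` normal_closure H A.
Proof. exact: sub_gen_smallest. Qed.

Lemma eta1 (N : normal_subgroup G) x : eta N x = 1 <-> nsval N x.
Proof.
rewrite -(gmorph1 (eta N)); split=> [/esym/etaP|Nx]; first by rewrite invg1 mul1g.
by apply/esym/etaP; rewrite invg1 mul1g.
Qed.

Lemma eta_surj (N : normal_subgroup G) (q : quot N) : exists x, eta N x = q.
Proof. by exists (quot_repr q); exact: quot_reprK. Qed.

End NormalClosure.

Lemma preim_normal (G H : groupType) (f : {multiplicative G -> H}) (K : set H) :
  is_normal setT K -> is_normal setT (f @^-1` K).
Proof.
move=> [sgK _ KJ]; split=> [|//|x h Kx _] /=.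
- split=> [|x y Kx Ky|x Kx] /=; first by rewrite gmorph1; exact: subgroup1.
  + by rewrite gmulfM; exact: subgroupM.
  + by rewrite gmorphV; exact: subgroupV.
- by rewrite /conjg !gmulfM gmorphV; exact: KJ.
Qed.

Lemma is_normal1 (G : groupType) : is_normal setT [set 1 : G].
Proof.
split=> [|//|x h -> _] /=; last by rewrite conj1g.
by split=> [//|x y -> ->|x ->] /=; rewrite ?mulg1 ?invg1.
Qed.

Section Words.
Variable G : groupType.
Implicit Types (S : set G) (R : set (word G)) (u v : word G).

Lemma word_val_nil : word_val ([::] : word G) = 1.
Proof. by rewrite /word_val big_nil. Qed.

Lemma word_val_cons (a : G * bool) u :
  word_val (a :: u) = (if a.2 then a.1^-1 else a.1) * word_val u.
Proof. by rewrite /word_val big_cons. Qed.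

Lemma word_val_cat u v : word_val (u ++ v) = word_val u * word_val v.
Proof. by rewrite /word_val big_cat. Qed.

Definition word_inv u : word G := rev [seq (a.1, ~~ a.2) | a <- u].

Lemma word_inv_cons a u : word_inv (a :: u) = word_inv u ++ [:: (a.1, ~~ a.2)].
Proof. by rewrite /word_inv /= rev_cons cats1. Qed.

Lemma word_val_inv u : word_val (word_inv u) = (word_val u)^-1.
Proof.
elim: u => [|[s e] u IHu]; first by rewrite word_val_nil invg1.
rewrite word_inv_cons word_val_cat IHu !word_val_cons word_val_nil mulg1 /= invgM.
by case: e; rewrite /= ?invgK.
Qed.

Lemma word_over_cat S u v :
  word_over S u -> word_over S v -> word_over S (u ++ v).
Proof. by move=> Su Sv a; rewrite mem_cat => /orP[/Su|/Sv]. Qed.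

Lemma word_over_inv S u : word_over S u -> word_over S (word_inv u).
Proof. by move=> Su a; rewrite mem_rev => /mapP[b /Su Sb ->]. Qed.

Lemma word_overP S w : generated S w -> exists2 u, word_over S u & word_val u = w.
Proof.
move: w; apply: generated_min => [|s Ss]; last first.
  exists [:: (s, false)]; last by rewrite word_val_cons word_val_nil mulg1.
  by move=> a; rewrite inE => /eqP->.
split=> [|_ _ [u Su <-] [v Sv <-]|_ [u Su <-]].
- by exists [::] => //; rewrite word_val_nil.
- by exists (u ++ v); [exact: word_over_cat|rewrite word_val_cat].
- by exists (word_inv u); [exact: word_over_inv|rewrite word_val_inv].
Qed.

Lemma generated_word S u : word_over S u -> generated S (word_val u).
Proof.
have sgS := generated_subgroup S.
elim: u => [|a u IHu] Su; first by rewrite word_val_nil; exact: subgroup1.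
rewrite word_val_cons; apply: (subgroupM sgS); last first.
  by apply: IHu => b bu; apply: Su; rewrite inE bu orbT.
have Sa : generated S a.1 by apply: sub_generated; apply: Su; rewrite inE eqxx.
by case: ifP => // _; exact: (subgroupV sgS).
Qed.

Definition alternating_word n (s t : G) : word G :=
  flatten (nseq n [:: (s, false); (t, false)]).

Lemma alternating_wordD n k s t :
  alternating_word (n + k) s t = alternating_word n s t ++ alternating_word k s t.
Proof. by rewrite /alternating_word nseqD flatten_cat. Qed.

Lemma word_val_alternating n s t : word_val (alternating_word n s t) = (s * t) ^+ n.
Proof.
elim: n => [|n IHn]; first by rewrite word_val_nil.
by rewrite -addn1 addnC alternating_wordD word_val_cat IHn !word_val_cons word_val_nil
           mulg1 expgS.
Qed.

Lemma word_over_alternating S n s t :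
  S s -> S t -> word_over S (alternating_word n s t).
Proof.
move=> Ss St; elim: n => [//|n IHn]; rewrite -addn1 addnC alternating_wordD.
by apply: word_over_cat => // a; rewrite !inE => /orP[] /eqP->.
Qed.

Lemma word_equiv_ctx S R p q u v :
  word_equiv S R u v -> word_equiv S R (p ++ u ++ q) (p ++ v ++ q).
Proof.
elim=> [|{}u {}v _|{}u {}v w _ uv _ vw|{}u {}v s e Ss|{}u {}v r Rr].
- by move=> ?; exact: we_refl.
- exact: we_sym.
- exact: we_trans uv vw.
- by have := we_cancel R (p ++ u) (v ++ q) e Ss; rewrite -!catA /=; apply.
- by have := we_relator S (p ++ u) (v ++ q) Rr; rewrite -!catA; apply.
Qed.

Lemma word_equiv_cat S R u u' v v' : word_equiv S R u u' ->
  word_equiv S R v v' -> word_equiv S R (u ++ v) (u' ++ v').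
Proof.
move=> uu' vv'; apply: (we_trans (v := u' ++ v)).
  exact: (word_equiv_ctx [::] v uu').
by have := word_equiv_ctx u' [::] vv'; rewrite !cats0.
Qed.

Lemma word_equiv_invl S R u :
  word_over S u -> word_equiv S R (word_inv u ++ u) [::].
Proof.
elim: u => [|[s e] u IHu] Su; first exact: we_refl.
apply: we_trans (IHu _) => [|a ua]; last by apply: Su; rewrite inE ua orbT.
rewrite word_inv_cons -catA /= -{2}[e]negbK.
by apply: (we_cancel R (word_inv u) u); apply: (Su (s, e)); rewrite inE eqxx.
Qed.

Lemma word_equiv_val S R u v : (forall r, R r -> word_val r = 1) ->
  word_equiv S R u v -> word_val u = word_val v.
Proof.
move=> R1; elim=> [//|//|{}u {}v w _ -> _ ->//|{}u {}v s e _|{}u {}v r Rr].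
  rewrite !word_val_cat !word_val_cons word_val_nil mulg1 /=.
  by case: e; rewrite /= ?mulVg ?mulgV mul1g.
by rewrite !word_val_cat (R1 r Rr) mul1g.
Qed.

Lemma word_equiv_alternating S m n s t : S s -> S t -> (m s t %| n)%N ->
  word_equiv S (coxeter_relators S m) (alternating_word n s t) [::].
Proof.
move=> Ss St /dvdnP[q ->]; case: (posnP (m s t)) => [->|m0].
  by rewrite muln0; exact: we_refl.
elim: q => [|q IHq]; first exact: we_refl.
rewrite mulSn alternating_wordD; apply: we_trans IHq.
apply: (we_relator S [::] (alternating_word (q * m s t) s t)).
by exists s, t; split.
Qed.

Section WordAction.
Variables (X : Type) (act : G -> X -> X).

Definition word_act u x := foldr (fun a => act a.1) x u.

Lemma word_act_cat u v x : word_act (u ++ v) x = word_act u (word_act v x).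
Proof. exact: foldr_cat. Qed.

Lemma word_act_alternating n s t x :
  word_act (alternating_word n s t) x = iter n (act s \o act t) x.
Proof.
by elim: n => [//|n IHn]; rewrite -addn1 addnC alternating_wordD word_act_cat IHn.
Qed.

Lemma word_act_equiv S R u v : (forall s, S s -> involutive (act s)) ->
  (forall r, R r -> word_act r =1 id) ->
  word_equiv S R u v -> word_act u =1 word_act v.
Proof.
move=> actK actR; elim=> [//|{}u {}v _ uv x|{}u {}v w _ uv _ vw x|{}u {}v s e Ss x|
                         {}u {}v r Rr x].
- by rewrite uv.
- by rewrite uv vw.
- by rewrite !word_act_cat /= (actK s Ss).
- by rewrite !word_act_cat (actR r Rr).
Qed.

End WordAction.

End Words.

Section CoxeterBasics.
Variables (W : groupType) (S : set W) (m : W -> W -> nat).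
Hypothesis HS : coxeter_system S m.

Lemma coxeter_relator_val r : coxeter_relators S m r -> word_val r = 1.
Proof.
case: HS => _ [_ presS] Rr; apply/presS; last first.
  by have := we_relator S [::] [::] Rr; rewrite cats0.
case: Rr => s [t [Ss St _ ->]]; exact: word_over_alternating.
Qed.

Lemma coxeter_matrix_eq1 s t : S s -> S t -> (m s t = 1%N <-> s = t).
Proof. by case: HS => mS _ Ss St; case: (mS s t Ss St). Qed.

Lemma coxeter_matrix_sym s t : S s -> S t -> m s t = m t s.
Proof. by case: HS => mS _ Ss St; case: (mS s t Ss St). Qed.

Lemma coxeter_expg s t : S s -> S t -> (s * t) ^+ m s t = 1.
Proof.
move=> Ss St; case: (posnP (m s t)) => [->//|m0].
by rewrite -word_val_alternating; apply: coxeter_relator_val; exists s, t; split.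
Qed.

Lemma coxeter_invol s : S s -> s * s = 1.
Proof.
move=> Ss; have := coxeter_expg Ss Ss.
by rewrite (coxeter_matrix_eq1 Ss Ss).2.
Qed.

Lemma coxeter_generated w : generated S w.
Proof. by case: HS => _ [-> _]. Qed.

(** A Coxeter group acts on any type on which its generators act compatibly with
    the defining relations. *)
Lemma coxeter_action (X : Type) (act : W -> X -> X) :
  (forall s t, S s -> S t -> (0 < m s t)%N -> iter (m s t) (act s \o act t) =1 id) ->
  exists A : W -> X -> X, [/\ A 1 =1 id,
    forall g h x, A (g * h) x = A g (A h x) & forall s, S s -> A s =1 act s].
Proof.
move=> actR.
have actK s : S s -> involutive (act s).
  move=> Ss x; have := actR s s Ss Ss.
  by rewrite (coxeter_matrix_eq1 Ss Ss).2 // => /(_ isT x).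
have val_act u v : word_over S u -> word_over S v ->
    word_val u = word_val v -> word_act act u =1 word_act act v.
  have actR' r : coxeter_relators S m r -> word_act act r =1 id.
    move=> [s [t [Ss St m0 ->]]] x.
    by rewrite -/(alternating_word _ _ _) word_act_alternating actR.
  move=> Su Sv uv x.
  have /(word_act_equiv actK actR') E : word_equiv S (coxeter_relators S m)
      (u ++ word_inv v) [::].
    case: HS => _ [_ presS]; apply/presS.
      by apply: word_over_cat => //; exact: word_over_inv.
    by rewrite word_val_cat word_val_inv uv mulgV.
  have /(word_act_equiv actK actR') E' := word_equiv_invl (coxeter_relators S m) Sv.
  have := E (word_act act v x); rewrite word_act_cat -(word_act_cat _ _ v) E'.
  by move=> ->.
have /choice[wd wdP] : forall w : W, exists u, word_over S u /\ word_val u = w.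
  by move=> w; have [u Su uw] := word_overP (coxeter_generated w); exists u.
exists (fun w => word_act act (wd w)); split=> [x|g h x|s Ss x].
- have [S1 v1] := wdP 1.
  by rewrite (val_act _ [::]) // v1 word_val_nil.
- have [Sg vg] := wdP g; have [Sh vh] := wdP h; have [Sgh vgh] := wdP (g * h).
  rewrite -word_act_cat; apply: (val_act _ _ Sgh (word_over_cat Sg Sh)).
  by rewrite word_val_cat vg vh.
- have [Sw vw] := wdP s.
  rewrite (val_act _ [:: (s, false)]) // => [a|]; first by rewrite inE => /eqP->.
  by rewrite vw word_val_cons word_val_nil mulg1.
Qed.

End CoxeterBasics.

(** * Edge quotients of Coxeter systems *)

(** A relator of [W] maps to a power of a relator of the quotient, since the orders
    in the quotient divide the labels. So a relation of the quotient, being the image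
    of an element of the normal closure of [A], follows from the relators. Taking
    orders as labels spares computing which generators become equal. *)
Lemma quotient_coxeter_system (W : groupType) (S : set W) m (A : set W) :
  coxeter_system S m ->
  (forall a, A a -> exists s t k, [/\ S s, S t & a = (s * t) ^+ k]) ->
  coxeter_system (eta (ncl A) @` S) (fun x y => elt_order (x * y)).
Proof.
move=> HS AP; pose N := ncl A; set X := _ @` S; set m2 := fun _ _ => _.
have [_ [_ presS]] := HS.
have Xinv x : X x -> x * x = 1.
  by move=> [s Ss <-]; rewrite -gmulfM (coxeter_invol HS Ss) gmorph1.
have m2E s t : m2 s t = elt_order (s * t) by [].
split.
  move=> x y Xx Xy; rewrite !m2E; split.
    by rewrite -elt_orderV invgM (mulg1_eq (Xinv _ Xx)) (mulg1_eq (Xinv _ Xy)).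
  split=> [/elt_order_eq1/mulg1_eq <-|->]; first by rewrite (mulg1_eq (Xinv _ Xx)).
  by apply/elt_order_eq1; exact: Xinv.
have relX n x y : X x -> X y -> (x * y) ^+ n = 1 ->
    word_equiv X (coxeter_relators X m2) (alternating_word n x y) [::].
  by move=> Xx Xy /elt_order_dvd xyn; exact: word_equiv_alternating.
pose mp (u : word W) : word (quot N) := [seq (eta N a.1, a.2) | a <- u].
have mp_cat u v : mp (u ++ v) = mp u ++ mp v by exact: map_cat.
have mp_alt n s t : mp (alternating_word n s t) = alternating_word n (eta N s) (eta N t).
  by elim: n => [//|n IHn]; rewrite -addn1 addnC !alternating_wordD mp_cat IHn.
have mp_inv u : mp (word_inv u) = word_inv (mp u).
  by rewrite /mp /word_inv map_rev -!map_comp.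
have mp_over u : word_over S u -> word_over X (mp u).
  by move=> Su _ /mapP[a /Su Sa ->]; exists a.1.
have mp_equiv u v : word_equiv S (coxeter_relators S m) u v ->
    word_equiv X (coxeter_relators X m2) (mp u) (mp v).
  elim=> [{}u|{}u {}v _|{}u {}v w _ uv _ vw|{}u {}v s e Ss|{}u {}v r Rr].
  - exact: we_refl.
  - exact: we_sym.
  - exact: we_trans uv vw.
  - by rewrite !mp_cat; apply: we_cancel; exists s.
  - rewrite !mp_cat; apply: (word_equiv_ctx _ _ (v := [::])).
    case: Rr => s [t [Ss St m0 ->]]; rewrite -/(alternating_word _ _ _) mp_alt.
    apply: relX; [by exists s|by exists t|].
    by rewrite -gmulfM -gmorphX (coxeter_expg HS) // gmorph1.
split.
  rewrite -image_generated; apply/seteqP; split=> // x _.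
  by have [w <-] := eta_surj x; exists w => //; exact: coxeter_generated HS w.
move=> u Xu; split; last first.
  move=> /(word_equiv_val _) ->; first exact: word_val_nil.
  move=> _ [x [y [_ _ _ ->]]]; rewrite -/(alternating_word _ _ _).
  by rewrite word_val_alternating; apply/elt_order_dvd.
(* The elements of [W] some word of which becomes trivial by the relators of the
   quotient. *)
pose K := [set w | exists u, [/\ word_over S u, word_val u = w &
  word_equiv X (coxeter_relators X m2) (mp u) [::]]].
have sNK : ncl A `<=` K.
  apply: ncl_min => [|a Aa]; last first.
    have [s [t [k [Ss St aE]]]] := AP a Aa.
    exists (alternating_word k s t); split.
    - exact: word_over_alternating.
    - by rewrite word_val_alternating.
    - rewrite mp_alt; apply: relX; [by exists s|by exists t|].
      by rewrite -gmulfM -gmorphX -aE; apply/eta1; exact: sub_ncl.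
  split=> [|//|_ h [u' [Su <- u'1]] _].
    split=> [|_ _ [u' [Su <- u'1]] [v [Sv <- v1]]|_ [u' [Su <- u'1]]].
    - by exists [::]; split=> //; [exact: word_val_nil|exact: we_refl].
    - exists (u' ++ v); split; [exact: word_over_cat|exact: word_val_cat|].
      by rewrite mp_cat; exact: word_equiv_cat u'1 v1.
    - exists (word_inv u'); split; [exact: word_over_inv|exact: word_val_inv|].
      rewrite mp_inv; apply: we_trans (word_equiv_invl _ (mp_over _ Su)).
      rewrite -[X in word_equiv _ _ X _]cats0.
      by apply: word_equiv_cat (we_sym u'1); exact: we_refl.
  have [v Sv vh] := word_overP (coxeter_generated HS h).
  exists (word_inv v ++ u' ++ v); split.
  - by do 2?apply: word_over_cat => //; exact: word_over_inv.
  - by rewrite !word_val_cat word_val_inv vh.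
  - rewrite !mp_cat mp_inv; apply: we_trans (word_equiv_invl _ (mp_over _ Sv)).
    by apply: (word_equiv_ctx _ (mp v) u'1).
move=> u1.
have /choice[lift liftP] : forall x, exists s, X x -> S s /\ eta N s = x.
  move=> x; have [[s Ss <-]|nXx] := pselect (X x); first by exists s.
  by exists 1.
pose u' : word W := [seq (lift a.1, a.2) | a <- u].
have Su' : word_over S u'.
  by move=> _ /mapP[a /Xu Xa ->]; have [] := liftP _ Xa.
have mpu' : mp u' = u.
  rewrite /mp -map_comp -[RHS]map_id; apply/eq_in_map => -[x e] /Xu Xa /=.
  by have [_ ->] := liftP _ Xa.
have val_mp v : eta N (word_val v) = word_val (mp v).
  elim: v => [|[s e] v IHv]; first by rewrite /= !word_val_nil gmorph1.
  by rewrite /= !word_val_cons etaM IHv; case: e; rewrite //= gmorphV.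
have [v [Sv vE v1]] : K (word_val u').
  by apply: sNK; apply/eta1; rewrite val_mp mpu'.
rewrite -mpu'; apply: we_trans v1; rewrite -[mp v]cats0 -[mp u']cats0.
have Svu : word_over S (word_inv v ++ u').
  by apply: word_over_cat => //; exact: word_over_inv.
have /(presS _ Svu)/mp_equiv : word_val (word_inv v ++ u') = 1.
  by rewrite word_val_cat word_val_inv vE mulVg.
rewrite mp_cat mp_inv => E.
have vvV : word_equiv X (coxeter_relators X m2) (mp v ++ word_inv (mp v)) [::].
  have := word_equiv_invl (coxeter_relators X m2) (word_over_inv (mp_over _ Sv)).
  suff -> : word_inv (word_inv (mp v)) = mp v by [].
  rewrite /word_inv map_rev revK -map_comp -[RHS]map_id.
  by apply: eq_map => -[x e] /=; rewrite negbK.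
apply: (we_trans (v := mp v ++ word_inv (mp v) ++ mp u')).
  rewrite cats0 catA; apply: we_sym.
  exact: (word_equiv_cat vvV (we_refl _ _ _)).
by apply: word_equiv_cat => //; exact: we_refl.
Qed.

(** By induction on the number of elements [(a i * b i) ^+ nth 0 l i] to divide out;
    [f] is the quotient map up to isomorphism, so that the induction may continue in
    the first quotient. *)
Lemma coxeter_edge_quotient_series (l : seq nat) : forall (W H : groupType)
    (S : set W) m (f : {multiplicative W -> H}) (a b : nat -> W),
  coxeter_system S m -> finite_set S -> (forall h, exists g, f g = h) ->
  (forall i, (i < size l)%N -> [/\ S (a i), S (b i) & (0 < m (a i) (b i))%N]) ->
  (forall g, f g = 1 <->
     nsval (ncl [set x | exists2 i, (i < size l)%N & x = (a i * b i) ^+ nth 0%N l i]) g) ->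
  edge_quotient_series S (f @` S) f.
Proof.
elim: l => [|k l IHl] W H S m f a b HS finS f_surj abP kerf.
  have f1 g : f g = 1 -> g = 1.
    by move=> /kerf; apply: (ncl_min (is_normal1 W)) => x [].
  have f_inj : injective f.
    move=> x y xy; apply: (mulIg y^-1); rewrite mulgV.
    by apply: f1; rewrite gmulfM gmorphV xy mulgV.
  have [g gK] := choice f_surj.
  by apply: edge_series_iso => //; exists g => // x; apply: f_inj; rewrite gK.
set A := (A in ncl A) in kerf.
have [Ss St mst0] := abP 0%N isT; set s := a 0%N in Ss mst0; set t := b 0%N in St mst0.
(* [(s * t) ^+ k] and [r] generate the same subgroup. *)
pose d := gcdn k (m s t); pose r := (s * t) ^+ d.
have stk (K : set W) : is_subgroup K -> K r -> K ((s * t) ^+ k).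
  by move=> sgK Kr; rewrite -(divnK (dvdn_gcdl k (m s t))) mulnC expgnA; exact: subgroupX.
pose A' := [set x | exists2 i, (i < size l)%N &
  x = (a i.+1 * b i.+1) ^+ nth 0%N l i].
have AA' x : A x -> x = (s * t) ^+ k \/ A' x.
  by move=> [[_ ->|i il ->]]; [left|right; exists i].
have A'A x : A' x -> A x by move=> [i il ->]; exists i.+1.
have [r1|/eqP r1] := eqVneq r 1.
  apply: (IHl _ _ _ m f (a \o succn) (b \o succn)) => // [i il|g]; first exact: abP i.+1 il.
  rewrite kerf; split; apply: ncl_min; try exact: nsvalP.
    move=> x /AA'[->|]; last exact: sub_ncl.
    by apply: (stk (nsval _)); [exact: nsval_subgroup|rewrite r1; exact: (subgroup1 (nsval_subgroup _))].
  by move=> x /A'A; exact: sub_ncl.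
have rel_r : edge_relator S r.
  have st : s <> t by move=> st; apply: r1; rewrite /r st (coxeter_invol HS) // expg1n.
  have d0 : (0 < d)%N by rewrite gcdn_gt0 mst0 orbT.
  have [d1|d1] := eqVneq d 1%N.
    by rewrite /r d1 expg1; apply: (edge_elimination (m := m)).
  apply: (edge_label_reduction (m := m)) => //; first exact: dvdn_gcdr.
  rewrite ltn_neqAle eq_sym d1 d0 /= ltn_neqAle (dvdn_leq _ (dvdn_gcdr _ _)) // andbT.
  by apply/eqP => dm; apply: r1; rewrite /r dm (coxeter_expg HS).
set N1 := ncl [set r].
have fr : f r = 1.
  rewrite gmorphX; apply/elt_order_dvd; rewrite dvdn_gcd; apply/andP; split; apply/elt_order_dvd.
    by rewrite -gmorphX; apply/kerf; apply: sub_ncl; exists 0%N.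
  by rewrite -gmorphX (coxeter_expg HS) // gmorph1.
have fN1 x : nsval N1 x -> f x = 1.
  by move: x; apply: (ncl_min (preim_normal f (is_normal1 H))) => _ ->.
pose f1 (q : quot N1) := f (quot_repr q).
have f1E g : f1 (eta N1 g) = f g.
  have /etaP/fN1 := quot_reprK (eta N1 g).
  by rewrite gmulfM gmorphV => /mulg1_eq; rewrite invgK.
have f1M : {morph f1 : x y / x * y}.
  by elim/quot_ind=> x; elim/quot_ind=> y; rewrite -etaM !f1E gmulfM.
pose F1 : {multiplicative quot N1 -> H} :=
  HB.pack f1 (isMultiplicative.Build _ _ f1 f1M).
have fE : f = f1 \o eta N1 :> (W -> H) by apply/funext => x /=; rewrite f1E.
rewrite {2}fE; apply: edge_series_step => //.
rewrite -/N1 (_ : f @` S = F1 @` (eta N1 @` S)); last by rewrite fE image_comp.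
apply: (IHl _ _ _ (fun x y => elt_order (x * y)) F1 (eta N1 \o a \o succn) (eta N1 \o b \o succn)).
- apply: quotient_coxeter_system HS _ => _ ->.
  by exists s, t, d; split.
- exact: finite_image.
- by move=> h; have [g <-] := f_surj h; exists (eta N1 g); exact: f1E.
- move=> i il; have [Sa Sb mab] := abP i.+1 il.
  split; [by exists (a i.+1)|by exists (b i.+1)|].
  by apply: (elt_order_gt0 mab); rewrite /= -etaM -gmorphX (coxeter_expg HS) // gmorph1.
elim/quot_ind => g; rewrite [F1 _]f1E; split; last first.
  rewrite -f1E -[f1 _]/(F1 _); move: (eta N1 g).
  apply: (ncl_min (preim_normal F1 (is_normal1 H))) => _ [i il ->] /=.
  rewrite -etaM -gmorphX f1E; apply/kerf; apply: sub_ncl; apply: A'A; by exists i.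
move=> /kerf; move: g; set B := [set x | _].
apply: (ncl_min (preim_normal (eta N1) (nsvalP (ncl B)))) => x /AA'[->|[i il ->]] /=.
  have -> : eta N1 ((s * t) ^+ k) = 1; last exact: (subgroup1 (nsval_subgroup (ncl B))).
  apply/eta1; apply: (stk (nsval _)); [exact: nsval_subgroup|exact: sub_ncl].
by apply: sub_ncl; exists i => //=; rewrite -etaM -gmorphX.
Qed.

(** * Edge weights *)

Section EdgeWeights.
Variable R : realType.
Implicit Types (c : R) (n k : nat).
Local Open Scope ring_scope.

(** Chebyshev polynomials of the second kind in [c / 2], indexed so that the [k]-th one
    at [2 * cos x] is [sin (k * x) / sin x]. *)
Fixpoint chebyshev c k : R :=
  match k with
  | 0 => 0
  | k'.+1 => match k' with 0 => 1 | j.+1 => c * chebyshev c k' - chebyshev c j end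
  end.

Lemma chebyshevSS c k : chebyshev c k.+2 = c * chebyshev c k.+1 - chebyshev c k.
Proof. by []. Qed.

(** Minus twice the value of the invariant form on two simple roots joined by the
    label [n], where 0 stands for infinity; the label 1 gives [-2]. *)
Definition edge_weight n : R := if n == 0%N then 2 else 2 * cos (pi / n%:R).

Lemma chebyshev2 k : chebyshev 2 k = k%:R.
Proof.
suff: chebyshev 2 k = k%:R /\ chebyshev 2 k.+1 = k.+1%:R by case.
elim: k => [|k [IH1 IH2]]; first by [].
by split=> //; rewrite chebyshevSS IH1 IH2 -!natr1; ring.
Qed.

Lemma chebyshev_sin x k : chebyshev (2 * cos x) k * sin x = sin (k%:R * x).
Proof.
suff: chebyshev (2 * cos x) k * sin x = sin (k%:R * x) /\
  chebyshev (2 * cos x) k.+1 * sin x = sin (k.+1%:R * x) by case.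
elim: k => [|k [IH1 IH2]]; first by rewrite !mul0r sin0 !mul1r.
split=> //; rewrite chebyshevSS mulrBl IH1 -(mulrA (2 * cos x)) IH2.
have -> : k.+2%:R * x = k.+1%:R * x + x by rewrite -[k.+2]addn1 natrD mulrDl mul1r.
have -> : k%:R * x = k.+1%:R * x - x by rewrite -[k.+1]addn1 natrD mulrDl mul1r addrK.
by rewrite (sinB (k.+1%:R * x)) (sinD (k.+1%:R * x) x); ring.
Qed.

Lemma edge_weight_norm n : `|edge_weight n| <= 2.
Proof.
rewrite /edge_weight; case: ifP => _; first by rewrite normr_nat.
by rewrite normrM normr_nat; have := cos_max (pi / n%:R : R); lra.
Qed.

Lemma edge_weight0 : edge_weight 0 = 2. Proof. by []. Qed.

Lemma edge_weight1 : edge_weight 1 = -2.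
Proof. by rewrite /edge_weight /= divr1 cospi; ring. Qed.

Lemma edge_weight2 : edge_weight 2 = 0.
Proof. by rewrite /edge_weight /= cos_pihalf mulr0. Qed.

Lemma sin_pi_div_gt0 n : (1 < n)%N -> 0 < sin (pi / n%:R : R).
Proof.
move=> n1; have n0 : 0 < n%:R :> R by rewrite ltr0n; lia.
apply: sin_gt0_pi; rewrite divr_gt0 ?pi_gt0 //= ltr_pdivrMr // ltr_pMr ?pi_gt0 //.
by rewrite ltr1n.
Qed.

(** These numbers are the coordinates of the roots of a dihedral group: they are
    positive as long as the length stays below the label. *)
Lemma chebyshev_edge_weight_gt0 n k : n != 1%N -> (0 < k)%N ->
  (n == 0%N) || (k < n)%N -> 0 < chebyshev (edge_weight n) k.
Proof.
move=> n1 k0; have [->|n0 /= kn] := eqVneq n 0%N; first by rewrite chebyshev2 ltr0n.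
have n_gt1 : (1 < n)%N by lia.
have s0 := sin_pi_div_gt0 n_gt1.
rewrite -(pmulr_lgt0 _ s0) /edge_weight (negbTE n0) chebyshev_sin.
have nR : 0 < n%:R :> R by rewrite ltr0n; lia.
apply: sin_gt0_pi; rewrite mulrCA mulr_gt0 ?pi_gt0 ?divr_gt0 ?ltr0n //=; last exact: ltnW.
by rewrite gtr_pMr ?pi_gt0 // ltr_pdivrMr // mul1r ltr_nat.
Qed.

Lemma chebyshev_edge_weight_eq0 n : (1 < n)%N -> chebyshev (edge_weight n) n = 0.
Proof.
move=> n1; have s0 := sin_pi_div_gt0 n1; apply: (mulIf (lt0r_neq0 s0)).
have n0 : n != 0%N by lia.
rewrite mul0r /edge_weight (negbTE n0) chebyshev_sin mulrCA divff ?mulr1 ?sinpi //.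
by rewrite pnatr_eq0.
Qed.

Lemma chebyshev_edge_weight_ge0 n k : n != 1%N ->
  (n == 0%N) || (k <= n)%N -> 0 <= chebyshev (edge_weight n) k.
Proof.
move=> n1; case: (posnP k) => [->//|k0]; rewrite leq_eqVlt.
have [->|n0] := eqVneq n 0%N.
  by move=> _; apply/ltW/chebyshev_edge_weight_gt0.
case/orP => [//|/orP[/eqP kn|kn]].
  by rewrite kn chebyshev_edge_weight_eq0 //; lia.
by apply/ltW/chebyshev_edge_weight_gt0; rewrite // kn orbT.
Qed.

Lemma edge_weight_ge0 n : n != 1%N -> 0 <= edge_weight n.
Proof.
case: n => [|[|[|n]]] // _; first by rewrite edge_weight2.
by have := @chebyshev_edge_weight_gt0 n.+3 2 isT isT isT; rewrite /= subr0 mulr1 => /ltW.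
Qed.

Lemma edge_weight_sqr n : (1 < n)%N -> edge_weight n ^+ 2 != 4.
Proof.
move=> n1; have c0 : 0 <= edge_weight n by apply: edge_weight_ge0; lia.
apply/eqP => c4; have c2 : edge_weight n = 2.
  by apply/eqP; rewrite -(@eqrXn2 _ 2) // c4; apply/eqP; ring.
have := chebyshev_edge_weight_eq0 n1; rewrite c2 chebyshev2.
by move/eqP; rewrite pnatr_eq0; lia.
Qed.

(** Lower bounds on the weight result from the signs of the first few Chebyshev
    polynomials rather than from the monotonicity of the cosine. *)
Lemma edge_weight_ge1 n : n \notin [:: 1; 2]%N -> 1 <= edge_weight n.
Proof.
case: n => [|[|[|n]]] // _; first by rewrite edge_weight0; lra.
have U2 := @chebyshev_edge_weight_gt0 n.+3 2 isT isT isT.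
have := @chebyshev_edge_weight_ge0 n.+3 3 isT isT.
by move: U2 => /=; set c := edge_weight _ => *; nra.
Qed.

Lemma edge_weight_ge_sqrt2 n : (3 < n)%N -> 2 <= edge_weight n ^+ 2.
Proof.
case: n => [|[|[|[|n]]]] // _.
have U2 := @chebyshev_edge_weight_gt0 n.+4 2 isT isT isT.
have := @chebyshev_edge_weight_ge0 n.+4 4 isT isT.
move: U2 => /=; set c := edge_weight _; rewrite !subr0 !mulr1 => c0.
have -> : c * (c * c - 1) - c = c * (c ^+ 2 - 2) by ring.
by rewrite pmulr_rge0 // subr_ge0.
Qed.

Lemma edge_weight_ge3div2 n : (4 < n)%N -> 3 / 2 <= edge_weight n.
Proof.
move=> n4; have c2 := @edge_weight_ge_sqrt2 n (ltnW n4).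
case: n n4 c2 => [|[|[|[|[|n]]]]] // _.
have U2 := @chebyshev_edge_weight_gt0 n.+4.+1 2 isT isT isT.
have := @chebyshev_edge_weight_ge0 n.+4.+1 5 isT isT.
move: U2 => /=; set c := edge_weight _; rewrite !subr0 !mulr1 => c0 c5 c2.
have {}c5 : 0 <= (c ^+ 2) ^+ 2 - 3 * c ^+ 2 + 1 by rewrite (le_trans c5) //; lra.
have : (3 / 2) ^+ 2 <= c ^+ 2 by move: (c ^+ 2) c2 c5 => d; nra.
by rewrite ler_pXn2r // nnegrE; lra.
Qed.

Lemma edge_weight_ge_sqrt3 n : (5 < n)%N -> 3 <= edge_weight n ^+ 2.
Proof.
move=> n5; have c2 := @edge_weight_ge_sqrt2 n (ltnW (ltnW n5)).
case: n n5 c2 => [|[|[|[|[|[|n]]]]]] // _.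
have U2 := @chebyshev_edge_weight_gt0 n.+4.+2 2 isT isT isT.
have := @chebyshev_edge_weight_ge0 n.+4.+2 6 isT isT.
move: U2 => /=; set c := edge_weight _; rewrite !subr0 !mulr1 => c0 c6 c2.
have {}c6 : 0 <= c * ((c ^+ 2 - 1) * (c ^+ 2 - 3)) by rewrite (le_trans c6) //; lra.
move: c6; rewrite pmulr_rge0 // pmulr_rge0 ?subr_ge0 //; lra.
Qed.

(** Along an alternating product of two reflections the coordinates satisfy the
    Chebyshev recurrence, hence come back after [2 * n] steps. *)
Lemma chebyshev_antiperiod n (z : nat -> R) :
  (1 < n)%N -> (forall k, z k.+2 = edge_weight n * z k.+1 - z k) ->
  forall k, z (2 * n + k)%N = z k.
Proof.
move=> n1 zS; set c := edge_weight n in zS.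
have zU k : z k.+1 = chebyshev c k.+1 * z 1%N - chebyshev c k * z 0%N.
  suff: z k.+1 = chebyshev c k.+1 * z 1%N - chebyshev c k * z 0%N /\
    z k.+2 = chebyshev c k.+2 * z 1%N - chebyshev c k.+1 * z 0%N by case.
  elim: k => [|k [IH1 IH2]]; first by rewrite zS /=; split; ring.
  by split=> //; rewrite zS IH1 IH2 !chebyshevSS; ring.
have Un : chebyshev c n = 0 by exact: chebyshev_edge_weight_eq0.
case: n n1 => // n n1 in c zS zU Un *; set e := - chebyshev c n.
have US : chebyshev c n.+2 = e by rewrite chebyshevSS Un mulr0 sub0r.
(* The Casoratian of two solutions of the recurrence is constant. *)
have cas k : chebyshev c k.+1 ^+ 2 - chebyshev c k.+2 * chebyshev c k = 1.
  elim: k => [|k <-]; first by rewrite /= ; ring.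
  by rewrite !chebyshevSS; ring.
have ee : e * e = 1.
  by have := cas n; rewrite Un US /e expr0n /= sub0r => <-; ring.
have zn k : z (n.+1 + k)%N = e * z k /\ z (n.+1 + k.+1)%N = e * z k.+1.
  elim: k => [|k [IH1 IH2]].
    by rewrite addn0 addn1 (zU n.+1) (zU n) Un US /e; split; ring.
  by split=> //; rewrite !addnS in IH1 IH2 *; rewrite (zS (n.+1 + k)%N) (zS k) IH1 IH2; ring.
by move=> k; rewrite mul2n -addnn -addnA !(zn _).1 mulrA ee mul1r.
Qed.

End EdgeWeights.

(** * Length *)

Section Length.
Variables (W : groupType) (S : set W) (m : W -> W -> nat).
Hypothesis HS : coxeter_system S m.
Implicit Types (w v : W) (n k : nat).

Fixpoint expression n w : Prop :=
  if n is k.+1 then exists s v, [/\ S s, expression k v & w = v * s] else w = 1.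

Lemma expressionM n k v w :
  expression n v -> expression k w -> expression (n + k) (v * w).
Proof.
move=> nv; elim: k w => [|k IHk] w /=; first by move=> ->; rewrite addn0 mulg1.
move=> [s [u [Ss ku ->]]]; rewrite addnS /=.
by exists s, (v * u); split=> //; [exact: IHk|rewrite mulgA].
Qed.

Lemma expression1 s : S s -> expression 1 s.
Proof. by move=> Ss; exists s, 1; split=> //; rewrite mul1g. Qed.

Lemma expressionV n w : expression n w -> expression n w^-1.
Proof.
elim: n w => [|n IHn] w /=; first by move=> ->; rewrite invg1.
move=> [s [v [Ss nv ->]]]; rewrite invgM (mulg1_eq (coxeter_invol HS Ss)).
by have := expressionM (expression1 Ss) (IHn _ nv); rewrite add1n.
Qed.

Lemma expression_exists w : exists n, `[< expression n w >].
Proof.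
suff: exists n, expression n w by case=> n nw; exists n; exact/asboolP.
have := coxeter_generated HS w; move: w; apply: generated_min => [|s Ss]; last first.
  by exists 1%N; exact: expression1.
split=> [|v w [n nv] [k kw]|w [n nw]]; first by exists 0%N.
  by exists (n + k)%N; exact: expressionM.
by exists n; exact: expressionV.
Qed.

Definition len w := ex_minn (expression_exists w).

Lemma expression_len w : expression (len w) w.
Proof. by rewrite /len; case: ex_minnP => n /asboolP. Qed.

Lemma len_le n w : expression n w -> (len w <= n)%N.
Proof.
by move=> nw; rewrite /len; case: ex_minnP => k _; apply; exact/asboolP.
Qed.

Lemma lenM v w : (len (v * w) <= len v + len w)%N.
Proof. by apply: len_le; apply: expressionM; exact: expression_len. Qed.

Lemma lenV w : len w^-1 = len w.
Proof.
apply/eqP; rewrite eqn_leq !len_le //; last exact/expressionV/expression_len.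
by rewrite -{2}[w]invgK; exact/expressionV/expression_len.
Qed.

(** The parity comes from the action on booleans in which each generator acts by
    negation. *)
Lemma expression_odd n w : expression n w -> odd n = odd (len w).
Proof.
have [|A [A1 AM AS]] := coxeter_action HS (act := fun _ => negb).
  by move=> s t _ _ _ b; elim: (m s t) => [//|k IHk] /=; rewrite negbK.
suff E k v : expression k v -> odd k = A v false.
  by move=> nw; rewrite (E _ _ nw) (E _ _ (expression_len w)).
have AN u b : A u b = A u false (+) b.
  have [i iu] : exists j, expression j u by exists (len u); exact: expression_len.
  elim: i u b iu => [|j IHj] u b /=; first by move=> ->; rewrite !A1.
  move=> [s [x [Ss jx ->]]]; rewrite !AM !(AS s Ss) /= (IHj x (~~ b) jx) (IHj x true jx).
  by case: b (A x false) => [] [].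
elim: k v => [|k IHk] v /=; first by move=> ->; rewrite A1.
by move=> [s [x [Ss kx ->]]]; rewrite AM (AS s Ss) AN -IHk // addbT.
Qed.

Lemma len_mulgen w s : S s ->
  len (w * s) = (len w).+1 \/ len w = (len (w * s)).+1.
Proof.
move=> Ss; have ws1 : (len (w * s) <= (len w).+1)%N.
  by apply: len_le; exists s, w; split=> //; exact: expression_len.
have ws2 : (len w <= (len (w * s)).+1)%N.
  apply: len_le; exists s, (w * s); split=> //; first exact: expression_len.
  by rewrite -mulgA (coxeter_invol HS Ss) mulg1.
have : odd (len w).+1 = odd (len (w * s)).
  by apply: expression_odd; exists s, w; split=> //; exact: expression_len.
lia.
Qed.

Lemma len_descent w : w <> 1 -> exists2 s, S s & len w = (len (w * s)).+1.
Proof.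
move=> w1; have := expression_len w; case E: (len w) => [|n] /=; first by move/w1.
move=> [s [v [Ss nv wE]]]; exists s => //; case: (len_mulgen w Ss) => [ws|<-//].
have : (len (w * s) <= n)%N.
  by rewrite wE -mulgA (coxeter_invol HS Ss) mulg1; exact: len_le.
by rewrite ws E; lia.
Qed.

Lemma coxeter_ind (P : W -> Prop) :
  P 1 -> (forall s w, S s -> P w -> P (s * w)) -> forall w, P w.
Proof.
move=> P1 PM w; rewrite -[w]invgK; move: (w^-1) => {}w.
have [n nw] : exists n, expression n w by exists (len w); exact: expression_len.
elim: n w nw => [|n IHn] w /=.
  by move=> ->; rewrite invg1.
move=> [s [v [Ss nv ->]]]; rewrite invgM (mulg1_eq (coxeter_invol HS Ss)).
by apply: PM => //; exact: IHn.
Qed.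

Fixpoint altprod (x y : W) k : W :=
  if k is j.+1 then x * altprod y x j else 1.

Lemma altprodD x y j k : altprod x y (j + k) =
  altprod x y j * (if odd j then altprod y x k else altprod x y k).
Proof.
elim: j x y => [|j IHj] x y /=; first by rewrite mul1g.
by rewrite IHj -mulgA; case: (odd j).
Qed.

Lemma altprodSr x y k :
  altprod x y k.+1 = altprod x y k * (if odd k then y else x).
Proof. by rewrite -addn1 altprodD; case: (odd k); rewrite /= mulg1. Qed.

Lemma expression_altprod x y k : S x -> S y -> expression k (altprod x y k).
Proof.
move=> Sx Sy; elim: k x y Sx Sy => [//|k IHk] x y Sx Sy.
by have := expressionM (expression1 Sx) (IHk y x Sy Sx); rewrite add1n.
Qed.

Lemma altprodV x y k : S x -> S y ->
  (altprod x y k)^-1 = if odd k then altprod x y k else altprod y x k.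
Proof.
elim: k x y => [|k IHk] x y Sx Sy; first by rewrite invg1.
rewrite [LHS]invgM IHk // (mulg1_eq (coxeter_invol HS Sx)).
by rewrite !altprodSr /=; case: (odd k).
Qed.

Lemma altprod_double x y k : altprod x y (k + k) = (x * y) ^+ k.
Proof.
by elim: k => [//|k IHk]; rewrite addSn addnS /= IHk expgS mulgA.
Qed.

Lemma altprod_braid x y : S x -> S y ->
  altprod x y (m x y) = altprod y x (m x y).
Proof.
move=> Sx Sy; have := altprod_double x y (m x y).
rewrite (coxeter_expg HS) // altprodD => /mulg1_eq/(canRL invgK) ->.
by case: ifP => o; rewrite altprodV // o.
Qed.

(** The first [m x y + 1] factors can be replaced by [m x y - 1] factors. *)
Lemma len_altprod x y k : S x -> S y -> (0 < m x y < k)%N ->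
  (len (altprod x y k) < k.-1)%N.
Proof.
move=> Sx Sy /andP[m0 mk]; rewrite -(subnKC mk) altprodD /=.
rewrite -altprod_braid //; case: (m x y) m0 => [//|n] _ /=.
rewrite mulgA (coxeter_invol HS Sx) mul1g -/(altprod y x n) !addSn /= ltnS.
apply: leq_trans (lenM _ _) _; apply: leq_add; apply: len_le.
  exact: expression_altprod.
by case: odd; exact: expression_altprod.
Qed.

End Length.

(** * The contragredient geometric representation *)

Section Geometry.
Local Open Scope ring_scope.
Variables (W : groupType) (S : set W) (m : W -> W -> nat).
Hypothesis HS : coxeter_system S m.
Variable R : realType.
Implicit Types (f g : W -> R) (s t : W).

Notation len := (len HS).

Definition weight s t : R := edge_weight R (m s t).

(** The simple reflection acts on functions on the generators, that is, on the dual of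
    the geometric representation. Contrary to the action on vectors, this involves
    no sum over the generators, which may therefore be infinitely many. *)
Definition refl s f : W -> R := fun u => f u + weight s u * f s.

Lemma weightC s t : S s -> S t -> weight s t = weight t s.
Proof. by move=> Ss St; rewrite /weight (coxeter_matrix_sym HS). Qed.

Lemma weight_diag s : S s -> weight s s = -2.
Proof. by move=> Ss; rewrite /weight (coxeter_matrix_eq1 HS _ _).2 // edge_weight1. Qed.

Lemma weight_ge0 s t : S s -> S t -> s <> t -> 0 <= weight s t.
Proof.
by move=> Ss St st; apply: edge_weight_ge0; apply/eqP => /(coxeter_matrix_eq1 HS Ss St).
Qed.

(** After [n] rounds, [f] has changed by a combination of the weights of [s] and of
    [t]. The values at [s] and [t] come back by [chebyshev_antiperiod], and the system
    giving the coefficients [p] and [q] of this combination is invertible since the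
    weight of the edge is not 2. *)
Lemma refl_braid s t : S s -> S t -> (0 < m s t)%N ->
  iter (m s t) (refl s \o refl t) =1 id.
Proof.
move=> Ss St m0 f.
have [m1|m1] := eqVneq (m s t) 1%N.
  rewrite m1 /= -((coxeter_matrix_eq1 HS Ss St).1 m1); apply/funext => u.
  by rewrite /refl weight_diag //; ring.
have {m0 m1} m1 : (1 < m s t)%N by lia.
set n := m s t in m1 *; pose g k := iter k (refl s \o refl t) f.
have gS k u : g k.+1 u = refl s (refl t (g k)) u by [].
have [p [q gE]] : exists p q : R, forall u,
    g n u = f u + weight s u * p + weight t u * q.
  elim: n {m1} => [|k [p [q IHk]]]; first by exists 0, 0 => u; rewrite /g /=; ring.
  exists (p + refl t (g k) s), (q + g k t) => u.
  by rewrite gS {1}/refl {1}/refl IHk; ring.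
pose z k := chebyshev (weight s t) k.+1 * (- f s)
          + chebyshev (weight s t) k * (f t + weight s t * f s).
have zS k : z k.+2 = weight s t * z k.+1 - z k.
  by rewrite /z !chebyshevSS; ring.
have gz k : g k s = - z (2 * k)%N /\ g k t = z (2 * k).+1.
  elim: k => [|k [IH1 IH2]]; first by rewrite /g /z /=; split; ring.
  have -> : (2 * k.+1 = (2 * k).+2)%N by lia.
  by rewrite !gS /refl !weight_diag // (weightC St Ss) IH1 IH2 !zS; split; ring.
have [gs gt] := gz n.
have zp := chebyshev_antiperiod m1 zS.
have z0 : z (2 * n)%N = - f s by rewrite -[(2 * n)%N]addn0 zp /z /=; ring.
have z1 : z (2 * n).+1 = f t by rewrite -addn1 zp /z /=; ring.
have e1 : -2 * p + weight s t * q = 0.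
  by have := gE s; rewrite gs z0 weight_diag // (weightC St Ss); lra.
have e2 : weight s t * p + -2 * q = 0.
  by have := gE t; rewrite gt z1 weight_diag //; lra.
have c4 : weight s t ^+ 2 - 4 != 0 by rewrite subr_eq0; exact: edge_weight_sqr.
have p0 : p = 0.
  apply: (mulfI c4); rewrite mulr0.
  transitivity (weight s t * (weight s t * p + -2 * q)
    + 2 * (-2 * p + weight s t * q)); first by ring.
  by rewrite e1 e2; ring.
have q0 : q = 0 by move: e2; rewrite p0; lra.
by apply/funext => u; rewrite -/(g n) gE p0 q0; rewrite /=; ring.
Qed.

Definition act : W -> (W -> R) -> W -> R :=
  projT1 (cid (coxeter_action HS refl_braid)).

Lemma act1 f : act 1%g f = f.
Proof. by rewrite /act; case: cid => A [/= -> _ _]. Qed.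

Lemma actM v w f : act (v * w)%g f = act v (act w f).
Proof. by rewrite /act; case: cid => A [/= _ -> _]. Qed.

Lemma act_gen s f : S s -> act s f = refl s f.
Proof. by rewrite /act; case: cid => A [/= _ _ AS] Ss; rewrite AS. Qed.

Lemma actK w f : act w (act w^-1%g f) = f.
Proof. by rewrite -actM mulgV act1. Qed.

Lemma actVK w f : act w^-1%g (act w f) = f.
Proof. by rewrite -actM mulVg act1. Qed.

Lemma act_lin w (a : R) f g u :
  act w (fun x => a * f x + g x) u = a * act w f u + act w g u.
Proof.
elim/(coxeter_ind HS): w u => [|s w Ss IHw] u; first by rewrite !act1.
by rewrite !actM !(act_gen _ Ss) /refl !IHw; ring.
Qed.

Lemma actZ w (a : R) f u : act w (fun x => a * f x) u = a * act w f u.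
Proof.
elim/(coxeter_ind HS): w u => [|s w Ss IHw] u; first by rewrite !act1.
by rewrite !actM !(act_gen _ Ss) /refl !IHw; ring.
Qed.

Lemma act_sum w (I : Type) (r : seq I) (F : I -> W -> R) u :
  act w (fun x => \sum_(i <- r) F i x) u = \sum_(i <- r) act w (F i) u.
Proof.
elim/(coxeter_ind HS): w u => [|s w Ss IHw] u.
  by rewrite act1; apply: eq_bigr => i _; rewrite act1.
rewrite actM (act_gen _ Ss) /refl !IHw mulr_sumr -big_split /=.
by apply: eq_bigr => i _; rewrite actM (act_gen _ Ss).
Qed.

Definition nonneg f := forall s, S s -> 0 <= f s.

(** The root [w s] is the functional [f |-> act w^-1 f s]; it is positive if it is so on
    the functions that are nonnegative on the simple roots. *)
Definition pos_root w s := forall f, nonneg f -> 0 <= act w^-1%g f s.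
Definition neg_root w s := forall f, nonneg f -> act w^-1%g f s <= 0.

(** The roots of the dihedral group generated by [s] and [t] have Chebyshev
    coordinates. *)
Lemma act_altprod s t k f : S s -> S t ->
  act (altprod t s k) f s =
    chebyshev (weight s t) k.+1 * (if odd k then f t else f s)
  + chebyshev (weight s t) k * (if odd k then f s else f t).
Proof.
move=> Ss St; suff H j : forall s t, S s -> S t -> forall k, (k <= j)%N ->
  act (altprod t s k) f s =
    chebyshev (weight s t) k.+1 * (if odd k then f t else f s)
  + chebyshev (weight s t) k * (if odd k then f s else f t) by exact: (H k).
elim: j {k s t Ss St} => [|j IHj] s t Ss St k kj.
  by move: kj; rewrite leqn0 => /eqP-> /=; rewrite act1; ring.
move: kj; case: k => [_|[_|k kj]]; first by rewrite act1 /=; ring.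
  by rewrite /= mulg1 act_gen // /refl (weightC St Ss); ring.
have -> : act (altprod t s k.+2) f s = act t (act s (act (altprod t s k) f)) s.
  by rewrite /= !actM.
rewrite act_gen // {1}/refl.
have -> : act s (act (altprod t s k) f) t = act (altprod s t k.+1) f t.
  by rewrite /= actM.
rewrite act_gen // {1}/refl weight_diag // (IHj t s) // (IHj s t) //; last exact: ltnW.
rewrite (weightC St Ss) !chebyshevSS /=; case: (odd k) => /=; ring.
Qed.

(** By induction on the length. Strip from [w] the longest alternating product of [s]
    and [t], for [t] a descent of [w], that shortens it by its number [k] of factors.
    The rest [v] is shorter and has neither [s] nor [t] as a descent, so that the roots
    of [v] at [s] and [t] are positive. The root of [w] is a combination of these two
    with Chebyshev coefficients, which are nonnegative because [k < m s t], for
    otherwise [w * s] would be too short. *)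
Lemma len_lt_pos_root w s : S s -> (len w < len (w * s)%g)%N -> pos_root w s.
Proof.
have [n] := ubnP (len w); elim: n w s => [//|n IHn] w s /ltnSE lwn Ss lws f f0.
have [w1|w1] := pselect (w = 1%g).
  by rewrite w1 invg1 act1; exact: f0.
have [t St wt] := len_descent HS w1.
have st : s <> t by move=> st; move: lws wt; rewrite st; lia.
pose P k := (len (w * altprod t s k)%g + k == len w)%N.
have P1 : P 1%N by rewrite /P /= mulg1 wt addn1.
have Pmax k : P k -> (k <= len w)%N by rewrite /P; lia.
have [k Pk kmax] := ex_maxnP (ex_intro P 1%N P1) Pmax.
have k0 : (0 < k)%N by exact: kmax.
set v := (w * altprod t s k)%g.
have vk : (len v + k = len w)%N by exact/eqP.
have v_lt : (len v < n)%N by lia.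
pose x := if odd k then s else t; pose y := if odd k then t else s.
have Sx : S x by rewrite /x; case: ifP.
have Sy : S y by rewrite /y; case: ifP.
have vx : (len v < len (v * x)%g)%N.
  case: (len_mulgen HS v Sx) => [->//|vx].
  suff /kmax : P k.+1 by rewrite ltnn.
  by rewrite /P altprodSr mulgA -/v -/x addnS -addSn -vx vk.
have vy : (len v < len (v * y)%g)%N.
  have yE : (v * y = w * altprod t s k.-1)%g.
    rewrite /v /y; case: (k) k0 => [//|j] _; rewrite altprodSr /=.
    by case: (odd j); rewrite -!mulgA (coxeter_invol HS) // mulg1.
  have := lenM HS (w * altprod t s k.-1)%g (altprod t s k.-1)^-1%g.
  rewrite mulgK -yE lenV.
  have := len_le HS (expression_altprod k.-1 St Ss); lia.
have vst : pos_root v s /\ pos_root v t.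
  move: Sx Sy vx vy; rewrite /x /y; case: ifP => _ Sx Sy vx vy;
    by split; apply: IHn.
have wE : (w^-1 = altprod t s k * v^-1)%g by rewrite /v invgM mulgA mulgV mul1g.
rewrite wE actM act_altprod //.
have km : (m s t == 0%N) || (k < m s t)%N.
  case: (posnP (m s t)) => [->//|m0] /=; rewrite ltnNge; apply/negP => mk.
  have : (len (w * s) <= len v + len (altprod s t k.+1))%N.
    rewrite -(lenV HS (altprod s t k.+1)) (_ : w * s = v * (altprod s t k.+1)^-1)%g.
      exact: lenM.
    by rewrite /= invgM (mulg1_eq (coxeter_invol HS Ss)) mulgA /v mulgK.
  have := @len_altprod _ _ _ HS s t k.+1 Ss St; rewrite m0 ltnS mk /= => /(_ isT).
  lia.
have m1 : m s t != 1%N by apply/eqP => /(coxeter_matrix_eq1 HS Ss St).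
have c1 : 0 <= chebyshev (weight s t) k.+1 by exact: chebyshev_edge_weight_ge0.
have c0 : 0 <= chebyshev (weight s t) k.
  by apply: chebyshev_edge_weight_ge0 => //; case/orP: km => [->//|/ltnW->]; rewrite orbT.
have [fs ft] : 0 <= act v^-1%g f s /\ 0 <= act v^-1%g f t.
  by case: vst => vs vt; split; [exact: vs|exact: vt].
by rewrite addr_ge0 // mulr_ge0 //; case: ifP.
Qed.

Lemma act_mulgen w s f : S s -> act (w * s)^-1%g f s = - act w^-1%g f s.
Proof.
move=> Ss; rewrite invgM (mulg1_eq (coxeter_invol HS Ss)) actM act_gen // /refl.
by rewrite weight_diag //; ring.
Qed.

Lemma len_gt_neg_root w s : S s -> (len (w * s)%g < len w)%N -> neg_root w s.
Proof.
move=> Ss ws f f0; have := @len_lt_pos_root (w * s)%g s Ss.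
rewrite -mulgA (coxeter_invol HS Ss) mulg1 => /(_ ws f f0).
by rewrite act_mulgen // oppr_ge0.
Qed.

Lemma root_sign w s : S s -> pos_root w s \/ neg_root w s.
Proof.
move=> Ss; case: (len_mulgen HS w Ss) => E.
  by left; apply: len_lt_pos_root; rewrite // E.
by right; apply: len_gt_neg_root; rewrite // E.
Qed.

End Geometry.

(** * Roots *)

Section Roots.
Local Open Scope ring_scope.
Variables (W : groupType) (S : set W) (m : W -> W -> nat).
Hypothesis HS : coxeter_system S m.
Variable R : realType.
Implicit Types (f h : W -> R) (s t r : W) (g u v w : W).

Notation len := (len HS).
Notation act := (@act W S m HS R).
Notation pos_root := (@pos_root W S m HS R).
Notation neg_root := (@neg_root W S m HS R).
Notation weight := (@weight W m R).

(** The invariance of the symmetric form, seen in the dual. *)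
Lemma act_weight_sym w s t : S s -> S t ->
  act w (weight s) t = act w^-1%g (weight t) s.
Proof.
elim/(coxeter_ind HS): w s t => [|r w Sr IHw] s t Ss St.
  by rewrite invg1 !act1 (weightC HS R).
rewrite actM (act_gen _ _ Sr) /refl !IHw // invgM (mulg1_eq (coxeter_invol HS Sr)).
rewrite actM (act_gen _ _ Sr) (weightC HS R Sr St).
have -> : refl m r (weight t) = fun u => weight t r * weight r u + weight t u.
  by apply/funext => u; rewrite /refl; ring.
by rewrite act_lin; ring.
Qed.

Definition delta s : W -> R := fun u => if u == s then 1 else 0.

(** The only positive root that the reflection [s] makes negative is the simple root
    of [s]. Such a root vanishes on the nonnegative functions that are zero at [s],
    because [s] fixes them, so it is [k] times the simple root; invariance of the form
    gives [k * k = 1]. *)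
Lemma simple_flip u s t : S s -> S t -> pos_root u t -> neg_root (s * u)%g t ->
  forall f, act u^-1%g f t = f s.
Proof.
move=> Ss St pos_u neg_su.
have flip f : nonneg S f -> act u^-1%g (refl m s f) t <= 0.
  move=> f0; have := neg_su f f0.
  by rewrite invgM (mulg1_eq (coxeter_invol HS Ss)) actM (act_gen _ _ Ss).
have fix0 f : nonneg S f -> f s = 0 -> act u^-1%g f t = 0.
  move=> f0 fs; apply/eqP; rewrite eq_le pos_u // andbT.
  suff -> : f = refl m s f by exact: flip.
  by apply/funext => x; rewrite /refl fs mulr0 addr0.
pose k := act u^-1%g (delta s) t.
have prop f : act u^-1%g f t = f s * k.
  pose h x := f x - f s * delta s x.
  pose hp x := Num.max (h x) 0; pose hn x := Num.max (- h x) 0.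
  have hs : h s = 0 by rewrite /h /delta eqxx; ring.
  have fE : f = fun x => f s * delta s x + ((-1) * hn x + hp x).
    apply/funext => x; rewrite /hn /hp.
    have -> : -1 * Num.max (- h x) 0 + Num.max (h x) 0 = h x.
      by case: (lerP (h x) 0) => hx; case: (lerP (- h x) 0) => hx'; lra.
    by rewrite /h; ring.
  have hn0 : act u^-1%g hn t = 0.
    by apply: fix0 => [x _|]; rewrite /hn ?hs ?oppr0 ?maxxx // le_max lexx orbT.
  have hp0 : act u^-1%g hp t = 0.
    by apply: fix0 => [x _|]; rewrite /hp ?hs ?maxxx // le_max lexx orbT.
  by rewrite {1}fE act_lin act_lin hn0 hp0 -/k; ring.
have k0 : 0 <= k by apply: pos_u => x _; rewrite /delta; case: ifP.
have k2 : k * k = 1.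
  have E1 : act u^-1%g (act u (weight t)) t = -2 by rewrite actVK (weight_diag HS).
  have := prop (act u (weight t)); rewrite E1 act_weight_sym // prop.
  by rewrite (weight_diag HS) //; lra.
have k1 : k = 1 by nra.
by move=> f; rewrite prop k1 mulr1.
Qed.

Definition root_form w s : (W -> R) -> R := fun f => act w^-1%g f s.

Let bounded f := exists M : R, forall s, S s -> `|f s| <= M.

Lemma bounded_act w f : bounded f -> bounded (act w f).
Proof.
move=> bf; elim/(coxeter_ind HS): w => [|s w Ss [M bM]]; first by rewrite act1.
exists (M + 2 * M) => u Su; rewrite actM (act_gen _ _ Ss) /refl.
apply: (le_trans (ler_normD _ _)); apply: lerD; first exact: bM.
by rewrite normrM ler_pM // ?edge_weight_norm //; exact: bM.
Qed.

(** An interior point of the fundamental chamber. *)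
Definition rho : W -> R := fun=> 1.

Lemma nonneg_rho : nonneg S rho. Proof. by move=> s _; rewrite /rho. Qed.

(** A root vanishing at the constant function 1 would, having a sign, vanish at all
    bounded functions, but it takes the value [-2] at one of them. *)
Lemma root_rho_neq0 w s : S s -> root_form w s rho != 0.
Proof.
move=> Ss; apply/eqP => w0.
have [M bM] : bounded (act w (weight s)).
  by apply: bounded_act; exists 2 => t St; exact: edge_weight_norm.
set f := act w _ in bM.
have fs : act w^-1%g f s = -2 by rewrite actVK (weight_diag HS).
have ge e : `|e| = 1 -> nonneg S (fun u => M * rho u + e * f u).
  move=> e1 t St; rewrite /rho; have := ler_norm (- (e * f t)).
  by rewrite normrN normrM e1 mul1r; have := bM t St; lra.
have E e : act w^-1%g (fun u => M * rho u + e * f u) s = e * -2.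
  by rewrite act_lin actZ fs; move: w0; rewrite /root_form => ->; ring.
have [pw|nw] := root_sign HS R w Ss.
  have := pw _ (ge 1 (normr1 _)); rewrite E; lra.
have := nw _ (ge (-1) (normrN1 _)); rewrite E; lra.
Qed.

Lemma root_rho_pos w s : S s -> 0 < root_form w s rho -> pos_root w s.
Proof.
move=> Ss w0; have [//|nw] := root_sign HS R w Ss.
by have := nw _ nonneg_rho; rewrite leNgt w0.
Qed.

Lemma root_rho_neg w s : S s -> root_form w s rho < 0 -> neg_root w s.
Proof.
move=> Ss w0; have [pw|//] := root_sign HS R w Ss.
by have := pw _ nonneg_rho; rewrite leNgt w0.
Qed.

(** Each factor of [g] adds at most one root to those that become negative. *)
Lemma inversions_finite g : exists L : seq ((W -> R) -> R), forall w s,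
  S s -> pos_root w s -> neg_root (g * w)%g s -> root_form w s \in L.
Proof.
elim/(coxeter_ind HS): g => [|r g Sr [L LP]].
  exists [::] => w s Ss pw; rewrite mul1g => nw.
  have /negP[] := root_rho_neq0 w Ss.
  by rewrite eq_le (pw _ nonneg_rho) (nw _ nonneg_rho).
exists ((fun f => act g f r) :: L) => w s Ss pw nw; rewrite inE.
have [pgw|ngw] := root_sign HS R (g * w)%g Ss; last by rewrite LP ?orbT.
apply/orP; left; apply/eqP/funext => f.
rewrite -mulgA in nw; have E := simple_flip Sr Ss pgw nw.
by rewrite -E /root_form invgM actM actVK.
Qed.

Lemma sum_act_fixed (l : seq W) g f : uniq l -> [set` l] g ->
  is_subgroup [set` l] ->
  act g (fun u => \sum_(x <- l) act x f u) = fun u => \sum_(x <- l) act x f u.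
Proof.
move=> ul lg sgl; apply/funext => u; rewrite act_sum.
under eq_bigr do rewrite -actM.
rewrite -(big_map (fun x => g * x)%g xpredT (fun x => act x f u)).
apply: perm_big; apply: uniq_perm => //; first by rewrite map_inj_uniq //; exact: mulgI.
move=> x; apply/mapP/idP => [[y ly ->]|lx].
  exact: (subgroupM sgl lg ly).
exists (g^-1 * x)%g; last by rewrite mulgA mulgV mul1g.
exact: (subgroupM sgl (subgroupV sgl lg) lx).
Qed.

(** Reflecting in a simple root that is negative at [f] removes this root from the
    positive roots negative at [f] and permutes the others, so a point where finitely
    many positive roots are negative can be moved into the fundamental chamber. *)
Lemma tits_cone n : forall (L : seq ((W -> R) -> R)) f, (size L <= n)%N ->
  (forall w s, S s -> pos_root w s -> root_form w s f < 0 -> root_form w s \in L) ->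
  exists w, nonneg S (act w f).
Proof.
elim: n => [|n IHn] L f Ln Lf;
    (have [f0|nf0] := pselect (nonneg S f); first by exists 1%g; rewrite act1).
all: have [s Ss fs] : exists2 s, S s & f s < 0
  by apply: contrapT => nf; apply: nf0 => s Ss; rewrite leNgt;
     apply/negP => fs; apply: nf; exists s.
all: have p1 : pos_root 1%g s by move=> h h0; rewrite invg1 act1; exact: h0.
all: have sL : root_form 1%g s \in L by apply: Lf => //; rewrite /root_form invg1 act1.
  by move: Ln sL; rewrite leqn0 size_eq0 => /eqP->.
pose L' : seq ((W -> R) -> R) := [seq (fun h => b (refl m s h)) | b <- L & b != root_form 1%g s].
have [|w t St pw wt|w w0] := IHn L' (refl m s f).
- rewrite size_map -ltnS; apply: leq_trans Ln.
  rewrite size_filter ltn_neqAle count_size andbT -all_count; apply/allPn.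
  by exists (root_form 1%g s) => //; rewrite negbK.
- have rS h : root_form (s * w)%g t h = root_form w t (refl m s h).
    by rewrite /root_form invgM (mulg1_eq (coxeter_invol HS Ss)) actM (act_gen _ _ Ss).
  have rr h : refl m s (refl m s h) = h.
    by rewrite -!(act_gen HS _ Ss) -actM (coxeter_invol HS Ss) act1.
  have [psw|nsw] := root_sign HS R (s * w)%g St; last first.
    move: wt; rewrite /root_form (simple_flip Ss St pw nsw) /refl (weight_diag HS) //.
    by move: fs; lra.
  apply/mapP; exists (root_form (s * w)%g t); last by apply/funext => h; rewrite rS rr.
  rewrite mem_filter Lf ?rS //.
  rewrite andbT; apply/eqP => E; have := pw _ nonneg_rho.
  rewrite -/(root_form w t rho) -[rho]rr -rS E /root_form invg1 act1 /refl (weight_diag HS) // /rho; lra.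
by exists (w * s)%g; rewrite actM (act_gen _ _ Ss).
Qed.

End Roots.

(** * Parabolic and finite subgroups *)

Section ZeroSums.
Local Open Scope ring_scope.
Lemma sumr0_gt0 (R : realDomainType) (I : eqType) (l : seq I) (F : I -> R) :
  \sum_(x <- l) F x = 0 -> (forall x, x \in l -> F x != 0) -> (exists x, x \in l) ->
  exists2 x, x \in l & 0 < F x.
Proof.
move=> s0 nz [x xl]; apply: contrapT => np.
have : \sum_(i <- l | i \in l) - F i = 0 by rewrite -big_seq sumrN s0 oppr0.
move/eqP; rewrite psumr_eq0 => [/allP/(_ x xl)|i il].
  by rewrite xl oppr_eq0 (negbTE (nz x xl)).
by rewrite oppr_ge0 leNgt; apply/negP => Fi; apply: np; exists i.
Qed.

End ZeroSums.

Section Parabolic.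
Local Open Scope ring_scope.
Variables (W : groupType) (S : set W) (m : W -> W -> nat).
Hypothesis HS : coxeter_system S m.
Variable R : realType.
Implicit Types (f h : W -> R) (s t r : W) (g u v w : W) (T B : set W).

Notation len := (len HS).
Notation act := (@act W S m HS R).
Notation pos_root := (@pos_root W S m HS R).
Notation neg_root := (@neg_root W S m HS R).
Notation weight := (@weight W m R).
Notation root_form := (@root_form W S m HS R).
Notation delta := (@delta W R).
Notation rho := (@rho W R).

(** Applied to [delta s] for [s] outside [T], this tells the subgroup generated by [T]
    from elements and descents involving [s]. *)
Lemma act_parabolic_fixed T f u : T `<=` S -> (forall t, T t -> f t = 0) ->
  generated T u -> act u f = f.
Proof.
move=> TS fT; move: u; apply: (@generated_min _ _ [set u | act u f = f]).
  split=> [|u v /= uf vf|u /= uf]; first exact: act1.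
    by rewrite actM vf.
  by rewrite -{1}uf actVK.
move=> t Tt /=; rewrite (act_gen _ _ (TS _ Tt)).
by apply/funext => x; rewrite /refl (fT t Tt) mulr0 addr0.
Qed.

Lemma parabolic_gen T s : T `<=` S -> S s -> generated T s -> T s.
Proof.
move=> TS Ss gs; apply: contrapT => nTs.
have d0 t : T t -> delta s t = 0.
  by move=> Tt; rewrite /delta; case: eqP => // ts; case: nTs; rewrite -ts.
have /(congr1 (fun f => f s)) := act_parabolic_fixed TS d0 gs.
by rewrite (act_gen _ _ Ss) /refl (weight_diag HS) // /delta eqxx; lra.
Qed.

Lemma parabolic_descent T u : T `<=` S -> generated T u -> u <> 1%g ->
  exists2 s, T s & len u = (len (u * s)%g).+1.
Proof.
move=> TS gu u1; have [s Ss us] := len_descent HS u1; exists s => //.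
apply: contrapT => nTs.
have d0 t : T t -> delta s t = 0.
  by move=> Tt; rewrite /delta; case: eqP => // ts; case: nTs; rewrite -ts.
have nu : neg_root u s by apply: len_gt_neg_root; rewrite // us.
have dn : nonneg S (delta s) by move=> t _; rewrite /delta; case: ifP.
have := nu _ dn.
rewrite (act_parabolic_fixed TS d0 (subgroupV (generated_subgroup T) gu)).
by rewrite /delta eqxx ler10.
Qed.

Lemma parabolic_faithful T u : T `<=` S -> generated T u ->
  (forall t f, T t -> act u^-1%g f t = f t) -> u = 1%g.
Proof.
move=> TS gu uT; apply: contrapT => u1.
have [s Ts us] := parabolic_descent TS gu u1.
have nu : neg_root u s by apply: len_gt_neg_root; [exact: TS|rewrite us].
by have := nu _ (@nonneg_rho _ S R); rewrite uT // /rho ler10.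
Qed.

(** By induction on the length: if [s] is a descent of [g], the root [g s] is negative,
    which forces [z s = 0]. *)
Lemma stabilizer_parabolic z g : nonneg S z -> nonneg S (act g z) ->
  generated [set s | S s /\ z s = 0] g.
Proof.
set T := (X in generated X); move=> z0; have sgT := generated_subgroup T.
have [n] := ubnP (len g); elim: n g => [//|n IHn] g /ltnSE gn gz0.
have [->|g1] := pselect (g = 1%g); first exact: subgroup1.
have [s Ss gs] := len_descent HS g1.
have ng : neg_root g s by apply: len_gt_neg_root; rewrite // gs.
have zs : z s = 0.
  by apply/eqP; rewrite eq_le z0 // andbT -[z](actVK HS g); exact: ng.
have Ts : T s by [].
rewrite -[g]mulg1 -(coxeter_invol HS Ss) mulgA.
apply: (subgroupM sgT); last exact: sub_generated.
apply: IHn; first by rewrite -gs.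
rewrite actM (act_gen _ _ Ss); suff -> : refl m s z = z by [].
by apply/funext => x; rewrite /refl zs mulr0 addr0.
Qed.

(** An element is determined by its action on the simple roots of [T]. *)
Lemma finite_generated_of_roots T (L : seq ((W -> R) -> R)) :
  T `<=` S -> finite_set T ->
  (forall u t, generated T u -> T t -> root_form u t \in L) ->
  finite_set (generated T).
Proof.
move=> TS /finite_seqP[lT TE] LP.
pose n := size lT; pose Phi u : n.-tuple ((W -> R) -> R) := [tuple of map (root_form u) (in_tuple lT)].
have Phi_inj u v : generated T u -> generated T v -> Phi u = Phi v -> u = v.
  move=> gu gv /(congr1 val) /= /eq_in_map uv.
  have sgT := generated_subgroup T.
  suff /mulg1_eq : (v^-1 * u = 1)%g by rewrite invgK.
  apply: (parabolic_faithful TS (subgroupM sgT (subgroupV sgT gv) gu)) => t f Tt.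
  rewrite invgM invgK actM.
  have tl : t \in lT by rewrite TE in Tt.
  by have := uv t tl; rewrite /root_form => /(congr1 (fun F => F (act v f))) ->; rewrite actVK.
have /choice[inv invP] : forall x, exists u, forall u', generated T u' -> Phi u' = x ->
    u = u'.
  move=> x; have [[u gu ux]|nu] := pselect (exists2 u, generated T u & Phi u = x).
    by exists u => u' gu' u'x; apply: Phi_inj => //; rewrite ux.
  by exists 1%g => u' gu' u'x; case: nu; exists u'.
pose val_of (x : {ffun 'I_n -> seq_sub L}) : n.-tuple ((W -> R) -> R) :=
  [tuple ssval (x i) | i < n].
apply: (@sub_finite_set _ _ ((inv \o val_of) @` setT)); last first.
  exact/finite_image/finite_finset.
move=> u gu.
have mL (i : 'I_n) : tnth (Phi u) i \in L.
  rewrite tnth_map; apply: LP => //; rewrite TE /=; exact: mem_tnth.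
exists [ffun i => SeqSub (mL i)] => //=; apply: invP => //.
by apply: eq_from_tnth => i; rewrite tnth_mktuple ffunE.
Qed.

(** Tits: the sum [y] of the orbit of [rho] under [F] is fixed by [F]. Once moved into the
    fundamental chamber by [w], its stabilizer is generated by the set [T] of generators
    at which it vanishes. This stabilizer is finite: a root of [T] is zero at [w y], so
    it takes both signs on the orbit, and only finitely many roots do. *)
Lemma finite_subgroup_conjugate (F : set W) :
  finite_set S -> is_subgroup F -> finite_set F ->
  exists w T, [/\ T `<=` S, finite_set (generated T) &
    forall g, F g -> generated T (w * g * w^-1)%g].
Proof.
move=> finS sgF /finite_seqP[l0 FE]; pose l := undup l0.
have {}FE : F = [set` l] by rewrite FE; apply/seteqP; split=> x /=; rewrite mem_undup.
have ul : uniq l by exact: undup_uniq.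
pose y : W -> R := fun u => \sum_(x <- l) act x rho u.
have y_fix g : F g -> act g y = y by rewrite FE in sgF * => Fg; exact: sum_act_fixed.
have root_y u t : root_form u t y = \sum_(x <- l) root_form (x^-1 * u)%g t rho.
  by rewrite /root_form act_sum; apply: eq_bigr => x _; rewrite invgM invgK actM.
have /choice[Linv LinvP] := inversions_finite HS R.
have [w wy0] : exists w, nonneg S (act w y).
  pose L := flatten [seq Linv x^-1%g | x <- l].
  apply: (@tits_cone _ _ _ HS R (size L) L) => // u t St pu uy.
  have [x xl ux] : exists2 x, x \in l & root_form (x^-1 * u)%g t rho < 0.
    apply: contrapT => nx; move: uy; rewrite root_y ltNge => /negP; apply.
    rewrite big_seq; apply: sumr_ge0 => x xl; rewrite leNgt; apply/negP => ux.
    by apply: nx; exists x.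
  apply/flattenP; exists (Linv x^-1%g); first exact: map_f.
  by apply: LinvP => //; exact: root_rho_neg.
set z := act w y in wy0.
pose T := [set s | S s /\ z s = 0].
have TS : T `<=` S by move=> s [].
exists w, T; split=> //; last first.
  move=> g Fg; apply: stabilizer_parabolic => //.
  suff -> : act (w * g * w^-1)%g z = z by [].
  by rewrite !actM /z actVK (y_fix _ Fg).
pose L := flatten [seq flatten [seq
  [seq (fun h => b (act (x^-1 * w^-1)%g h)) | b <- Linv (x'^-1 * x)%g]
  | x' <- l] | x <- l].
apply: (@finite_generated_of_roots T L TS); first exact: sub_finite_set finS.
move=> u t gu Tt; have St := TS _ Tt; pose v := (w^-1 * u)%g.
have act_uz : act u^-1%g z = z.
  have gV := subgroupV (generated_subgroup T) gu.
  move: gV; apply: (@generated_min _ T [set u | act u z = z]) => [|s [Ss zs]] /=.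
    split=> [|a b /= az bz|a /= az]; first exact: act1.
      by rewrite actM bz.
    by rewrite -{1}az actVK.
  by rewrite (act_gen _ _ Ss); apply/funext => x; rewrite /refl zs mulr0 addr0.
have sum0 : \sum_(x <- l) root_form (x^-1 * v)%g t rho = 0.
  rewrite -root_y /root_form /v invgM invgK actM -/z act_uz; exact: Tt.2.
have lN0 : exists x, x \in l.
  by exists 1%g; have := subgroup1 sgF; rewrite FE.
have nz x : root_form (x^-1 * v)%g t rho != 0 by exact: root_rho_neq0.
have [x xl xv] := sumr0_gt0 sum0 (fun x _ => nz x) lN0.
have [|x' _|x' x'l] := @sumr0_gt0 _ _ l (fun x => - root_form (x^-1 * v)%g t rho) _ _ lN0.
- by rewrite sumrN sum0 oppr0.
- by rewrite oppr_eq0.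
rewrite oppr_gt0 => x'v; apply/flattenP; eexists; first exact: map_f xl.
apply/flattenP; eexists; first exact: map_f x'l.
apply/mapP; exists (root_form (x^-1 * v)%g t).
  apply: LinvP => //; first exact: root_rho_pos.
  rewrite -mulgA mulVKg; exact: root_rho_neg.
apply/funext => h; rewrite /root_form /v -actM.
by rewrite (mulgA x^-1%g) invgM -mulgA mulVg mulg1.
Qed.

(** The functional [X] given by the weights does not decrease when a generator is
    applied to a function nonnegative there, so it is positive on the orbit of [rho].
    But the sum of this orbit is fixed by every generator in [T], hence vanishes on
    [T], and so does [X] at this sum. *)
Lemma finite_generated_weights T (l : seq (R * W)) :
  T `<=` S -> finite_set (generated T) ->
  (forall p, p \in l -> 0 <= p.1 /\ T p.2) -> 0 < \sum_(p <- l) p.1 ->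
  (forall s, T s -> 0 <= \sum_(p <- l) p.1 * weight s p.2) -> False.
Proof.
move=> TS finT lP x0 cP.
pose X (f : W -> R) := \sum_(p <- l) p.1 * f p.2.
have X_rho u : generated T u -> X rho <= X (act u rho).
  have [n] := ubnP (len u); elim: n u => [//|n IHn] u /ltnSE un gu.
  have [->|u1] := pselect (u = 1%g); first by rewrite act1.
  have sgT := generated_subgroup T; have gV := subgroupV sgT gu.
  have [|s Ts us] := parabolic_descent TS gV.
    by move=> uV; apply: u1; rewrite -[u]invgK uV invg1.
  have Ss := TS _ Ts; pose v := (s * u)%g.
  have vV : (v^-1 = u^-1 * s)%g by rewrite /v invgM (mulg1_eq (coxeter_invol HS Ss)).
  have gv : generated T v by apply: (subgroupM sgT) => //; exact: sub_generated.
  have lv : (len v < n)%N by rewrite -(lenV HS v) vV -(lenV HS u) us in un *.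
  have pv : pos_root v^-1%g s.
    apply: len_lt_pos_root => //.
    by rewrite vV -mulgA (coxeter_invol HS Ss) mulg1 us.
  apply: (le_trans (IHn v lv gv)).
  have -> : u = (s * v)%g by rewrite /v mulgA (coxeter_invol HS Ss) mul1g.
  rewrite actM (act_gen _ _ Ss) /refl /X.
  have -> : \sum_(p <- l) p.1 * (act v rho p.2 + weight s p.2 * act v rho s) =
      X (act v rho) + act v rho s * \sum_(p <- l) p.1 * weight s p.2.
    by rewrite mulr_sumr -big_split /=; apply: eq_bigr => t _; ring.
  rewrite lerDl mulr_ge0 ?cP //.
  by have := pv _ (@nonneg_rho _ S R); rewrite invgK.
have [r0 FE] := (finite_seqP _).1 finT; pose r := undup r0.
have {}FE : generated T = [set` r].
  by rewrite FE; apply/seteqP; split=> u /=; rewrite mem_undup.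
pose y : W -> R := fun t => \sum_(u <- r) act u rho t.
have y0 s : T s -> y s = 0.
  move=> Ts; have : act s y = y.
    have sgT := generated_subgroup T; rewrite FE in sgT.
    apply: sum_act_fixed => //; first exact: undup_uniq.
    by rewrite -FE; exact: sub_generated.
  rewrite (act_gen _ _ (TS _ Ts)) => /(congr1 (fun f => f s)).
  by rewrite /refl (weight_diag HS) ?TS //; [lra|exact: TS].
have : X y = \sum_(u <- r) X (act u rho).
  rewrite /X exchange_big /=; apply: eq_bigr => t _; by rewrite mulr_sumr.
have -> : X y = 0.
  by rewrite /X big_seq big1 // => p /lP[_ Tp]; rewrite y0 // mulr0.
have Xr : 0 < X rho by rewrite /X /rho; under eq_bigr do rewrite mulr1.
have r1 : 1%g \in r.
  by have := subgroup1 (generated_subgroup T); rewrite FE.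
rewrite (big_rem 1%g) //= act1 => s0.
suff : 0 <= \sum_(u <- rem 1%g r) X (act u rho) by lra.
rewrite big_seq; apply: sumr_ge0 => u /mem_rem ur.
by apply: (le_trans (ltW Xr)); apply: X_rho; rewrite FE.
Qed.

End Parabolic.

(** Finitely many generators occur in words for the elements of [A]; they generate
    [W], so no other generator exists. *)
Lemma finite_coxeter_generators (R : realType) (W : groupType) (S A : set W) m :
  coxeter_system S m -> finite_set A -> generated A = setT -> finite_set S.
Proof.
move=> HS /finite_seqP[l AE] gA.
have /choice[wd wdP] : forall w : W, exists u, word_over S u /\ word_val u = w.
  by move=> w; have [u Su uw] := word_overP (coxeter_generated HS w); exists u.
pose L := flatten [seq [seq a.1 | a <- wd x] | x <- l].
have LS : [set` L] `<=` S.
  move=> s /= /flattenP[_ /mapP[x _ ->] /mapP[a ax ->]].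
  by have [Sx _] := wdP x; exact: Sx.
have gL : generated [set` L] = setT.
  apply/seteqP; split=> // w _.
  have : generated A w by rewrite gA.
  move: w; apply: generated_min (generated_subgroup _) _ => x; rewrite AE => /= xl.
  have [_ <-] := wdP x; apply: generated_word => a ax /=.
  by apply/flattenP; exists [seq b.1 | b <- wd x]; [exact: map_f|exact: map_f].
apply: (@sub_finite_set _ _ [set` L]); last exact: finite_seq.
move=> s Ss; apply: (parabolic_gen HS R LS Ss); by rewrite gL.
Qed.

(** * Diagrams of finite Coxeter groups *)

Section FiniteDiagrams.
Local Open Scope ring_scope.
Variables (W : groupType) (S : set W) (m : W -> W -> nat).
Hypothesis HS : coxeter_system S m.
Variable R : realType.
Variable B : set W.
Hypotheses (BS : B `<=` S) (finB : finite_set (generated B)).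
Implicit Types (a b c d e s t : W).

Notation wt := (@weight W m R).
Notation r2 := (Num.sqrt 2 : R).
Notation r3 := (Num.sqrt 3 : R).

Lemma sqrt2P : [/\ 1 <= r2, r2 <= 2 & r2 * r2 = 2].
Proof.
have e : r2 * r2 = 2 by rewrite -expr2 sqr_sqrtr.
have p : 0 <= r2 by exact: sqrtr_ge0.
by split=> //; nra.
Qed.

Lemma sqrt3P : [/\ 1 <= r3, r3 <= 2 & r3 * r3 = 3].
Proof.
have e : r3 * r3 = 3 by rewrite -expr2 sqr_sqrtr.
have p : 0 <= r3 by exact: sqrtr_ge0.
by split=> //; nra.
Qed.

Lemma weight_pairP a b : B a -> B b -> a != b ->
  [/\ 0 <= wt a b, 0 <= r2 * wt a b, 0 <= r3 * wt a b & wt b a = wt a b].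
Proof.
move=> Ba Bb ab; have w0 : 0 <= wt a b.
  by apply: (weight_ge0 HS); [exact: BS|exact: BS|exact/eqP].
split=> //; try by rewrite mulr_ge0 // sqrtr_ge0.
by apply: (weightC HS); exact: BS.
Qed.

Lemma weight_edge3P a b : (2 < m a b)%N -> 1 <= wt a b /\ r2 <= r2 * wt a b.
Proof.
move=> ab; have w1 : 1 <= wt a b.
  by apply: edge_weight_ge1; rewrite !inE; lia.
by split=> //; rewrite ler_peMr // sqrtr_ge0.
Qed.

Lemma weight_edge4P a b : (3 < m a b)%N -> r2 <= wt a b /\ 2 <= r2 * wt a b.
Proof.
move=> ab; have [r1 _ rr] := sqrt2P; have w0 : 0 <= wt a b.
  by apply: edge_weight_ge0; lia.
have w2 : r2 <= wt a b.
  by rewrite -(ler_pXn2r (n := 2)) ?nnegrE ?sqrtr_ge0 // sqr_sqrtr // edge_weight_ge_sqrt2.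
split=> //; nra.
Qed.

(** Outside the support of the weights the condition is automatic, as the weights of
    distinct generators are nonnegative. *)
Lemma excluded_weights (q : R * W) (l : seq (R * W)) :
  all (fun p => 0 <= p.1) (q :: l) -> 0 < q.1 -> (forall p, p \in q :: l -> B p.2) ->
  (forall p, p \in q :: l -> 0 <= \sum_(r <- q :: l) r.1 * wt p.2 r.2) -> False.
Proof.
move=> /allP l0 q0 lB cl.
apply: (finite_generated_weights HS BS finB (l := q :: l)) => [p pl||s Bs].
- by split; [exact: l0|exact: lB].
- rewrite big_cons ltr_wpDr // big_seq; apply: sumr_ge0 => p pl.
  by apply: l0; rewrite inE pl orbT.
have [/hasP[p pl /eqP<-]|/hasPn ns] := boolP (has (fun p => p.2 == s) (q :: l)).
  exact: cl.
rewrite big_seq; apply: sumr_ge0 => p pl.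
rewrite mulr_ge0 ?l0 //; apply: (weight_ge0 HS); [exact: BS|exact/BS/lB|].
by move=> sp; move: (ns p pl); rewrite sp eqxx.
Qed.

Lemma label_gt0 a b : B a -> B b -> (0 < m a b)%N.
Proof.
move=> Ba Bb; rewrite lt0n; apply/eqP => m0.
apply: (@excluded_weights (1, a) [:: (1, b)]); rewrite /= ?ler01 ?ltr01 //.
  by move=> p; rewrite !inE => /orP[] /eqP->.
have mb0 : m b a = 0%N by rewrite (coxeter_matrix_sym HS) //; exact: BS.
move=> q; rewrite !inE => /orP[] /eqP->; rewrite !big_cons big_nil /= (weight_diag HS);
  try exact: BS; by rewrite /weight ?m0 ?mb0 edge_weight0; lra.
Qed.

Lemma label_eq2 a b : B a -> B b -> a != b -> ~ (2 < m a b)%N -> m a b = 2%N.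
Proof.
move=> Ba Bb /eqP ab; have := label_gt0 Ba Bb.
have : m a b <> 1%N by move=> /(coxeter_matrix_eq1 HS (BS Ba) (BS Bb)).
lia.
Qed.

Lemma labelC a b : B a -> B b -> m a b = m b a.
Proof. by move=> Ba Bb; apply: (coxeter_matrix_sym HS); exact: BS. Qed.

(* Keeps the facts on the weights and square roots in the goal, abstracting these
   numbers, as the inequality solver is slow on compound atoms. *)
Ltac generalize_weights :=
  repeat match goal with
  | |- context [weight ?n ?K ?x ?y] => generalize dependent (weight n K x y); intros
  end;
  repeat match goal with H : context [weight _ _ _ _] |- _ => clear H end;
  repeat match goal with
  | |- context [Num.sqrt ?x] => generalize dependent (Num.sqrt x); intros
  end;
  repeat match goal with H : context [Num.sqrt _] |- _ => clear H end.

(* Checks the system of inequalities one generator at a time, after splitting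
   [uniq] into disequalities and replacing each by the facts on the weight of the
   pair. *)
Ltac check_weights q l :=
  let U := fresh "U" in move=> U;
  let p := fresh "p" in
  apply: (@excluded_weights q l);
  [ by rewrite /= ?mulr_ge0 ?sqrtr_ge0 ?ler01 ?ler0n
  | by rewrite /= ?ltr01 ?ltr0n
  | by move=> p; rewrite !inE; repeat (case/orP => [/eqP->//|]); move/eqP->
  | move: U; rewrite /= ?inE ?negb_or ?andbT; move=> U;
    repeat match goal with H : is_true (_ && _) |- _ => move/andP: H => [? ?] end;
    repeat match goal with
    | H : is_true (?x != ?y), Hx : B ?x, Hy : B ?y |- _ =>
      case: (weight_pairP Hx Hy H) => ? ? ? ?; clear H
    end;
    have [? ? ?] := sqrt2P; have [? ? ?] := sqrt3P;
    move=> p; rewrite !inE;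
    repeat (case/orP => [/eqP->|]);
    [..| move/eqP->];
    rewrite !big_cons big_nil /=;
    repeat match goal with E : weight _ _ _ _ = weight _ _ _ _ |- _ => rewrite ?E; clear E end;
    rewrite (weight_diag HS); first [exact: BS | generalize_weights; lra] ].

(** The diagrams excluded below are affine, and the weights are the marks of the affine
    diagram, rescaled by square roots across its multiple edges; only the hyperbolic
    diagram [3; 5; 3] needs other ones. More edges or larger labels only increase the
    sums. *)
Lemma no_triangle a b c : B a -> B b -> B c ->
  (2 < m a b)%N -> (2 < m b c)%N -> (2 < m a c)%N -> uniq [:: a; b; c] -> False.
Proof.
move=> Ba Bb Bc /weight_edge3P[ab _] /weight_edge3P[bc _] /weight_edge3P[ac _].
by check_weights (1 : R, a) [:: (1 : R, b); (1, c)].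
Qed.

Lemma no_path_4_4 a b c : B a -> B b -> B c ->
  (3 < m a b)%N -> (3 < m b c)%N -> uniq [:: a; b; c] -> False.
Proof.
move=> Ba Bb Bc /weight_edge4P[? ?] /weight_edge4P[? ?].
by check_weights (1 : R, a) [:: (r2 : R, b); (1, c)].
Qed.

Lemma no_path_3_6 a b c : B a -> B b -> B c ->
  (2 < m a b)%N -> (5 < m b c)%N -> uniq [:: a; b; c] -> False.
Proof.
move=> Ba Bb Bc /weight_edge3P[? _] bc.
have [? r3_2 rr] := sqrt3P.
have w0 : 0 <= wt b c by apply: edge_weight_ge0; lia.
have w3 : r3 <= wt b c.
  by rewrite -(ler_pXn2r (n := 2)) ?nnegrE ?sqrtr_ge0 // sqr_sqrtr // edge_weight_ge_sqrt3.
have w3' : 3 <= r3 * wt b c by nra.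
by check_weights (1 : R, a) [:: (2 : R, b); (r3, c)].
Qed.

Lemma no_square a b c d : B a -> B b -> B c -> B d ->
  (2 < m a b)%N -> (2 < m b c)%N -> (2 < m c d)%N -> (2 < m a d)%N ->
  uniq [:: a; b; c; d] -> False.
Proof.
move=> Ba Bb Bc Bd /weight_edge3P[? _] /weight_edge3P[? _] /weight_edge3P[? _].
move=> /weight_edge3P[? _].
by check_weights (1 : R, a) [:: (1 : R, b); (1, c); (1, d)].
Qed.

Lemma no_star_3_3_4 c a b d : B c -> B a -> B b -> B d ->
  (2 < m c a)%N -> (2 < m c b)%N -> (3 < m c d)%N ->
  uniq [:: c; a; b; d] -> False.
Proof.
move=> Bc Ba Bb Bd /weight_edge3P[? _] /weight_edge3P[? _] /weight_edge4P[? ?].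
by check_weights (2 : R, c) [:: (1 : R, a); (1, b); (r2, d)].
Qed.

Lemma no_path_4_3_4 a b c d : B a -> B b -> B c -> B d ->
  (3 < m a b)%N -> (2 < m b c)%N -> (3 < m c d)%N -> uniq [:: a; b; c; d] -> False.
Proof.
move=> Ba Bb Bc Bd /weight_edge4P[? ?] /weight_edge3P[? ?] /weight_edge4P[? ?].
by check_weights (1 : R, a) [:: (r2 : R, b); (r2, c); (1, d)].
Qed.

Lemma no_path_3_5_3 a b c d : B a -> B b -> B c -> B d ->
  (2 < m a b)%N -> (4 < m b c)%N -> (2 < m c d)%N -> uniq [:: a; b; c; d] -> False.
Proof.
move=> Ba Bb Bc Bd /weight_edge3P[? ?] bc /weight_edge3P[? ?].
have ? : 3 / 2 <= wt b c by exact: edge_weight_ge3div2.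
by check_weights (1 : R, a) [:: (2 : R, b); (2, c); (1, d)].
Qed.

Lemma no_star_4_leaves c a b d e : B c -> B a -> B b -> B d -> B e ->
  (2 < m c a)%N -> (2 < m c b)%N -> (2 < m c d)%N -> (2 < m c e)%N ->
  uniq [:: c; a; b; d; e] -> False.
Proof.
move=> Bc Ba Bb Bd Be /weight_edge3P[? _] /weight_edge3P[? _] /weight_edge3P[? _].
move=> /weight_edge3P[? _].
by check_weights (2 : R, c) [:: (1 : R, a); (1, b); (1, d); (1, e)].
Qed.

Lemma no_fork_4 c a b d e : B c -> B a -> B b -> B d -> B e ->
  (2 < m c a)%N -> (2 < m c b)%N -> (2 < m c d)%N -> (3 < m d e)%N ->
  uniq [:: c; a; b; d; e] -> False.
Proof.
move=> Bc Ba Bb Bd Be /weight_edge3P[? _] /weight_edge3P[? _] /weight_edge3P[? ?].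
move=> /weight_edge4P[? ?].
by check_weights (2 : R, c) [:: (1 : R, a); (1, b); (2, d); (r2, e)].
Qed.

Lemma no_path_4_3_3_4 a b c d e : B a -> B b -> B c -> B d -> B e ->
  (3 < m a b)%N -> (2 < m b c)%N -> (2 < m c d)%N -> (3 < m d e)%N ->
  uniq [:: a; b; c; d; e] -> False.
Proof.
move=> Ba Bb Bc Bd Be /weight_edge4P[? ?] /weight_edge3P[? ?] /weight_edge3P[? ?].
move=> /weight_edge4P[? ?].
by check_weights (1 : R, a) [:: (r2 : R, b); (r2, c); (r2, d); (1, e)].
Qed.

Lemma no_path_3_3_4_3 a b c d e : B a -> B b -> B c -> B d -> B e ->
  (2 < m a b)%N -> (2 < m b c)%N -> (3 < m c d)%N -> (2 < m d e)%N ->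
  uniq [:: a; b; c; d; e] -> False.
Proof.
move=> Ba Bb Bc Bd Be /weight_edge3P[? ?] /weight_edge3P[? ?] /weight_edge4P[? ?].
move=> /weight_edge3P[? ?].
by check_weights (1 : R, a) [:: (2 : R, b); (3, c); (2 * r2, d); (r2, e)].
Qed.

End FiniteDiagrams.

(** * Diagrams of rank three and four *)

Lemma card_set_seq_le (T : eqType) (X : seq T) : [set` X] #<= `I_(size X).
Proof.
case: X => [|x X].
  by have -> : [set` [::]] = set0 :> set T; [by apply/seteqP; split|exact: card_ge0].
apply: card_le_trans (card_image_le (nth x (x :: X)) _); apply: subset_card_le.
move=> y yX; exists (index y (x :: X)); last exact: nth_index.
have : y \in x :: X := yX; by rewrite -index_mem.
Qed.

Lemma card_set_seq_ge (T : eqType) (X : seq T) : uniq X -> `I_(size X) #<= [set` X].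
Proof.
case: X => [|x X] uX; first by rewrite II0; exact: card_ge0.
have inj : {in `I_(size (x :: X)) &, injective (nth x (x :: X))}.
  by move=> i j; rewrite !inE => iX jX /eqP; rewrite nth_uniq // => /eqP.
have := inj_card_eq inj; rewrite card_eq_le => /andP[_ H]; apply: card_le_trans H _.
by apply: subset_card_le => _ [i iX <-] /=; exact: mem_nth.
Qed.

Lemma card_exists_notin (T : eqType) (A : set T) n (X : seq T) :
  `I_n #<= A -> (size X < n)%N -> exists2 v, A v & v \notin X.
Proof.
move=> nA Xn; apply: contrapT => nv.
have AX : A `<=` [set` X].
  by move=> v Av /=; apply: contrapT => /negP vX; apply: nv; exists v.
have := card_le_trans nA (card_le_trans (subset_card_le AX) (card_set_seq_le X)).
by rewrite card_le_II leqNgt Xn.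
Qed.

Lemma card_lt_sub_seq (T : eqType) (A : set T) (X : seq T) :
  uniq X -> [set` X] `<=` A -> ~ (`I_(size X).+1 #<= A) -> A = [set` X].
Proof.
move=> uX XA nA; apply/seteqP; split=> // v Av; apply: contrapT => /negP vX; apply: nA.
have uvX : uniq (v :: X) by rewrite /= vX.
apply: card_le_trans (card_set_seq_ge uvX) _; apply: subset_card_le => w /=.
by rewrite inE => /orP[/eqP->//|/XA].
Qed.

Section Classification.
Variables (W : groupType) (S : set W) (m : W -> W -> nat).
Hypothesis HS : coxeter_system S m.
Variable R : realType.
Variable B : set W.
Hypotheses (BS : B `<=` S) (finB : finite_set (generated B)) (irrB : irreducible m B).
Implicit Types (a b c d e s t p q r : W) (X : seq W).

(** As the vertices of [X] need only be a part of [B], [path_type] is used with the set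
    of these vertices. *)
Definition chain l X := path_type m [set` X] l X.

Lemma chain3P l0 l1 a b c : chain [:: l0; l1] [:: a; b; c] <->
  [/\ uniq [:: a; b; c], m a b = l0, m b c = l1 & m a c = 2%N].
Proof.
split=> [[_ uX _ mX]|[uX ab bc ac]].
  by split=> //; [exact: (mX 0%N 1%N)|exact: (mX 1%N 2%N)|exact: (mX 0%N 2%N)].
split=> // -[|[|[|i]]] [|[|[|j]]] //=.
by rewrite !ltnS ltn0 andbF.
Qed.

Lemma chain4P l0 l1 l2 a b c d : chain [:: l0; l1; l2] [:: a; b; c; d] <->
  [/\ uniq [:: a; b; c; d], [/\ m a b = l0, m b c = l1 & m c d = l2]
    & [/\ m a c = 2%N, m b d = 2%N & m a d = 2%N]].
Proof.
split=> [[_ uX _ mX]|[uX [ab bc cd] [ac bd ad]]].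
  by split=> //; split; [exact: (mX 0%N 1%N)|exact: (mX 1%N 2%N)|exact: (mX 2%N 3%N)|
                         exact: (mX 0%N 2%N)|exact: (mX 1%N 3%N)|exact: (mX 0%N 3%N)].
split=> // -[|[|[|[|i]]]] [|[|[|[|j]]]] //=.
by rewrite !ltnS ltn0 andbF.
Qed.

Variant rank4_type X : Prop :=
| rank4_A of chain [:: 3; 3; 3]%N X
| rank4_C of chain [:: 3; 3; 4]%N X
| rank4_G of chain [:: 3; 3; 5]%N X
| rank4_F of chain [:: 3; 4; 3]%N X
| rank4_B b1 b2 b3 b4 of X = [:: b1; b2; b3; b4] & star_type m [set` X] b1 b2 b3 b4.

Let lt2_label_neq s t : B s -> B t -> (2 < m s t)%N -> s != t.
Proof.
move=> Bs Bt st; apply/eqP => e; move: st.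
by rewrite (coxeter_matrix_eq1 HS (BS Bs) (BS Bt)).2.
Qed.

Lemma boundary_edge X x v : {in X, forall y, B y} -> x \in X -> B v -> v \notin X ->
  exists y z, [/\ y \in X, B z, z \notin X & (2 < m y z)%N].
Proof.
move=> XB xX Bv vX; have [p] := irrB (XB x xX) Bv.
elim: p x xX => [|z p IHp] x xX /=; first by move=> _ xv; rewrite -xv xX in vX.
move=> /andP[/and3P[_ /set_mem Bz xz] zp] lzv.
have [zX|zX] := boolP (z \in X); first exact: IHp zX zp lzv.
exists x, z; split=> //; move: xz (label_gt0 HS R BS finB (XB x xX) Bz).
by rewrite !inE; lia.
Qed.

Lemma connected_triple s t v : B s -> B t -> (2 < m s t)%N -> B v ->
  v \notin [:: s; t] -> exists p q r, [/\ [/\ B p, B q & B r], uniq [:: p; q; r],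
    (2 < m p q)%N, (2 < m q r)%N & {subset [:: s; t] <= [:: p; q; r]}].
Proof.
move=> Bs Bt st Bv vst; have nst := lt2_label_neq Bs Bt st.
have [||y [z [yst Bz zst yz]]] := @boundary_edge [:: s; t] s v _ _ Bv vst.
- by move=> x; rewrite !inE => /orP[] /eqP->.
- exact: mem_head.
move: zst yst yz; rewrite !inE negb_or => /andP[zs zt] /orP[] /eqP-> yz.
  exists t, s, z; split=> //; first by rewrite /= !inE negb_or eq_sym nst eq_sym zt eq_sym zs.
    by rewrite (labelC HS BS).
  by move=> x; rewrite !inE => /orP[] ->; rewrite ?orbT.
exists s, t, z; split=> //; first by rewrite /= !inE negb_or nst eq_sym zs eq_sym zt.
by move=> x; rewrite !inE => /orP[] ->; rewrite ?orbT.
Qed.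

Lemma triple_type p q r : B p -> B q -> B r -> uniq [:: p; q; r] ->
  (2 < m p q)%N -> (2 < m q r)%N -> exists k X, [/\ k \in [:: 3; 4; 5]%N,
    chain [:: 3%N; k] X & perm_eq X [:: p; q; r]].
Proof.
move=> Bp Bq Br u pq qr.
have npr : p != r by move: u; rewrite /= !inE !negb_or => /andP[/andP[]].
have pr : m p r = 2%N.
  by apply: (label_eq2 HS R BS finB) => // pr; exact: (no_triangle HS R BS finB Bp Bq Br).
have [pq4|pq3] := ltnP 3 (m p q); last first.
  exists (m q r), [:: p; q; r]; split=> //.
    have := no_path_3_6 HS R BS finB Bp Bq Br pq; rewrite !inE.
    by case: (ltnP 5 (m q r)) => [? /(_ isT u)//|? _]; lia.
  by apply/chain3P; split=> //; lia.
have u' : uniq [:: r; q; p] by rewrite -(rev_uniq [:: p; q; r]) in u.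
have qr3 : (m q r <= 3)%N.
  rewrite leqNgt; apply/negP => qr4; exact: (no_path_4_4 HS R BS finB Bp Bq Br pq4 qr4 u).
have [[qp rq] rp] := (labelC HS BS Bq Bp, labelC HS BS Br Bq, labelC HS BS Br Bp).
exists (m q p), [:: r; q; p]; split=> //.
- have := no_path_3_6 HS R BS finB Br Bq Bp; rewrite !inE rq qr => /(_ isT).
  by case: (ltnP 5 (m q p)) => [? /(_ isT u')//|? _]; lia.
- by apply/chain3P; split=> //; [lia|rewrite rp].
by rewrite -[X in perm_eq X](revK [:: r; q; p]) perm_rev.
Qed.

Lemma path4_type p q r s : B p -> B q -> B r -> B s -> uniq [:: p; q; r; s] ->
  (2 < m p q)%N -> (2 < m q r)%N -> (2 < m r s)%N ->
  exists2 X, rank4_type X & perm_eq X [:: p; q; r; s].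
Proof.
move=> Bp Bq Br Bs u pq qr rs.
have sub X : subseq X [:: p; q; r; s] -> uniq X by move=> /subseq_uniq; exact.
have u1 : uniq [:: p; q; r] by apply: sub; rewrite /= !eqxx.
have u2 : uniq [:: q; r; s] by move: u => /andP[].
have [npr nps nqs] : [/\ p != r, p != s & q != s].
  by move: u; rewrite /= !inE !negb_or => /and4P[/and3P[]] ? ? ? /andP[].
have pr : m p r = 2%N.
  by apply: (label_eq2 HS R BS finB) => // pr; exact: (no_triangle HS R BS finB Bp Bq Br).
have qs : m q s = 2%N.
  by apply: (label_eq2 HS R BS finB) => // qs; exact: (no_triangle HS R BS finB Bq Br Bs).
have ps : m p s = 2%N.
  apply: (label_eq2 HS R BS finB) => // ps.
  exact: (no_square HS R BS finB Bp Bq Br Bs pq qr rs ps).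
have [[qp rq] sr] := (labelC HS BS Bq Bp, labelC HS BS Br Bq, labelC HS BS Bs Br).
have [[rp sq] sp] := (labelC HS BS Br Bp, labelC HS BS Bs Bq, labelC HS BS Bs Bp).
have ur : uniq [:: s; r; q; p] by rewrite -(rev_uniq [:: p; q; r; s]) in u.
have ur1 : uniq [:: r; q; p] by move: ur => /andP[].
have no36 := no_path_3_6 HS R BS finB.
have no44 := no_path_4_4 HS R BS finB.
have [qr4|qr3] := ltnP 3 (m q r).
  have pq3 : m p q = 3%N.
    by apply/eqP; rewrite eqn_leq pq andbT leqNgt; apply/negP => pq4; exact: (no44 _ _ _ Bp Bq Br pq4 qr4 u1).
  have rs3 : m r s = 3%N.
    apply/eqP; rewrite eqn_leq rs andbT leqNgt; apply/negP => rs4.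
    exact: (no44 _ _ _ Bq Br Bs).
  have qr4' : m q r = 4%N.
    apply/eqP; rewrite eqn_leq qr4 andbT leqNgt; apply/negP => qr5.
    exact: (no_path_3_5_3 HS R BS finB Bp Bq Br Bs pq qr5 rs).
  by exists [:: p; q; r; s] => //; apply: rank4_F; apply/chain4P.
have {qr3} qr3 : m q r = 3%N by lia.
have [pq4|pq3] := ltnP 3 (m p q).
  have rs3 : m r s = 3%N.
    apply/eqP; rewrite eqn_leq rs andbT leqNgt; apply/negP => rs4.
    exact: (no_path_4_3_4 HS R BS finB Bp Bq Br Bs pq4 qr rs4).
  exists [:: s; r; q; p]; last first.
    by rewrite -[X in perm_eq X](revK [:: s; r; q; p]) perm_rev.
  have pq5 : (m p q <= 5)%N.
    rewrite leqNgt; apply/negP => pq6; apply: (no36 _ _ _ Br Bq Bp) => //; lia.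
  have [pq'|pq'] : m p q = 4%N \/ m p q = 5%N by lia.
    by apply: rank4_C; apply/chain4P; split=> //; split; lia.
  by apply: rank4_G; apply/chain4P; split=> //; split; lia.
have {pq3} pq3 : m p q = 3%N by lia.
exists [:: p; q; r; s] => //.
have rs5 : (m r s <= 5)%N.
  by rewrite leqNgt; apply/negP => rs6; exact: (no36 _ _ _ Bq Br Bs).
have [rs'|[rs'|rs']] : m r s = 3%N \/ (m r s = 4%N \/ m r s = 5%N) by lia.
- by apply: rank4_A; apply/chain4P.
- by apply: rank4_C; apply/chain4P.
- by apply: rank4_G; apply/chain4P.
Qed.

Lemma star4_type c a b d : B c -> B a -> B b -> B d -> uniq [:: c; a; b; d] ->
  (2 < m c a)%N -> (2 < m c b)%N -> (2 < m c d)%N ->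
  star_type m [set` [:: a; b; d; c]] a b d c.
Proof.
move=> Bc Ba Bb Bd u ca cb cd.
have no := no_star_3_3_4 HS R BS finB.
have u' : uniq [:: a; b; d; c] by rewrite -(rot_uniq 1) in u.
have ub : uniq [:: c; a; d; b].
  by move: u; rewrite /= !inE !negb_or (eq_sym d b) => /and4P[/and3P[-> -> ->] /andP[-> ->] -> _].
have ua : uniq [:: c; b; d; a].
  move: u; rewrite /= !inE !negb_or (eq_sym d a) (eq_sym b a).
  by move=> /and4P[/and3P[-> -> ->] /andP[-> ->] -> _].
have tri x y : B x -> B y -> (2 < m c x)%N -> (2 < m c y)%N ->
    uniq [:: c; x; y] -> m x y = 2%N.
  move=> Bx By cx cy uxy; apply: (label_eq2 HS R BS finB) => //.
    by move: uxy; rewrite /= !inE => /andP[_ /andP[]].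
  move=> xy; exact: (no_triangle HS R BS finB Bc Bx By cx xy cy uxy).
have sub X Y : uniq Y -> subseq X Y -> uniq X by move=> uY /subseq_uniq; exact.
split=> //; split.
- rewrite (labelC HS BS Ba Bc); apply/eqP; rewrite eqn_leq ca andbT leqNgt.
  by apply/negP => ca4; exact: (no _ _ _ _ Bc Bb Bd Ba cb cd ca4 ua).
- rewrite (labelC HS BS Bb Bc); apply/eqP; rewrite eqn_leq cb andbT leqNgt.
  by apply/negP => cb4; exact: (no _ _ _ _ Bc Ba Bd Bb ca cd cb4 ub).
- rewrite (labelC HS BS Bd Bc); apply/eqP; rewrite eqn_leq cd andbT leqNgt.
  by apply/negP => cd4; exact: (no _ _ _ _ Bc Ba Bb Bd ca cb cd4 u).
- by apply: tri => //; apply: (sub _ _ u); rewrite /= !eqxx.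
- by apply: tri => //; apply: (sub _ _ ub); rewrite /= !eqxx.
- by apply: tri => //; apply: (sub _ _ ua); rewrite /= !eqxx.
Qed.

Lemma connected_quadruple s t : `I_4 #<= B -> B s -> B t -> (2 < m s t)%N ->
  exists X, [/\ rank4_type X, {in X, forall x, B x} & {subset [:: s; t] <= X}].
Proof.
move=> B4 Bs Bt st.
have [v Bv vst] := card_exists_notin B4 (isT : size [:: s; t] < 4)%N.
have [p [q [r [[Bp Bq Br] u pq qr sub]]]] := connected_triple Bs Bt st Bv vst.
have [w Bw wX] := card_exists_notin B4 (isT : size [:: p; q; r] < 4)%N.
have XB : {in [:: p; q; r], forall x, B x}.
  by move=> x; rewrite !inE => /or3P[] /eqP->.
have [y [z [yX Bz zX yz]]] := boundary_edge XB (mem_head _ _) Bw wX.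
have zB : {in z :: [:: p; q; r], forall x, B x}.
  by move=> x; rewrite inE => /orP[/eqP->//|/XB].
have uz : uniq (z :: [:: p; q; r]) by rewrite /= zX.
have fin X : rank4_type X -> perm_eq X (z :: [:: p; q; r]) -> exists X,
    [/\ rank4_type X, {in X, forall x, B x} & {subset [:: s; t] <= X}].
  move=> tX /perm_mem pX; exists X; split=> // x; rewrite pX; first exact: zB.
  by move=> /sub xX; rewrite inE xX orbT.
move: yX; rewrite !inE => /or3P[] /eqP yE; rewrite {y}yE in yz.
- have [|X tX pX] := path4_type Bz Bp Bq Br uz _ pq qr; first by rewrite (labelC HS BS).
  exact: fin tX pX.
- have perm1 : perm_eq [:: p; r; z; q] (z :: [:: p; q; r]).
    by apply/permP => P /=; lia.
  have uq : uniq [:: q; p; r; z].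
    by rewrite -(rot_uniq 1) (perm_uniq (perm1 : perm_eq (rot 1 [:: q; p; r; z]) _)).
  apply: fin perm1; apply: (rank4_B (b1 := p) (b2 := r) (b3 := z) (b4 := q)) => //.
  by apply: star4_type => //; rewrite (labelC HS BS Bq Bp).
- have perm1 : perm_eq [:: p; q; r; z] (z :: [:: p; q; r]) by apply/permP => P /=; lia.
  have [|X tX pX] := path4_type Bp Bq Br Bz _ pq qr yz.
    by rewrite (perm_uniq perm1).
  by apply: (fin X tX); exact: perm_trans pX perm1.
Qed.

End Classification.

Section Relations.
Variable G : groupType.
Implicit Types x y : G.

Lemma commute_expg2 x y : x * x = 1 -> y * y = 1 -> (x * y) ^+ 2 = 1 <-> commute x y.
Proof.
move=> xx yy; rewrite expg2; split=> [/mulg1_eq|xy].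
  by rewrite invgM (mulg1_eq xx) (mulg1_eq yy) => /esym.
by rewrite {1}xy mulgA -(mulgA y) xx mulg1 yy.
Qed.

Lemma commute_odd_eq x y k : x * x = 1 -> y * y = 1 -> commute x y -> odd k ->
  (x * y) ^+ k = 1 -> x = y.
Proof.
move=> xx yy /(commute_expg2 xx yy)/elt_order_dvd o2 ko /elt_order_dvd ok.
have : elt_order (x * y) = 1%N.
  apply/eqP; rewrite -dvdn1; have /eqP <- : coprime 2 k by rewrite coprime2n.
  by rewrite dvdn_gcd o2 ok.
by move/elt_order_eq1/mulg1_eq <-; rewrite (mulg1_eq xx).
Qed.

End Relations.

(** * The kernel of a base as a second derived subgroup *)

Section BaseKernel.
Variables (W Q : groupType) (S : set W) (m : W -> W -> nat).
Hypothesis HS : coxeter_system S m.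
Variable f : {multiplicative W -> Q}.
Variable B : set W.
Hypotheses (BS : B `<=` S) (finB : finite_set (generated B)) (irrB : irreducible m B).
Implicit Types (a b c d e s t p q r z : W) (X : seq W).
Variable R : realType.

Let inv s : B s -> f s * f s = 1.
Proof. by move=> Bs; rewrite -gmulfM (coxeter_invol HS (BS Bs)) gmorph1. Qed.

Let rel s t k : B s -> B t -> m s t = k -> (f s * f t) ^+ k = 1.
Proof.
by move=> Bs Bt <-; rewrite -gmulfM -gmorphX (coxeter_expg HS (BS Bs) (BS Bt)) gmorph1.
Qed.

Let com s t : B s -> B t -> m s t = 2%N -> commute (f s) (f t).
Proof.
by move=> Bs Bt st; apply/(commute_expg2 (inv Bs) (inv Bt)); exact: rel.
Qed.

Ltac solve_uniq :=
  rewrite /= ?inE ?negb_or;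
  repeat match goal with |- is_true (_ && _) => apply/andP; split end;
  by [done | rewrite eq_sym].

Section Collapse.
Hypothesis metB : metabelian (f @` generated B).

Let memB s : B s -> (f @` generated B) (f s).
Proof. by move=> Bs; exists s => //; exact: sub_generated. Qed.

Lemma collapse_odd a b c : B a -> B b -> B c -> odd (m a b) -> odd (m b c) ->
  m a c = 2%N -> f a = f c.
Proof.
move=> Ba Bb Bc ab bc ac.
exact: (odd_path_collapse metB (memB Ba) (memB Bb) (memB Bc) (inv Ba) (inv Bb)
  (inv Bc) ab bc (rel Ba Bb erefl) (rel Bb Bc erefl) (com Ba Bc ac)).
Qed.

Lemma collapse_C3 a b c : B a -> B b -> B c -> m a b = 3%N -> m b c = 4%N ->
  m a c = 2%N -> (f b * f c) ^+ 2 = 1.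
Proof.
move=> Ba Bb Bc ab bc ac.
exact: (four_path_collapse metB (memB Ba) (memB Bb) (memB Bc) (inv Ba) (inv Bb)
  (inv Bc) (rel Ba Bb ab) (rel Bb Bc bc) (com Ba Bc ac)).
Qed.

Lemma collapse_A4 a b c d : B a -> B b -> B c -> B d ->
  chain m [:: 3; 3; 3]%N [:: a; b; c; d] -> [/\ f b = f a, f c = f a & f d = f a].
Proof.
move=> Ba Bb Bc Bd /chain4P[_ [ab bc cd] [ac bd ad]].
have fac : f a = f c by apply: (collapse_odd Ba Bb Bc); rewrite ?ab ?bc.
have fbd : f b = f d by apply: (collapse_odd Bb Bc Bd); rewrite ?bc ?cd.
have fab : f a = f b.
  apply: (commute_odd_eq (inv Ba) (inv Bb) _ (isT : odd 3) (rel Ba Bb ab)).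
  by rewrite fbd; exact: com.
by rewrite -fbd -fac fab.
Qed.

Lemma collapse_G3 a b c : B a -> B b -> B c ->
  chain m [:: 3; 5]%N [:: a; b; c] -> f b = f a /\ f c = f a.
Proof.
move=> Ba Bb Bc /chain3P[_ ab bc ac].
have fac : f a = f c by apply: (collapse_odd Ba Bb Bc); rewrite ?ab ?bc.
suff : f a * f b = 1 by rewrite -fac => /mulg1_eq <-; rewrite (mulg1_eq (inv Ba)).
have /elt_order_dvd o3 := rel Ba Bb ab.
have /elt_order_dvd o5 := rel Bb Bc bc.
apply/elt_order_eq1/eqP; rewrite -dvdn1 -[1%N]/(gcdn 3 5) dvdn_gcd o3 /=.
by rewrite -elt_orderV invgM (mulg1_eq (inv Ba)) (mulg1_eq (inv Bb)) fac.
Qed.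

Lemma collapse_G4 a b c d : B a -> B b -> B c -> B d ->
  chain m [:: 3; 3; 5]%N [:: a; b; c; d] -> [/\ f b = f a, f c = f a & f d = f a].
Proof.
move=> Ba Bb Bc Bd /chain4P[u [ab bc cd] [ac bd ad]].
have [|fcb fdb] := @collapse_G3 b c d Bb Bc Bd.
  by apply/chain3P; split=> //; move: u => /andP[].
have fac : f a = f c by apply: (collapse_odd Ba Bb Bc); rewrite ?ab ?bc.
by rewrite fdb -fcb -fac.
Qed.

(** Prolonging an [A3] at its first vertex by an edge labelled 3 produces an [A4]. *)
Lemma collapse_extended a b c z : B a -> B b -> B c -> B z ->
  uniq [:: z; a; b; c] -> m a b = 3%N -> m b c = 3%N -> m a c = 2%N ->
  m z a = 3%N -> f b = f a.
Proof.
move=> Ba Bb Bc Bz u ab bc ac za.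
have [nzb nzc] : z != b /\ z != c.
  by move: u; rewrite /= !inE !negb_or => /andP[/and3P[_ -> ->]].
have zb : m z b = 2%N.
  apply: (label_eq2 HS R BS finB) => // zb.
  apply: (no_triangle HS R BS finB Bz Ba Bb) => //; rewrite ?za ?ab //.
  by apply: (subseq_uniq _ u); rewrite /= !eqxx.
have zc : m z c = 2%N.
  apply: (label_eq2 HS R BS finB) => // zc.
  by apply: (no_square HS R BS finB Bz Ba Bb Bc) => //; rewrite ?za ?ab ?bc.
have /collapse_A4 : chain m [:: 3; 3; 3]%N [:: z; a; b; c] by apply/chain4P.
by case/(_ Bz Ba Bb Bc) => -> -> _.
Qed.

(** An edge lies in a connected subdiagram of rank 4, which some fifth vertex extends.
    In types [A4] and [G4] the edge collapses. In the others the extension either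
    contains an [A4] through which the edges labelled 3 collapse, or contains one of
    the excluded diagrams. *)
Lemma rank5_commute s t : `I_5 #<= B -> B s -> B t -> commute (f s) (f t).
Proof.
move=> B5 Bs Bt; have [->|nst] := eqVneq s t; first exact: commute_refl.
have [st|nadj] := ltnP 2 (m s t); last first.
  by apply: com => //; apply: (label_eq2 HS R BS finB) => //; rewrite ltnNge nadj.
have B4 : `I_4 #<= B by apply: card_le_trans B5; rewrite card_le_II.
have [X [tX XB sX]] := connected_quadruple HS R BS finB irrB B4 Bs Bt st.
have sXs : s \in X by apply: sX; rewrite mem_head.
have sXt : t \in X by apply: sX; rewrite !inE eqxx orbT.
have [X4 uX] : size X = 4%N /\ uniq X.
  by case: (tX) => [[]|[]|[]|[]|? ? ? ? -> []].
have [y [z [yX Bz zX yz]]] : exists y z, [/\ y \in X, B z, z \notin X & (2 < m y z)%N].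
  have [|v Bv vX] := card_exists_notin (X := X) B5; first by rewrite X4.
  exact: (boundary_edge HS R BS finB irrB XB sXs Bv vX).
case: X {sX} X4 uX tX XB sXs sXt yX zX => [|a [|b [|c [|d []]]]] // _ uX tX XB sXs sXt.
have [Ba Bb Bc Bd] : [/\ B a, B b, B c & B d].
  by split; apply: XB; rewrite !inE eqxx ?orbT.
have eqc : [/\ f b = f a, f c = f a & commute (f d) (f a)] -> commute (f s) (f t).
  move=> [fb fc da]; have ad := commute_sym da.
  move: sXs sXt; rewrite !inE.
  by move=> /or4P[] /eqP-> /or4P[] /eqP->; rewrite ?fb ?fc //; exact: commute_refl.
have eqc' : [/\ f b = f a, f c = f a & f d = f a] -> commute (f s) (f t).
  by move=> [fb fc fd]; apply: eqc; split=> //; rewrite fd; exact: commute_refl.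
rewrite !inE => yX; rewrite !negb_or => /and4P[za zb zc zd].
have [nab nac nad] : [/\ a != b, a != c & a != d].
  by move: uX; rewrite /= !inE !negb_or => /andP[/and3P[]].
have [nbc nbd ncd] : [/\ b != c, b != d & c != d].
  by move: uX; rewrite /= !inE !negb_or => /and4P[_ /andP[]].
have lC x1 x2 := @labelC _ _ _ HS _ BS x1 x2.
case: tX => [cX|cX|cX|cX|b1 b2 b3 b4 XE].
- by apply: eqc'; exact: collapse_A4 cX.
- have /chain4P[_ [ab bc cd] [ac bd ad]] := cX.
  have fac : f a = f c by apply: (collapse_odd Ba Bb Bc); rewrite ?ab ?bc.
  suff fb : f b = f a by apply: eqc; split=> //; exact/commute_sym/com.
  move: yX => /or4P[] /eqP yE; rewrite {y}yE in yz.
  + have za2 : (2 < m z a)%N by rewrite lC.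
    have [za4|za3] := ltnP 3 (m z a).
      exfalso; apply: (no_path_4_3_3_4 HS R BS finB Bz Ba Bb Bc Bd);
        by rewrite ?ab ?bc ?cd //; solve_uniq.
    have za3' : m z a = 3%N by apply/eqP; rewrite eqn_leq za3.
    by apply: (collapse_extended Ba Bb Bc Bz) => //; solve_uniq.
  + exfalso; apply: (no_fork_4 HS R BS finB Bb Ba Bz Bc Bd);
      by rewrite ?(lC b a) ?ab ?bc ?cd //; solve_uniq.
  + exfalso; apply: (no_star_3_3_4 HS R BS finB Bc Bb Bz Bd);
      by rewrite ?(lC c b) ?bc ?cd //; solve_uniq.
  + exfalso; apply: (no_path_3_3_4_3 HS R BS finB Ba Bb Bc Bd Bz);
      by rewrite ?ab ?bc ?cd //; solve_uniq.
- by apply: eqc'; exact: collapse_G4 cX.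
- have /chain4P[_ [ab bc cd] _] := cX; exfalso.
  move: yX => /or4P[] /eqP yE; rewrite {y}yE in yz.
  + apply: (no_path_3_3_4_3 HS R BS finB Bz Ba Bb Bc Bd);
      by rewrite ?(lC z a) ?ab ?bc ?cd //; solve_uniq.
  + apply: (no_star_3_3_4 HS R BS finB Bb Ba Bz Bc);
      by rewrite ?(lC b a) ?ab ?bc //; solve_uniq.
  + apply: (no_star_3_3_4 HS R BS finB Bc Bd Bz Bb);
      by rewrite ?(lC c b) ?bc ?cd //; solve_uniq.
  + apply: (no_path_3_3_4_3 HS R BS finB Bz Bd Bc Bb Ba);
      by rewrite ?(lC z d) ?(lC d c) ?(lC c b) ?(lC b a) ?ab ?bc ?cd //; solve_uniq.
case: XE => <- <- <- <- [_ _ [ad bd cd] [ab ac bc]] {b1 b2 b3 b4}.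
have fab : f a = f b.
  by apply: (collapse_odd Ba Bd Bb); rewrite ?(lC d b) ?ad ?bd.
have fac : f a = f c.
  by apply: (collapse_odd Ba Bd Bc); rewrite ?(lC d c) ?ad ?cd.
suff fd : f d = f a by apply: eqc'.
have leaf p q r : B p -> B q -> B r -> uniq [:: d; q; r; p; z] ->
    m p d = 3%N -> m q d = 3%N -> m r d = 3%N -> m p q = 2%N -> (2 < m p z)%N ->
    f d = f p.
  move=> Bp Bq Br u pd qd rd pq pz; have zp2 : (2 < m z p)%N by rewrite lC.
  have [pz4|pz3] := ltnP 3 (m p z).
    exfalso; apply: (no_fork_4 HS R BS finB Bd Bq Br Bp Bz) => //;
      by rewrite ?(lC d q) ?(lC d r) ?(lC d p) ?pd ?qd ?rd.
  apply: (collapse_extended Bp Bd Bq Bz) => //.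
  - move: u; rewrite /= !inE !negb_or.
    move=> /and5P[/and4P[? ? ? ?] /and3P[? ? ?] /andP[? ?] ? _]; solve_uniq.
  - by rewrite lC.
  - by apply/eqP; rewrite eqn_leq zp2 andbT lC.
move: yX => /or4P[] /eqP yE; rewrite {y}yE in yz.
- by apply: (leaf a b c) => //; solve_uniq.
- by rewrite fab; apply: (leaf b a c) => //; [solve_uniq|rewrite lC].
- by rewrite fac; apply: (leaf c a b) => //; [solve_uniq|rewrite lC].
- exfalso; apply: (no_star_4_leaves HS R BS finB Bd Ba Bb Bc Bz) => //;
    rewrite ?(lC d a) ?(lC d b) ?(lC d c) ?ad ?bd ?cd //; solve_uniq.
Qed.

(** In the commutator types the images of the generators commute: from rank 5 on by
    [rank5_commute], and otherwise because they are all equal. In the other types each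
    relator lies in an [A3] or a [C3]. *)
Lemma base_kernel_collapse x : base_kernel m B x -> f x = 1.
Proof.
rewrite /base_kernel; case: asboolP => [cB|_].
  suff comm s t : B s -> B t -> commute (f s) (f t).
    apply: (commutator_subgroup_min (K := f @^-1` [set 1])) => [|u v gu gv] /=.
      by case: (preim_normal f (is_normal1 Q)).
    have cg := @commute_generated2 _ (f @` B) (f @` B).
    have {}cg : commute (f u) (f v).
      apply: cg => [_ _ [s Bs <-] [t Bt <-]||]; first exact: comm.
        by rewrite -image_generated; exists u.
      by rewrite -image_generated; exists v.
    by rewrite gmorphR; exact/eqP/commgP.
  move=> Bs Bt.
  have eqs a (X : seq W) : (forall y, y \in X -> f y = f a) -> B = [set` X] ->
      commute (f s) (f t).
    move=> E BX; rewrite BX in Bs Bt; rewrite (E s) // (E t) //; exact: commute_refl.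
  case: cB => [B5|[X cX]|[X cX]|[X cX]]; first exact: rank5_commute.
  - have [BX _ X4 _] := cX; have {}cX : chain m [:: 3; 3; 3]%N X by rewrite /chain -BX.
    case: X X4 cX BX => [|a [|b [|c [|d []]]]] // _ cX BX.
    have [Ba Bb Bc Bd] : [/\ B a, B b, B c & B d].
      by rewrite BX /= !inE !eqxx !orbT.
    have [fb fc fd] := collapse_A4 Ba Bb Bc Bd cX.
    by apply: (eqs a _ _ BX) => y; rewrite !inE => /or4P[] /eqP->.
  - have [BX _ X4 _] := cX; have {}cX : chain m [:: 3; 5]%N X by rewrite /chain -BX.
    case: X X4 cX BX => [|a [|b [|c []]]] // _ cX BX.
    have [Ba Bb Bc] : [/\ B a, B b & B c] by rewrite BX /= !inE !eqxx !orbT.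
    have [fb fc] := collapse_G3 Ba Bb Bc cX.
    by apply: (eqs a _ _ BX) => y; rewrite !inE => /or3P[] /eqP->.
  - have [BX _ X4 _] := cX; have {}cX : chain m [:: 3; 3; 5]%N X by rewrite /chain -BX.
    case: X X4 cX BX => [|a [|b [|c [|d []]]]] // _ cX BX.
    have [Ba Bb Bc Bd] : [/\ B a, B b, B c & B d].
      by rewrite BX /= !inE !eqxx !orbT.
    have [fb fc fd] := collapse_G4 Ba Bb Bc Bd cX.
    by apply: (eqs a _ _ BX) => y; rewrite !inE => /or4P[] /eqP->.
have sgB := generated_subgroup B.
pose K := [set x | generated B x /\ f x = 1].
suff sK : normal_closure (generated B) (base_relator m B) `<=` K by move=> /sK[].
apply: normal_closure_min.
  split=> [|y []//|y h [By y1] Bh].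
    split=> [|y z [By y1] [Bz z1]|y [By y1]].
    - by split; [exact: subgroup1|exact: gmorph1].
    - by split; [exact: (subgroupM sgB)|rewrite gmulfM y1 z1 mulg1].
    - by split; [exact: (subgroupV sgB)|rewrite gmorphV y1 invg1].
  split; last by rewrite /conjg !gmulfM gmorphV y1 mul1g mulVg.
  by rewrite /conjg; do 2?apply: (subgroupM sgB) => //; exact: (subgroupV sgB).
have gB y : B y -> generated B y by exact: sub_generated.
have fVM y z : B y -> f y = f z -> f (y * z) = 1.
  by move=> By yz; rewrite gmulfM -yz inv.
move=> _ [a b c cX|b1 b2 b3 b4 cX|b1 b2 b3 b4 cX|a b c cX|a b c d cX|a b c d cX].
- have [BX _ _ _] := cX; have {}cX : chain m [:: 3; 3]%N [:: a; b; c] by rewrite /chain -BX.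
  have [Ba Bb Bc] : [/\ B a, B b & B c] by rewrite BX /= !inE !eqxx !orbT.
  have /chain3P[_ ab bc ac] := cX.
  split; first by apply: (subgroupM sgB); exact: gB.
  by apply: fVM => //; apply: (collapse_odd Ba Bb Bc); rewrite ?ab ?bc.
- have [BX _ [b14 b24 _] [b12 _ _]] := cX.
  have [B1 B2 B4] : [/\ B b1, B b2 & B b4] by rewrite BX /= !inE !eqxx !orbT.
  split; first by apply: (subgroupM sgB); exact: gB.
  apply: fVM => //; apply: (collapse_odd B1 B4 B2); by rewrite ?(labelC HS BS B4 B2) ?b14 ?b24.
- have [BX _ [_ b24 b34] [_ _ b23]] := cX.
  have [B2 B3 B4] : [/\ B b2, B b3 & B b4] by rewrite BX /= !inE !eqxx !orbT.
  split; first by apply: (subgroupM sgB); exact: gB.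
  apply: fVM => //; apply: (collapse_odd B2 B4 B3); by rewrite ?(labelC HS BS B4 B3) ?b24 ?b34.
- have [BX _ _ _] := cX; have {}cX : chain m [:: 3; 4]%N [:: a; b; c] by rewrite /chain -BX.
  have [Ba Bb Bc] : [/\ B a, B b & B c] by rewrite BX /= !inE !eqxx !orbT.
  have /chain3P[_ ab bc ac] := cX.
  split; first by apply: (subgroupX _ sgB); apply: (subgroupM sgB); exact: gB.
  by rewrite gmorphX gmulfM; exact: (collapse_C3 Ba Bb Bc).
- have [BX _ _ _] := cX; have {}cX : chain m [:: 3; 3; 4]%N [:: a; b; c; d] by rewrite /chain -BX.
  have [Ba Bb Bc] : [/\ B a, B b & B c] by rewrite BX /= !inE !eqxx !orbT.
  have /chain4P[_ [ab bc _] [ac _ _]] := cX.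
  split; first by apply: (subgroupM sgB); exact: gB.
  by apply: fVM => //; apply: (collapse_odd Ba Bb Bc); rewrite ?ab ?bc.
- have [BX _ _ _] := cX; have {}cX : chain m [:: 3; 4; 3]%N [:: a; b; c; d] by rewrite /chain -BX.
  have [Ba Bb Bc] : [/\ B a, B b & B c] by rewrite BX /= !inE !eqxx !orbT.
  have /chain4P[_ [ab bc _] [ac _ _]] := cX.
  split; first by apply: (subgroupX _ sgB); apply: (subgroupM sgB); exact: gB.
  by rewrite gmorphX gmulfM; exact: (collapse_C3 Ba Bb Bc).
Qed.

End Collapse.
Lemma metabelian_sub2 (A : set W) x y : A `<=` S ->
  A `<=` [set x; y] -> metabelian (generated (f @` A)).
Proof.
have finv s : S s -> f s * f s = 1.
  by move=> Ss; rewrite -gmulfM (coxeter_invol HS Ss) gmorph1.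
move=> AS Axy; have fA (u v : Q) : u * u = 1 -> v * v = 1 -> f @` A `<=` [set u; v] ->
    metabelian (generated (f @` A)).
  by move=> uu vv sA; exact: metabelianS (generatedS sA) (metabelian_dihedral uu vv).
have [Ax|nAx] := pselect (A x); have [Ay|nAy] := pselect (A y).
- apply: (fA (f x) (f y)); [exact: finv (AS _ _)|exact: finv (AS _ _)|].
  by move=> _ [z /Axy[->|->] <-]; [left|right].
- apply: (fA (f x) (f x)); [exact: finv (AS _ _)|exact: finv (AS _ _)|].
  by move=> _ [z Az <-]; have [zx|zy] := Axy _ Az; [left; rewrite zx|rewrite zy in Az].
- apply: (fA (f y) (f y)); [exact: finv (AS _ _)|exact: finv (AS _ _)|].
  by move=> _ [z Az <-]; have [zx|zy] := Axy _ Az; [rewrite zx in Az|left; rewrite zy].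
- apply: (fA 1 1); rewrite ?mulg1 // => u [z Az uz]; exfalso.
  by have [zx|zy] := Axy _ Az; [rewrite zx in Az|rewrite zy in Az].
Qed.

Lemma metabelian_rank2 (A : set W) : A `<=` S -> ~ (`I_3 #<= A) ->
  metabelian (generated (f @` A)).
Proof.
move=> AS A3; have [[a Aa]|nA] := pselect (exists a, A a); last first.
  by apply: (metabelian_sub2 (x := 1) (y := 1) AS) => a Aa; case: nA; exists a.
have [[b [Ab ab]]|nb] := pselect (exists b, A b /\ a != b); last first.
  apply: (metabelian_sub2 (x := a) (y := a) AS) => b Ab; left; apply: contrapT => ba.
  by apply: nb; exists b; split=> //; apply/eqP => /esym.
have AE : A = [set` [:: a; b]].
  apply: card_lt_sub_seq => //; first by rewrite /= inE ab.
  by move=> x /=; rewrite !inE => /orP[] /eqP->.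
apply: (metabelian_sub2 (x := a) (y := b) AS) => x; rewrite AE /= !inE.
by move=> /orP[] /eqP->; [left|right].
Qed.

(** By the classification in ranks 3 and 4, a base outside the commutator types has
    one of the types [A3], [C3], [C4], [F4] and [B4], and its relators make the image a
    product of at most two commuting groups generated by two involutions. *)
Lemma base_kernel_metabelian : `I_3 #<= B ->
  (forall x, base_kernel m B x -> f x = 1) -> metabelian (generated (f @` B)).
Proof.
move=> B3 fB.
have [cB|nB] := pselect (commutator_type m B).
  apply: metabelian_abelian; apply: commute_generated2 => _ _ [s Bs <-] [t Bt <-].
  apply/commgP/eqP; rewrite -gmorphR; apply: fB.
  rewrite /base_kernel; case: asboolP => // _.
  by apply: mem_commutator; exact: sub_generated.
have fR x : base_relator m B x -> f x = 1.
  move=> Bx; apply: fB; rewrite /base_kernel; case: asboolP => // _.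
  exact: sub_normal_closure.
have feq x y : B y -> f (x * y) = 1 -> f x = f y.
  by move=> By; rewrite gmulfM => /(canRL (mulgK _)); rewrite mul1g (mulg1_eq (inv By)).
have dih x y : B x -> B y -> metabelian (generated [set f x; f y]).
  by move=> Bx By; apply: metabelian_dihedral; exact: inv.
have fcom x y : B x -> B y -> f ((x * y) ^+ 2) = 1 -> commute (f x) (f y).
  move=> Bx By; rewrite gmorphX gmulfM.
  by move/(commute_expg2 (inv Bx) (inv By)).
have sub D : f @` B `<=` D -> metabelian (generated D) -> metabelian (generated (f @` B)).
  by move=> sD; apply: metabelianS; exact: generatedS.
have [s Bs _] := card_exists_notin B3 (isT : (size ([::] : seq W) < 3)%N).
have [v Bv vs] := card_exists_notin B3 (isT : (size [:: s] < 3)%N).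
have [|s' [t [s's Bt ts st]]] := boundary_edge HS R BS finB irrB _ (mem_head s [::]) Bv vs.
  by move=> x; rewrite inE => /eqP->.
move: s's st; rewrite inE => /eqP-> st.
have [B4|nB4] := pselect (`I_4 #<= B); last first.
  have [w Bw wst] := card_exists_notin B3 (isT : (size [:: s; t] < 3)%N).
  have [p [q [r [[Bp Bq Br] u pq qr _]]]] := connected_triple HS R BS finB irrB Bs Bt st Bw wst.
  have [k [X [k345 cX pX]]] := triple_type HS R BS finB Bp Bq Br u pq qr.
  have [_ uX X3 _] := cX.
  have BX : B = [set` X].
    apply: card_lt_sub_seq => //; last by rewrite X3.
    by move=> x /=; rewrite (perm_mem pX) !inE => /or3P[] /eqP->.
  have cXB : path_type m B [:: 3; k]%N X by rewrite BX.
  case: X {pX uX} X3 BX cX cXB => [|a [|b [|c []]]] // _ BX /chain3P[_ ab bc ac] cXB.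
  have [Ba Bb Bc] : [/\ B a, B b & B c] by rewrite BX /= !inE !eqxx !orbT.
  move: k345; rewrite !inE => /or3P[] /eqP kE; rewrite {k}kE in bc cXB.
  - have fac : f a = f c by apply: feq => //; apply: fR; exact: relator_A3 cXB.
    apply: sub (dih a b Ba Bb) => _ [x Bx <-]; move: Bx; rewrite BX /= !inE.
    by move=> /or3P[] /eqP->; [left|right|left].
  - have fbc : commute (f b) (f c) by apply: fcom => //; apply: fR; exact: relator_C3 cXB.
    apply: (sub ([set f a; f b] `|` [set f c; f c])).
      move=> _ [x Bx <-]; move: Bx; rewrite BX /= !inE.
      by move=> /or3P[] /eqP->; [left; left|left; right|right; left].
    apply: metabelianU; [|exact: dih|exact: dih].
    by move=> x y [->|->] [->|->] //; exact: com.
  - by case: nB; apply: Or43; exists [:: a; b; c].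
have [X [tX XB _]] := connected_quadruple HS R BS finB irrB B4 Bs Bt st.
have [X4 uX] : size X = 4%N /\ uniq X.
  by case: (tX) => [[]|[]|[]|[]|? ? ? ? -> []].
have BX : B = [set` X].
  apply: card_lt_sub_seq => //; rewrite X4 => B5; apply: nB; exact: Or41.
have BXi (x : W) : x \in X -> B x by rewrite BX.
case: X X4 {uX XB} tX BX BXi => [|a [|b [|c [|d []]]]] // _ tX BX BXi.
have [Ba Bb Bc Bd] : [/\ B a, B b, B c & B d] by rewrite BX /= !inE !eqxx !orbT.
have BP (D : set Q) : D (f a) -> D (f b) -> D (f c) -> D (f d) -> f @` B `<=` D.
  move=> Da Db Dc Dd _ [x Bx <-]; move: Bx; rewrite BX /= !inE.
  by move=> /or4P[] /eqP->.
case: tX => [cX|cX|cX|cX|b1 b2 b3 b4 XE sX].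
- by case: nB; apply: Or42; exists [:: a; b; c; d]; rewrite BX.
- have /chain4P[_ _ [ac bd ad]] := cX.
  have fac : f a = f c.
    by apply: feq => //; apply: fR; apply: (@relator_C4 _ _ _ _ b _ d); rewrite BX.
  apply: (sub ([set f a; f b] `|` [set f d; f d])).
    by apply: BP; rewrite -?fac; [left; left|left; right|left; left|right; left].
  apply: metabelianU; [|exact: dih|exact: dih].
  by move=> x y [->|->] [->|->] //; exact: com.
- by case: nB; apply: Or44; exists [:: a; b; c; d]; rewrite BX.
- have /chain4P[_ _ [ac bd ad]] := cX.
  have fbc : commute (f b) (f c).
    by apply: fcom => //; apply: fR; apply: (@relator_F4 _ _ _ a _ _ d); rewrite BX.
  apply: (sub ([set f a; f b] `|` [set f c; f d])).
    by apply: BP; [left; left|left; right|right; left|right; right].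
  apply: metabelianU; [|exact: dih|exact: dih].
  by move=> x y [->|->] [->|->] //; exact: com.
- rewrite -BX in sX; case: XE sX => <- <- <- <- sX.
  have fab : f a = f b.
    by apply: feq => //; apply: fR; exact: relator_B4_12 sX.
  have fbc : f b = f c.
    by apply: feq => //; apply: fR; exact: relator_B4_23 sX.
  apply: (sub [set f a; f d]); last exact: dih.
  by apply: BP; rewrite -?fbc -?fab; [left|left|left|right].
Qed.

End BaseKernel.

(** * Visual subgroups *)

Section Visual.
Variables (W : groupType) (S : set W) (m : W -> W -> nat).
Hypothesis HS : coxeter_system S m.
Variable R : realType.
Implicit Types (A B T : set W) (s t a b : W).

(** If [s] and [t] commute, then [(t * s) ^+ 2] fixes the simple root of [s]; its Chebyshev
    coordinates, of indices 5 and 4, are thus 1 and 0, which is impossible for a weight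
    that is at least 1. *)
Lemma label_gt2_noncommute s t : S s -> S t -> (2 < m s t)%N -> ~ commute s t.
Proof.
move=> Ss St st cst; have ts4 : altprod t s 4 = 1.
  rewrite (altprod_double t s 2).
  apply/(commute_expg2 (coxeter_invol HS St) (coxeter_invol HS Ss)).
  exact: commute_sym.
have nst : s != t.
  apply/eqP => e; move: st; rewrite (coxeter_matrix_eq1 HS Ss St).2 //.
have E (f : W -> R) := act_altprod HS 4 f Ss St; rewrite ts4 in E.
have := E (delta R t); rewrite act1 /delta (negbTE nst) eqxx.
have := E (delta R s); rewrite act1 /delta eq_sym (negbTE nst) eqxx.
have c1 : (1 <= weight m R s t)%R by apply: edge_weight_ge1; rewrite !inE; lia.
rewrite !chebyshevSS /=; move: (weight m R s t) c1 => c c1; nra.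
Qed.

Lemma generated_visual_inj A B : A `<=` S -> B `<=` S ->
  generated A `<=` generated B -> A `<=` B.
Proof.
move=> AS BS AB s As; apply: (parabolic_gen HS R BS); first exact: AS.
by apply: AB; exact: sub_generated.
Qed.

Section Components.
Variables (T : set W) (TS : T `<=` S).

Lemma c_diagram_sym s t : T s -> T t -> c_diagram m T s t = c_diagram m T t s.
Proof.
move=> Ts Tt; rewrite /c_diagram (coxeter_matrix_sym HS (TS Ts) (TS Tt)).
by rewrite andbCA.
Qed.

Definition component a : set W :=
  [set t | exists2 p, path (c_diagram m T) a p & last a p = t].

Lemma component_refl a : component a a.
Proof. by exists [::]. Qed.

Lemma component_sub a : T a -> component a `<=` T.
Proof.
move=> Ta _ [p + <-]; elim: p a Ta => [//|b p IHp] a Ta /= /andP[/and3P[_ Tb _]].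
by apply: IHp; exact: set_mem.
Qed.

Lemma component_step a s t : component a s -> c_diagram m T s t -> component a t.
Proof.
move=> [p ap <-] st; exists (rcons p t); last by rewrite last_rcons.
by rewrite rcons_path ap.
Qed.

Lemma component_trans a s t : component a s -> component s t -> component a t.
Proof.
move=> as_ [p sp <-]; elim: p s as_ sp => [//|b p IHp] s as_ /= /andP[sb bp].
by apply: IHp bp; exact: component_step sb.
Qed.

Lemma component_sym a s : T a -> component a s -> component s a.
Proof.
move=> Ta [p ap <-]; elim: p a Ta ap => [|b p IHp] a Ta /=; first by move=> _; exact: component_refl.
move=> /andP[ab bp]; have Tb : T b by case/and3P: ab => _ /set_mem.
apply: component_step (IHp b Tb bp) _.
by rewrite c_diagram_sym.
Qed.

Lemma component_irreducible a : T a -> irreducible m (component a).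
Proof.
move=> Ta s t as_ at_.
have [p sp <-] := component_trans (component_sym Ta as_) at_.
exists p => //; elim: p s as_ sp => [//|b p IHp] s as_ /= /andP[sb bp].
have ab := component_step as_ sb.
rewrite IHp // andbT; case/and3P: sb => _ _ sb.
by rewrite /c_diagram (mem_set as_) (mem_set ab).
Qed.

End Components.

Hypothesis finS : finite_set S.

(** A finite irreducible visual set above [A] of maximal cardinality is a base. It is
    not cyclic because it contains two generators that do not commute. *)
Lemma exists_base A : finite_irreducible_visual S m A -> `I_3 #<= A ->
  exists B, [/\ base S m B, A `<=` B & `I_3 #<= B].
Proof.
move=> finA A3; have [l SE] := (finite_seqP _).1 finS.
pose P n := `[< exists B, [/\ finite_irreducible_visual S m B, A `<=` B & `I_n #<= B] >].
have P3 : P 3%N by apply/asboolP; exists A; split.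
have Pmax n : P n -> (n <= size l)%N.
  move=> /asboolP[B [[BS _ _] _ nB]]; rewrite -card_le_II.
  apply: card_le_trans nB (card_le_trans (subset_card_le BS) _).
  by rewrite SE; exact: card_set_seq_le.
have [n /asboolP[B [fB AB nB]] nmax] := ex_maxnP (ex_intro P 3%N P3) Pmax.
have B3 : `I_3 #<= B by apply: card_le_trans A3 (subset_card_le AB).
exists B; split=> //; have [BS irrB finB] := fB; split=> //.
  have [s Bs _] := card_exists_notin B3 (isT : (size ([::] : seq W) < 3)%N).
  have [v Bv vs] := card_exists_notin B3 (isT : (size [:: s] < 3)%N).
  have [|s' [t [s's Bt ts st]]] :=
    boundary_edge HS R BS finB irrB _ (mem_head s [::]) Bv vs.
    by move=> x; rewrite inE => /eqP->.
  move: s's st; rewrite inE => /eqP-> st [x xB].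
  apply: (label_gt2_noncommute (BS _ Bs) (BS _ Bt) st).
  have cx : forall y z, generated [set x] y -> generated [set x] z -> commute y z.
    by apply: commute_generated2 => _ _ -> ->; exact: commute_refl.
  by apply: cx; rewrite -xB; exact: sub_generated.
move=> A' fA' BA'; have [A'S _ _] := fA'.
have sBA' : B `<=` A' by exact: generated_visual_inj.
suff -> : A' = B by [].
apply/seteqP; split=> // v A'v; apply: contrapT => nBv.
have [X BX] := (finite_seqP _).1 (sub_finite_set BS finS).
have uX := undup_uniq X; have {}BX : B = [set` undup X].
  by rewrite BX; apply/seteqP; split=> x /=; rewrite mem_undup.
have nX : (n <= size (undup X))%N.
  rewrite -card_le_II; apply: card_le_trans nB _; rewrite BX; exact: card_set_seq_le.
have : P (size (undup X)).+1.
  apply/asboolP; exists A'; split=> //; first exact: subset_trans AB sBA'.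
  have uv : uniq (v :: undup X).
    by rewrite cons_uniq uX andbT; apply/negP => vX; apply: nBv; rewrite BX.
  apply: card_le_trans (card_set_seq_ge uv) _; apply: subset_card_le => x /=.
  by rewrite inE => /orP[/eqP->//|xX]; apply: sBA'; rewrite BX.
by move=> /nmax; lia.
Qed.

(** Split off one component of [T] after the other; it is small or lies in a base. *)
Lemma metabelian_visual (Q : groupType) (f : {multiplicative W -> Q}) T :
  (forall B x, base S m B -> `I_3 #<= B -> base_kernel m B x -> f x = 1) ->
  T `<=` S -> finite_set (generated T) -> metabelian (generated (f @` T)).
Proof.
move=> fker TS finT.
have irr A : finite_irreducible_visual S m A -> metabelian (generated (f @` A)).
  move=> fA; have [A3|nA3] := pselect (`I_3 #<= A); last first.
    by apply: (metabelian_rank2 HS) => //; case: fA.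
  have [B [bB AB B3]] := exists_base fA A3; have [[BS irrB finB] _ _] := bB.
  apply: metabelianS (base_kernel_metabelian HS BS finB irrB R B3 _).
    by apply: generatedS; exact: image_subset.
  by move=> x; exact: fker.
have [l TE] := (finite_seqP _).1 (sub_finite_set TS finS).
have {TE} : T `<=` [set` l] by rewrite TE.
have [n] := ubnP (size l); elim: n l T TS finT => [//|n IHn] l T TS finT /ltnSE ln Tl.
have [[a Ta]|nT] := pselect (exists a, T a); last first.
  apply: (metabelian_rank2 HS (A := T) TS) => /card_exists_notin => /(_ [::] isT)[v Tv _].
  by apply: nT; exists v.
have TE : T = component T a `|` (T `\` component T a).
  by rewrite setDE setUIr setUv setIT; apply/esym/setUidPr; exact: component_sub.
rewrite TE image_setU; apply: metabelianU.
- move=> _ _ [s as_ <-] [t [Tt nat_] <-].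
  have Ts := component_sub Ta as_.
  apply: gmulf_commute.
  apply/(commute_expg2 (coxeter_invol HS (TS _ Ts)) (coxeter_invol HS (TS _ Tt))).
  have [st|st] := boolP (m s t \in [:: 1; 2]%N); last first.
    case: nat_; apply: component_step as_ _.
    by rewrite /c_diagram (mem_set Ts) (mem_set Tt).
  move: st; rewrite !inE => /orP[] /eqP st; last first.
    by have := coxeter_expg HS (TS _ Ts) (TS _ Tt); rewrite st.
  by case: nat_; rewrite -((coxeter_matrix_eq1 HS (TS _ Ts) (TS _ Tt)).1 st).
- apply: irr; split; [|exact: (component_irreducible TS Ta)|].
  + exact: subset_trans (component_sub Ta) TS.
  + by apply: sub_finite_set finT; apply: generatedS; exact: component_sub.
apply: (IHn [seq x <- l | x != a]).
- by move=> x [/TS].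
- by apply: sub_finite_set finT; apply: generatedS => x [].
- apply: leq_trans _ ln; rewrite size_filter ltn_neqAle count_size andbT -all_count.
  by apply/allPn; exists a; [exact: Tl|rewrite eqxx].
- move=> x [Tx nax] /=; rewrite mem_filter (Tl _ Tx) andbT.
  by apply/eqP => xa; apply: nax; rewrite xa; exact: component_refl.
Qed.

End Visual.

(** * The intrinsic kernel *)

Section Intrinsic.
Variable W : groupType.

Definition finite_second_derived : set W :=
  [set z | exists F : set W, [/\ is_subgroup F, finite_set F & second_derived F z]].

Lemma image_subgroup (f : {multiplicative W -> W}) (F : set W) :
  is_subgroup F -> is_subgroup (f @` F).
Proof.
by move=> sgF; rewrite -(generated_id sgF) image_generated; exact: generated_subgroup.
Qed.

Lemma characteristic_finite_second_derived : characteristic (ncl finite_second_derived).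
Proof.
have sub (phi : {multiplicative W -> W}) :
    bijective phi -> phi @` ncl finite_second_derived `<=` ncl finite_second_derived.
  move=> bphi _ [z Nz <-]; move: z Nz.
  apply: (ncl_min (preim_normal phi (nsvalP (ncl finite_second_derived)))) => z [F [sgF finF Fz]].
  apply: sub_ncl; exists (phi @` F); split.
  - exact: image_subgroup.
  - exact: finite_image.
  - by rewrite -image_second_derived; exists z.
move=> phi bphi; apply/seteqP; split; first exact: sub.
have [psi phiK psiK] := bphi.
pose Psi : {multiplicative W -> W} :=
  HB.pack psi (isMultiplicative.Build _ _ psi (can2_gmulfM phiK psiK)).
move=> z Nz; exists (psi z); last exact: psiK.
by apply: (sub Psi); [exists phi|exists z].
Qed.

Definition conjugation (w : W) : W -> W := fun x => w * x * w^-1.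

Lemma conjugationM w : {morph conjugation w : x y / x * y}.
Proof. by move=> x y; rewrite /conjugation -!mulgA mulKg. Qed.

HB.instance Definition _ w :=
  isMultiplicative.Build W W (conjugation w) (conjugationM w).

(** One inclusion holds because the image of a base in the quotient by the right-hand
    side is metabelian, the other because the finite subgroups become metabelian in
    the quotient by the left-hand side. *)
Lemma coxeter_kernel_intrinsic (R : realType) (S : set W) m :
  coxeter_system S m -> finite_set S ->
  coxeter_kernel S m = ncl finite_second_derived :> set W.
Proof.
move=> HS finS; set N := coxeter_kernel S m; set M := ncl finite_second_derived.
apply/seteqP; split.
  apply: (ncl_min (nsvalP M)) => x [B [bB B3] Bx]; have [[BS irrB finB] _ _] := bB.
  apply/eta1; apply: (base_kernel_collapse HS BS finB irrB R _ Bx).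
  rewrite /metabelian -image_second_derived => _ [z Bz <-]; apply/eta1; apply: sub_ncl.
  by exists (generated B); split=> //; exact: generated_subgroup.
apply: (ncl_min (nsvalP N)) => z [F [sgF finF Fz]].
have [w [T [TS finT FT]]] := finite_subgroup_conjugate HS R finS sgF finF.
have Twz : second_derived (generated T) (conjugation w z).
  apply: (second_derivedS (H := conjugation w @` F)).
    by move=> _ [g Fg <-]; exact: FT.
  by rewrite -image_second_derived; exists z.
have Nwz : nsval N (conjugation w z).
  apply/eta1; have mT : metabelian (generated (eta N @` T)).
    apply: (metabelian_visual HS R finS) => // B x bB B3 Bx.
    by apply/eta1; apply: sub_ncl; exists B.
  apply: mT; rewrite -image_generated -image_second_derived.
  by exists (conjugation w z).
have := nsvalJ w Nwz; congr (nsval N _).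
by rewrite /conjugation /conjg -!mulgA mulVg mulg1 mulKg.
Qed.

End Intrinsic.

Section EdgeRelators.
Variables (W : groupType) (S : set W) (m : W -> W -> nat).
Hypothesis HS : coxeter_system S m.
Variable R : realType.

Let N := coxeter_kernel S m.

Definition edge_relators : set W := [set x | exists s t k,
  [/\ S s, S t, (0 < m s t)%N, k \in [:: 1; 2]%N & x = (s * t) ^+ k /\ nsval N x]].

(** The commutator of two generators is the square of their product, and the other
    relators of a base are explicit. The label is finite inside a base. *)
Lemma coxeter_kernel_edge_relators : nsval N = ncl edge_relators.
Proof.
apply/seteqP; split; last first.
  by apply: (ncl_min (nsvalP N)) => x [s [t [k [_ _ _ _ []]]]].
apply: (ncl_min (nsvalP _)) => x [B [bB B3] Bx]; have [[BS irrB finB] _ _] := bB.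
have BN y : base_kernel m B y -> nsval N y.
  by move=> By; apply: sub_ncl; exists B.
have AB s t k : B s -> B t -> k \in [:: 1; 2]%N -> nsval N ((s * t) ^+ k) ->
    nsval (ncl edge_relators) ((s * t) ^+ k).
  move=> Bs Bt k12 Nst; apply: sub_ncl; exists s, t, k; split=> //; try exact: BS.
  exact: (label_gt0 HS R BS finB).
apply/eta1; pose f : {multiplicative W -> quot (ncl edge_relators)} := eta _.
rewrite -[eta _ x]/(f x).
have inv s : B s -> f s * f s = 1.
  by move=> Bs; rewrite -gmulfM (coxeter_invol HS (BS _ Bs)) gmorph1.
move: Bx BN; rewrite /base_kernel; case: asboolP => _ Bx BN.
  have gBB : forall u v, generated B u -> generated B v -> commute (f u) (f v).
    move=> u v gu gv; apply: (@commute_generated2 _ (f @` B) (f @` B)).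
    - move=> _ _ [s Bs <-] [t Bt <-]; apply/(commute_expg2 (inv _ Bs) (inv _ Bt)).
      rewrite -gmulfM -gmorphX; apply/eta1; apply: AB => //.
      apply: BN; have -> : (s * t) ^+ 2 = [~ s, t].
        rewrite expg2 /commg /conjg (mulg1_eq (coxeter_invol HS (BS _ Bs))).
        by rewrite (mulg1_eq (coxeter_invol HS (BS _ Bt))) !mulgA.
      by apply: mem_commutator; exact: sub_generated.
    - by rewrite -image_generated; exists u.
    - by rewrite -image_generated; exists v.
  move: x Bx; apply: (commutator_subgroup_min (K := f @^-1` [set 1])) => [|u v gu gv] /=.
    by case: (preim_normal f (is_normal1 _)).
  by rewrite gmorphR; apply/eqP/commgP; exact: gBB.
apply/eta1.
have sgB := generated_subgroup B; have sgA := nsval_subgroup (ncl edge_relators).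
pose K := nsval (ncl edge_relators) `&` generated B.
have nK : is_normal (generated B) K.
  split=> [|y []//|y h [Ay By] Bh].
    split=> [|y z [Ay By] [Az Bz]|y [Ay By]].
    - by split; exact: subgroup1.
    - by split; [exact: (subgroupM sgA)|exact: (subgroupM sgB)].
    - by split; [exact: (subgroupV sgA)|exact: (subgroupV sgB)].
  split; first exact: nsvalJ.
  by apply: (subgroupM sgB); [exact: (subgroupV sgB)|exact: (subgroupM sgB)].
suff [] : K x by [].
apply: (normal_closure_min nK) Bx => y By; have Ny := BN y (sub_normal_closure By).
have KX s t k : B s -> B t -> k \in [:: 1; 2]%N -> nsval N ((s * t) ^+ k) ->
    K ((s * t) ^+ k).
  move=> Bs Bt k12 Nst; split; first exact: AB.
  by apply: (subgroupX _ sgB); apply: (subgroupM sgB); exact: sub_generated.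
case: By Ny => [a b c|b1 b2 b3 b4|b1 b2 b3 b4|a b c|a b c d|a b c d] [BX _ _ _] Ny.
- by apply: (KX a c 1%N) => //; rewrite BX /= !inE !eqxx ?orbT.
- by apply: (KX b1 b2 1%N) => //; rewrite BX /= !inE !eqxx ?orbT.
- by apply: (KX b2 b3 1%N) => //; rewrite BX /= !inE !eqxx ?orbT.
- by apply: (KX b c 2%N) => //; rewrite BX /= !inE !eqxx ?orbT.
- by apply: (KX a c 1%N) => //; rewrite BX /= !inE !eqxx ?orbT.
- by apply: (KX b c 2%N) => //; rewrite BX /= !inE !eqxx ?orbT.
Qed.

Lemma coxeter_kernel_edge_quotient_series : finite_set S ->
  edge_quotient_series S (eta N @` S) (eta N).
Proof.
move=> finS; have [l SE] := (finite_seqP _).1 finS.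
pose ok (x : W * W * nat) := (0 < m x.1.1 x.1.2)%N &&
  `[< nsval N ((x.1.1 * x.1.2) ^+ x.2) >].
pose L := [seq x <- [seq (p, k) | p <- [seq (s, t) | s <- l, t <- l], k <- [:: 1; 2]%N] | ok x].
pose x0 : W * W * nat := (1, 1, 0%N).
have LP i : (i < size L)%N -> [/\ S (nth x0 L i).1.1, S (nth x0 L i).1.2 & ok (nth x0 L i)].
  move=> iL; have := mem_nth x0 iL; rewrite mem_filter => /andP[okx].
  case/allpairsP => [[p k] /= [pl _ xE]]; case/allpairsP: pl => [[s t] /= [sl tl pE]].
  by rewrite xE pE /= SE; split=> //; rewrite -pE -xE.
apply: (@coxeter_edge_quotient_series [seq x.2 | x <- L] _ _ S m (eta N)
  (fun i => (nth x0 L i).1.1) (fun i => (nth x0 L i).1.2)) => //.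
- exact: eta_surj.
- by move=> i; rewrite size_map => iL; have [Sa Sb /andP[]] := LP i iL.
move=> g; rewrite eta1; rewrite coxeter_kernel_edge_relators.
suff -> : edge_relators = [set x | exists2 i, (i < size [seq x.2 | x <- L])%N &
    x = ((nth x0 L i).1.1 * (nth x0 L i).1.2) ^+ nth 0%N [seq x.2 | x <- L] i] by [].
apply/seteqP; split=> [x [s [t [k [Ss St mst k12 [xE Nx]]]]]|x [i]]; last first.
  rewrite size_map => iL ->; have [Sa Sb /andP[mab /asboolP Nab]] := LP i iL.
  rewrite (nth_map x0) //; exists (nth x0 L i).1.1, (nth x0 L i).1.2, (nth x0 L i).2.
  split=> //; have := mem_nth x0 iL; rewrite mem_filter => /andP[_].
  by case/allpairsP => [[p k] /= [_ k12 ->]].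
have xL : (s, t, k) \in L.
  rewrite mem_filter; apply/andP; split.
    by rewrite /ok mst -xE; exact/asboolP.
  apply/allpairsP; exists ((s, t), k); split=> //=.
  by apply/allpairsP; exists (s, t); split=> //=; rewrite SE in Ss St.
exists (index (s, t, k) L); first by rewrite size_map index_mem.
by rewrite (nth_map x0) ?index_mem // nth_index.
Qed.

End EdgeRelators.

Lemma normal_subgroup_eq (G : groupType) (N M : normal_subgroup G) :
  nsval N = nsval M -> N = M.
Proof.
case: N M => [N nN] [M nM] /= NM; move: nM; rewrite -NM => nM.
by congr NormalSubgroup; exact: Prop_irrelevance.
Qed.

Local Close Scope group_scope.
Local Close Scope card_scope.

Theorem theorem8p1 (W : groupType) (S : set W) (m : W -> W -> nat)
    (HS : coxeter_system S m) (finS : finite_set S) :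
  let N := coxeter_kernel S m in
  let S2 : set (quot N) := eta N @` S in
  [/\ exists m2 : quot N -> quot N -> nat, coxeter_system S2 m2,
      edge_quotient_series S S2 (eta N),
      characteristic N
    & forall (S' : set W) (m' : W -> W -> nat),
        coxeter_system S' m' -> coxeter_kernel S' m' = N :> set W].
Proof.
have kerE (S' : set W) m' : coxeter_system S' m' ->
    coxeter_kernel S' m' = ncl (@finite_second_derived W) :> set W.
  move=> HS'; apply: (coxeter_kernel_intrinsic Rdefinitions.R HS').
  apply: (finite_coxeter_generators Rdefinitions.R HS' finS).
  by case: HS => _ [].
move=> N S2; split.
- have NE : N = ncl (edge_relators S m).
    exact/normal_subgroup_eq/(coxeter_kernel_edge_relators HS Rdefinitions.R).
  rewrite /S2 NE; exists (fun x y => elt_order (x * y)%g).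
  by apply: (quotient_coxeter_system HS) => x [s [t [k [Ss St _ _ [-> _]]]]]; exists s, t, k.
- exact: (coxeter_kernel_edge_quotient_series HS Rdefinitions.R).
- by rewrite /N (kerE _ _ HS); exact: characteristic_finite_second_derived.
- by move=> S' m' HS'; rewrite (kerE _ _ HS') -(kerE _ _ HS).
Qed.
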